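(* Let $(M,\omega)$ be a connected symplectic 6-manifold and let $\varphi$ be a smooth $\omega$-primitive 3-form on $M$. If $\varphi$ is integrable ($d\varphi=0$) and $F$-integrable ($dF(\varphi)=0$), then $\varphi$ is also $K$-integrable (the Nijenhuis tensor $N_K$ of $K(\varphi)$ vanishes) and $Q$-integrable ($Q(\varphi)$ is a constant function on $M$). Moreover, $\varphi$ is either stable at every point of $M$ or unstable (i.e. not stable) at every point of $M$.
   Context: A 3-form $\varphi$ on a symplectic 6-manifold $(M,\omega)$ is $\omega$-primitive if $\omega\wedge\varphi=0$. For such $\varphi$: $K=K(\varphi)$ is the smooth section of $\mathrm{End}(TM)$ defined by $\iota_{KX}\frac{\omega^3}{3!}=-\iota_X\varphi\wedge\varphi$; $F(\varphi)$ is the 3-form defined by $F(\varphi)(X,Y,Z)=-2\varphi(KX,Y,Z)$; $Q(\varphi)$ is the function defined by $\varphi\wedge F(\varphi)=-Q(\varphi)\frac{\omega^3}{3!}$. The Nijenhuis tensor of $K$ is $$N_K(X,Y)=-K^2[X,Y]+K([KX,Y]+[X,KY])-[KX,KY].$$ A 3-form on a 6-dimensional real vector space $V$ is called stable if its orbit under $\mathrm{GL}(V)$ is open in $\bigwedge^3V^*$; $\varphi$ is stable at $p\in M$ if $\varphi_p\in\bigwedge^3T_p^*M$ is stable. *)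

(* Defs.v *)
From HB Require Import structures.
From mathcomp Require Import all_boot all_order all_algebra all_fingroup.
From mathcomp Require Import all_classical all_reals all_analysis.
Import Order.TTheory GRing.Theory Num.Theory.
Import numFieldNormedType.Exports.

Set Implicit Arguments.
Unset Strict Implicit.
Unset Printing Implicit Defensive.

Local Open Scope classical_set_scope.
Local Open Scope ring_scope.

(** The arguments of a [k]-form on [R^n] are the rows of a [k x n] matrix. *)

Section Exterior.
Variables (R : realType) (n : nat).

Definition multilinear_rows k (a : 'M[R]_(k, n) -> R) :=
  forall (i : 'I_k) (A B C : 'M[R]_(k, n)) (b c : R),
    row i A = b *: row i B + c *: row i C ->
    row' i B = row' i A -> row' i C = row' i A ->
    a A = b * a B + c * a C.

Definition alternating_rows k (a : 'M[R]_(k, n) -> R) :=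
  forall (A : 'M[R]_(k, n)) (i j : 'I_k),
    i != j -> row i A = row j A -> a A = 0.

(** [\bigwedge^k (R^n)^*].  On this finite-dimensional space, the topology
    induced by pointwise convergence is the usual one. *)
Definition alt_forms k : set {ptws 'M[R]_(k, n) -> R} :=
  [set a | multilinear_rows a /\ alternating_rows a].

(** Determinant convention: [(dx1 /\ dx2) (e1, e2) = 1]. *)
Definition wedge p q (a : 'M[R]_(p, n) -> R) (b : 'M[R]_(q, n) -> R)
    (A : 'M[R]_(p + q, n)) : R :=
  (p`! * q`!)%:R^-1 *
  \sum_(s : 'S_(p + q))
    (-1) ^+ s * a (usubmx (row_perm s A)) * b (dsubmx (row_perm s A)).

Definition interior_product k (X : 'rV[R]_n) (a : 'M[R]_(1 + k, n) -> R)
    (A : 'M[R]_(k, n)) : R :=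
  a (col_mx X A).

Definition GL_orbit k (a : 'M[R]_(k, n) -> R) :
    set {ptws 'M[R]_(k, n) -> R} :=
  [set b | exists2 g : 'M[R]_n, g \in unitmx & b = (fun A => a (A *m g))].

Definition stable k (a : 'M[R]_(k, n) -> R) : Prop :=
  open (GL_orbit a : set (subspace (@alt_forms k))).

End Exterior.

Section SixDimensional.
Variables (R : realType) (w : 'M[R]_(2, 6) -> R) (f : 'M[R]_(3, 6) -> R).

Definition volume (A : 'M[R]_(6, 6)) : R :=
  (3`!)%:R^-1 * wedge (wedge w w) w A.

Definition primitive_at : Prop := forall A, wedge w f A = 0.

Definition K_at (X : 'rV[R]_6) : 'rV[R]_6 :=
  xget 0 [set Y : 'rV[R]_6 | forall A : 'M[R]_(5, 6),
    interior_product Y volume A = - wedge (interior_product X f) f A].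

Definition F_at (A : 'M[R]_(1 + 2, 6)) : R :=
  - 2 * f (col_mx (K_at (usubmx A)) (dsubmx A)).

Definition Q_at : R :=
  xget 0 [set q : R | forall A : 'M[R]_(6, 6),
    wedge f F_at A = - q * volume A].

End SixDimensional.

Section Calculus.
Variables (R : realType) (n : nat).

Fixpoint Ck (V : normedModType R) (k : nat) (D : set 'rV[R]_n)
    (f : 'rV[R]_n -> V) : Prop :=
  if k is l.+1 then
    (forall x, D x -> differentiable f x) /\
    (forall v, Ck l D (fun x => 'D_v f x))
  else {in D, continuous f}.

Definition smooth (V : normedModType R) (D : set 'rV[R]_n)
    (f : 'rV[R]_n -> V) : Prop :=
  forall k, Ck k D f.

Definition ext_derivative k (a : 'rV[R]_n -> 'M[R]_(k, n) -> R)
    (x : 'rV[R]_n) (A : 'M[R]_(k.+1, n)) : R :=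
  \sum_(i < k.+1) (-1) ^+ i * 'D_(row i A) (fun y => a y (row' i A)) x.

Definition lie_bracket (X Y : 'rV[R]_n -> 'rV[R]_n) (x : 'rV[R]_n) :
    'rV[R]_n :=
  'D_(X x) Y x - 'D_(Y x) X x.

Definition nijenhuis (K : 'rV[R]_n -> 'rV[R]_n -> 'rV[R]_n)
    (X Y : 'rV[R]_n -> 'rV[R]_n) (x : 'rV[R]_n) : 'rV[R]_n :=
  let KX y := K y (X y) in
  let KY y := K y (Y y) in
  - K x (K x (lie_bracket X Y x))
  + K x (lie_bracket KX Y x + lie_bracket X KY x)
  - lie_bracket KX KY x.

End Calculus.

(** [param i] is only meaningful on [chart i @` chart_dom i], where it is the
    inverse of [chart i]. *)
Record manifold (R : realType) (n : nat) := Manifold {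
  carrier :> topologicalType;
  carrier_hausdorff : hausdorff_space carrier;
  carrier_second_countable : @second_countable carrier;
  chart_index : Type;
  chart_dom : chart_index -> set carrier;
  chart : chart_index -> carrier -> 'rV[R]_n;
  param : chart_index -> 'rV[R]_n -> carrier;
  chart_cover : \bigcup_i chart_dom i = [set: carrier];
  chart_dom_open : forall i, open (chart_dom i);
  chart_open : forall i, open (chart i @` chart_dom i);
  chartK : forall i p, chart_dom i p -> param i (chart i p) = p;
  chart_continuous : forall i, {within chart_dom i, continuous (chart i)};
  param_continuous :
    forall i, {within chart i @` chart_dom i, continuous (param i)};
  transition_smooth : forall i j,
    smooth (chart i @` (chart_dom i `&` chart_dom j)) (chart j \o param i)
}.

Section Fields.
Variables (R : realType) (n : nat) (M : manifold R n).

Definition transition (i j : chart_index M) : 'rV[R]_n -> 'rV[R]_n :=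
  @chart R n M j \o @param R n M i.

(** A field on [M] is the family of its coordinate expressions: the value
    at [p] in the chart [i] is read at the point [chart i p] of [R^n].  The
    differential of a transition map acts on row vectors by right
    multiplication by its Jacobian matrix. *)

Definition form_field (k : nat) : Type :=
  chart_index M -> 'rV[R]_n -> 'M[R]_(k, n) -> R.

Definition smooth_form k (a : form_field k) : Prop :=
  [/\ forall i p, chart_dom i p -> @alt_forms R n k (a i (chart i p)),
      forall i A, smooth (@chart R n M i @` chart_dom i) (fun x => a i x A)
    & forall i j p, chart_dom i p -> chart_dom j p -> forall A,
        a i (chart i p) A =
        a j (chart j p) (A *m jacobian (transition i j) (chart i p))].

Definition closed_form k (a : form_field k) : Prop :=
  forall i p, chart_dom i p -> forall A, ext_derivative (a i) (chart i p) A = 0.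

Definition smooth_vector_field (U : set M)
    (X : chart_index M -> 'rV[R]_n -> 'rV[R]_n) : Prop :=
  (forall i, smooth (@chart R n M i @` (chart_dom i `&` U)) (X i)) /\
  (forall i j p, U p -> chart_dom i p -> chart_dom j p ->
     X j (chart j p) =
     X i (chart i p) *m jacobian (transition i j) (chart i p)).

Definition nondegenerate (w : form_field 2) : Prop :=
  forall i p, chart_dom i p -> forall u : 'rV[R]_n,
    (forall v : 'rV[R]_n, w i (chart i p) (col_mx u v) = 0) -> u = 0.

Definition symplectic (w : form_field 2) : Prop :=
  [/\ smooth_form w, closed_form w & nondegenerate w].

(** For a form field satisfying [smooth_form], this does not depend on the
    chart used to identify [T_p M] with [R^n]. *)
Definition stable_at k (a : form_field k) (p : M) : Prop :=
  exists2 i, chart_dom i p & stable (a i (chart i p)).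

End Fields.

Section PrimitiveForms.
Variables (R : realType) (M : manifold R 6).
Variables (w : form_field M 2) (f : form_field M 3).

Definition primitive : Prop :=
  forall i p, chart_dom i p -> primitive_at (w i (chart i p)) (f i (chart i p)).

Definition K_field (i : chart_index M) (x : 'rV[R]_6) : 'rV[R]_6 -> 'rV[R]_6 :=
  K_at (w i x) (f i x).

Definition F_field : form_field M 3 := fun i x => F_at (w i x) (f i x).

Definition Q_field (i : chart_index M) (x : 'rV[R]_6) : R := Q_at (w i x) (f i x).

Definition d_integrable : Prop := closed_form f.

Definition F_integrable : Prop := closed_form F_field.

(** Vanishing of the tensor [N_K] is tested on all local vector fields. *)
Definition K_integrable : Prop :=
  forall U : set M, open U ->
  forall X Y, smooth_vector_field U X -> smooth_vector_field U Y ->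
  forall i p, chart_dom i p -> U p ->
    nijenhuis (K_field i) (X i) (Y i) (chart i p) = 0.

Definition Q_integrable : Prop :=
  exists c : R, forall i p, chart_dom i p -> Q_field i (chart i p) = c.

End PrimitiveForms.

(* Main.v *)
(** For 3-forms [f], [g] on [R^6] let [T(f, g)] be the matrix for which
    [(i_{e_u} f) /\ g] is the contraction of [det] with row [u] of [T(f, g)], and
    let [rho] be the Pfaffian of [omega]; then [K = - T(phi, phi) / rho].  Writing
    [P = phi(K ., ., .) = - F / 2], the form [P] is alternating, so [K] acts on
    [phi] as a derivation by [3 P]; the equivariance of [T] under [gl_6] gives
    [T(P, phi) + T(phi, P) = 0], hence [K^2] is a scalar, proportional to [Q], and
    [T(phi, P)] is half the pairing [<phi, P>].

    [Q] is constant: as [phi] and [P] are closed, the divergence of row [u] of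
    [T(phi, P)] is [<d_u phi, P>]; comparing with the derivative of
    [<phi, P> / 2] gives [<d_u phi, P> = <phi, d_u P>], i.e. [tr (K d_u K) = 0].

    [N_K = 0]: by Cartan's formula the Lie derivative of [phi] along [K x] is
    [d (i_{Kx} phi) = d (i_x P)], the Lie derivative of [P] along [x].  Differentiating
    [T(phi, phi) = - rho K] in the direction [K x] then yields
    [N_K(x, y) = - s(x) K y] for a linear form [s], and the antisymmetry of [N_K]
    makes this vanish.

    Stability: [K^2], computed with the volume form [det], is a quartic polynomial
    [q] in the 3-form.  Forms with [q <> 0] are brought to a normal form depending on
    the sign of [q] only, and the zero set of [q], which is invariant under [GL_6],
    contains no open set.  Thus [phi] is stable at [p] iff [Q(p) <> 0]. *)

Require Import Defs.
From HB Require Import structures.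
From mathcomp Require Import all_boot all_order all_algebra all_fingroup.
From mathcomp Require Import all_classical all_reals all_analysis.
From mathcomp Require Import ring lra zify.
Import Order.TTheory GRing.Theory Num.Theory.

Set Implicit Arguments.
Unset Strict Implicit.
Unset Printing Implicit Defensive.

Local Open Scope classical_set_scope.
Local Open Scope ring_scope.

(** * Coefficients of 3-forms in dimension 6 *)

(** The charts are arbitrary rather than Darboux, so the Pfaffian rho varies from point to point.
    Its derivatives are carried through the computation, where they cancel or contribute only
    multiples of K.

    Contracting [phi /\ P] with a vector shows that T(phi, P) - T(P, phi) is the scalar <phi, P>.
    Together with the vanishing of the sum of the two matrices, this makes both of them scalar. The
    divergence of row u of T(phi, P) is then just a partial derivative of <phi, P> / 2, which is how
    the closedness of phi and P gets to bear on Q.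

    The basic identities are polynomial in the coefficients of the forms and are checked by [ring]
    at concrete indices. Their first-order versions are polarizations: the 1-jet at a point is
    independent data, constrained only by the linear equations that express closedness. *)

Section Coef.
Variable R : comNzRingType.
Implicit Types f g : nat -> nat -> nat -> R.

(** Coefficients are indexed by [nat], with only indices below 6 meaningful.
    [alt2] and [alt3] extend the values at increasing indices by antisymmetry, so
    that the identities below are ring identities between independent variables. *)
Definition alt3 f i j k : R :=
  if (i < j)%N then
    if (j < k)%N then f i j k else if j == k then 0
    else if (i < k)%N then - f i k j else if i == k then 0 else f k i j
  else if i == j then 0 else
    if (i < k)%N then - f j i k else if i == k then 0
    else if (j < k)%N then f j k i else if j == k then 0 else - f k j i.

Definition alt2 (a : nat -> nat -> R) i j : R :=
  if (i < j)%N then a i j else if i == j then 0 else - a j i.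

(** The value of [a /\ b] on the vectors numbered [i j k l m], one term for each (2,3)-shuffle. *)
Definition shuffle23 (a : nat -> nat -> R) (b : nat -> nat -> nat -> R) i j k l m : R :=
  a i j * b k l m - a i k * b j l m + a i l * b j k m - a i m * b j k l
  + a j k * b i l m - a j l * b i k m + a j m * b i k l
  + a k l * b i j m - a k m * b i j l + a l m * b i j k.

(** [a /\ g] is the contraction of [det] with the vector of entries [codim1_coef a g m]. *)
Definition codim1_coef (a : nat -> nat -> R) g m : R :=
  (-1) ^+ m * shuffle23 a g (bump m 0) (bump m 1) (bump m 2) (bump m 3) (bump m 4).

(** The entry in row [u] and column [m] of the matrix T(f, g) of the overview. *)
Definition iwedge f g u m : R := codim1_coef (f u) g m.

Definition sum6 (F : nat -> R) : R := F 0%N + F 1%N + F 2%N + F 3%N + F 4%N + F 5%N.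

(** The coefficient of [f /\ g] with respect to [det]. *)
Definition pair3 f g : R :=
  f 0 1 2 * g 3 4 5 - f 0 1 3 * g 2 4 5 + f 0 1 4 * g 2 3 5 - f 0 1 5 * g 2 3 4
  + f 0 2 3 * g 1 4 5 - f 0 2 4 * g 1 3 5 + f 0 2 5 * g 1 3 4
  + f 0 3 4 * g 1 2 5 - f 0 3 5 * g 1 2 4 + f 0 4 5 * g 1 2 3
  - f 1 2 3 * g 0 4 5 + f 1 2 4 * g 0 3 5 - f 1 2 5 * g 0 3 4
  - f 1 3 4 * g 0 2 5 + f 1 3 5 * g 0 2 4 - f 1 4 5 * g 0 2 3
  + f 2 3 4 * g 0 1 5 - f 2 3 5 * g 0 1 4 + f 2 4 5 * g 0 1 3
  - f 3 4 5 * g 0 1 2.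

Definition nat_act1 (E : nat -> nat -> R) f i j k : R := sum6 (fun n => E i n * f n j k).
Definition nat_act (E : nat -> nat -> R) f i j k : R :=
  sum6 (fun n => E i n * f n j k + E j n * f i n k + E k n * f i j n).

Lemma lt6P (Q : nat -> Prop) : Q 0 -> Q 1 -> Q 2 -> Q 3 -> Q 4 -> Q 5 ->
  forall i, (i < 6)%N -> Q i.
Proof. by move=> ? ? ? ? ? ?; do 6 (case=> //). Qed.

(** Contracting [f /\ g] with [e_u] gives [i_u f /\ g - f /\ i_u g], and the 2-form [i_u g] commutes
    with [f]. The left side thus describes the contraction of a multiple of [det]. *)
Lemma iwedge_asym f g u m : (u < 6)%N -> (m < 6)%N ->
  iwedge (alt3 f) (alt3 g) u m - iwedge (alt3 g) (alt3 f) u m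
  = pair3 (alt3 f) (alt3 g) * (u == m)%:R.
Proof.
move: u; apply: lt6P; move: m; apply: lt6P;
rewrite /iwedge /codim1_coef /shuffle23 /pair3 /alt3 /=; ring.
Qed.

(** Here and in the next two lemmas, let K = T(f, f); the claim is that f(K x, y, z) alternates.
    Indeed f(K x, x, z) is proportional to the top form [i_x f /\ i_x f /\ i_z f]. Its contraction
    with x is proportional to the contraction with z of the cube of [i_x f], a top form annihilated
    by x and hence 0. *)
Lemma nat_act1_swap12 f i j k : (i < j)%N -> (j < k)%N -> (k < 6)%N ->
  nat_act1 (iwedge (alt3 f) (alt3 f)) (alt3 f) j i k =
    - nat_act1 (iwedge (alt3 f) (alt3 f)) (alt3 f) i j k.
Proof.
move=> ij jk k6; have j6 := ltn_trans jk k6; have i6 := ltn_trans ij j6.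
move: i i6 j j6 k k6 ij jk; do 3 apply: lt6P; move=> // _ _;
rewrite /nat_act1 /sum6 /iwedge /codim1_coef /shuffle23 /alt3 /=; ring.
Qed.

Lemma nat_act1_swap13 f i j k : (i < j)%N -> (j < k)%N -> (k < 6)%N ->
  nat_act1 (iwedge (alt3 f) (alt3 f)) (alt3 f) k j i =
    - nat_act1 (iwedge (alt3 f) (alt3 f)) (alt3 f) i j k.
Proof.
move=> ij jk k6; have j6 := ltn_trans jk k6; have i6 := ltn_trans ij j6.
move: i i6 j j6 k k6 ij jk; do 3 apply: lt6P; move=> // _ _;
rewrite /nat_act1 /sum6 /iwedge /codim1_coef /shuffle23 /alt3 /=; ring.
Qed.

Lemma nat_act1_alt0 f i k : (i < 6)%N -> (k < 6)%N ->
  nat_act1 (iwedge (alt3 f) (alt3 f)) (alt3 f) i i k = 0.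
Proof.
move: i; apply: lt6P; move: k; apply: lt6P;
rewrite /nat_act1 /sum6 /iwedge /codim1_coef /shuffle23 /alt3 /=; ring.
Qed.

(** Leibniz rule for the derivation [E] on the 5-form [a /\ g]. When 5-forms are identified with
    vectors through [det], [E] acts as its trace minus right multiplication by [E]. *)
Lemma codim1_coef_act E a g m : (m < 6)%N ->
  codim1_coef (fun j k => sum6 (fun n => E j n * alt2 a n k + E k n * alt2 a j n)) (alt3 g) m
  + codim1_coef (alt2 a) (nat_act E (alt3 g)) m =
  sum6 (fun n => E n n) * codim1_coef (alt2 a) (alt3 g) m
  - sum6 (fun n => codim1_coef (alt2 a) (alt3 g) n * E n m).
Proof.
move: m; apply: lt6P; rewrite /codim1_coef /shuffle23 /nat_act /sum6 /alt3 /alt2 /=; ring.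
Qed.

Lemma alt3_alt2 f u i j : alt3 f u i j = alt2 (alt3 f u) i j.
Proof.
rewrite /alt2 /alt3; case: (ltngtP i j) => [//|ji|<-].
  case: (ltngtP u i) => [ui|ui|ui]; case: (ltngtP u j) => [uj|uj|uj];
    rewrite ?opprK ?oppr0 -?ui ?ltnn ?eqxx //; lia.
by case: (ltngtP u i).
Qed.

Lemma codim1_coef_ext (a a' : nat -> nat -> R) g m : (forall i j, a i j = a' i j) ->
  codim1_coef a g m = codim1_coef a' g m.
Proof. by move=> aa; rewrite /codim1_coef /shuffle23 !aa. Qed.

Lemma codim1_coef_lin (x : nat -> R) (a : nat -> nat -> nat -> R) b g m :
  codim1_coef (fun i j => sum6 (fun n => x n * a n i j) + b i j) g m =
  sum6 (fun n => x n * codim1_coef (a n) g m) + codim1_coef b g m.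
Proof. rewrite /codim1_coef /shuffle23 /sum6; ring. Qed.

(** Infinitesimal equivariance of T: [codim1_coef_act] supplemented by the action on the index [u]
    of the contracting vector. *)
Lemma iwedge_act E f g u m : (m < 6)%N ->
  iwedge (nat_act E (alt3 f)) (alt3 g) u m + iwedge (alt3 f) (nat_act E (alt3 g)) u m =
  sum6 (fun n => E n n) * iwedge (alt3 f) (alt3 g) u m
  + sum6 (fun n => E u n * iwedge (alt3 f) (alt3 g) n m)
  - sum6 (fun n => iwedge (alt3 f) (alt3 g) u n * E n m).
Proof.
move=> m6; have h i j : alt3 f u i j = alt2 (alt3 f u) i j by exact: alt3_alt2.
have e g' n : codim1_coef (alt2 (alt3 f u)) g' n = iwedge (alt3 f) g' u n.
  by rewrite /iwedge /codim1_coef /shuffle23 -!h.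
have -> : iwedge (nat_act E (alt3 f)) (alt3 g) u m =
  sum6 (fun n => E u n * iwedge (alt3 f) (alt3 g) n m)
    + codim1_coef (fun j k => sum6 (fun n =>
      E j n * alt2 (alt3 f u) n k + E k n * alt2 (alt3 f u) j n))
        (alt3 g) m.
  rewrite -codim1_coef_lin; apply: codim1_coef_ext => j k.
  by rewrite /nat_act /sum6 !h; ring.
rewrite -addrA -(e (nat_act E (alt3 g))) codim1_coef_act // /sum6 !e; ring.
Qed.

(** [E f] is the sum of the forms [E u n * e^u /\ i_n f]. Since [i_n f /\ g] is [det] contracted
    with row [n] of T(f, g), wedging it with [e^u] picks out the entry [iwedge f g n u]. *)
Lemma pair3_nat_act (E : nat -> nat -> R) f g : 
  pair3 (nat_act E (alt3 f)) (alt3 g)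
  = sum6 (fun u => sum6 (fun n => E u n * iwedge (alt3 f) (alt3 g) n u)).
Proof. rewrite /pair3 /iwedge /codim1_coef /shuffle23 /nat_act /sum6 /alt3 /=; ring. Qed.

(** The trace is the coefficient of the sum of [e^u /\ i_u f /\ f], that is of [3 f /\ f], and a
    3-form has square 0. *)
Lemma iwedge_tr f : sum6 (fun u => iwedge (alt3 f) (alt3 f) u u) = 0.
Proof. rewrite /iwedge /codim1_coef /shuffle23 /sum6 /alt3 /=; ring. Qed.

(** The divergence of a vector field is [d] of its contraction with [det]. The first argument of
    [pair3] consists of the coefficients of [d (i_u f)], with [g] held constant. *)
Lemma div_iwedge_left (df : nat -> nat -> nat -> nat -> R) g u : (u < 6)%N ->
  sum6 (fun m => iwedge (alt3 (df m)) (alt3 g) u m) =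
  pair3 (fun i j k => alt3 (df i) u j k - alt3 (df j) u i k + alt3 (df k) u i j)
    (alt3 g).
Proof.
move: u; apply: lt6P; rewrite /iwedge /codim1_coef /shuffle23 /sum6 /pair3 /alt3 /=; ring.
Qed.

Definition dcoef (dg : nat -> nat -> nat -> nat -> R) a i j k :=
  dg a i j k - dg i a j k + dg j a i k - dg k a i j.

Lemma div_iwedge_right f (dg : nat -> nat -> nat -> nat -> R) u : (u < 6)%N ->
  (forall a i j k, (a < 6)%N -> (i < 6)%N -> (j < 6)%N -> (k < 6)%N -> 
     dcoef (fun n => alt3 (dg n)) a i j k = 0) ->
  sum6 (fun m => iwedge (alt3 f) (alt3 (dg m)) u m) = 0.
Proof.
move=> u6 d0; set D := dcoef (fun n => alt3 (dg n)).
(* These are the fifteen (2,4)-shuffles of [i_u f /\ dg]. *)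
transitivity (alt3 f u 0 1 * D 2 3 4 5 - alt3 f u 0 2 * D 1 3 4 5
 + alt3 f u 0 3 * D 1 2 4 5 - alt3 f u 0 4 * D 1 2 3 5 + alt3 f u 0 5 * D 1 2 3 4
 + alt3 f u 1 2 * D 0 3 4 5 - alt3 f u 1 3 * D 0 2 4 5 + alt3 f u 1 4 * D 0 2 3 5
 - alt3 f u 1 5 * D 0 2 3 4 + alt3 f u 2 3 * D 0 1 4 5 - alt3 f u 2 4 * D 0 1 3 5
 + alt3 f u 2 5 * D 0 1 3 4 + alt3 f u 3 4 * D 0 1 2 5 - alt3 f u 3 5 * D 0 1 2 4
 + alt3 f u 4 5 * D 0 1 2 3); last by rewrite /D !d0 //; ring.
rewrite {}/D {d0}; move: u u6; apply: lt6P;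
  rewrite /iwedge /codim1_coef /shuffle23 /sum6 /dcoef /alt3 /=; ring.
Qed.

End Coef.

(** * Signed permutations and Pfaffians *)

(** Permutations are listed by their first entry, with their parity as a boolean. Unlike a sum over
    ['S_n], a sum over this list reduces by computation. *)
Fixpoint signed_perms n (l : seq nat) : seq (bool * seq nat) :=
  if n is n'.+1 then
    flatten [seq [seq (odd j (+) p.1, nth 0%N l j :: p.2)
                 | p <- signed_perms n' (take j l ++ drop j.+1 l)] | j <- iota 0 n]
  else [:: (false, [::])].

Section Sums.
Variable R : comNzRingType.
(** An unlocked sum, which simplification expands into explicit terms for [ring]. *)
Definition foldsum (I : Type) (s : seq I) (F : I -> R) : R := foldr (fun t x => F t + x) 0 s.
Lemma foldsumE (I : Type) (s : seq I) (F : I -> R) : \sum_(t <- s) F t = foldsum s F.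
Proof. by elim: s => [|t s IH]; rewrite ?big_nil ?big_cons ?IH. Qed.

(** Here and in the next two lemmas the constant is p! q!, the number of permutations that give the
    same shuffle. *)
Lemma sum22 (a b : nat -> nat -> R) :
  \sum_(t <- signed_perms 4 (iota 0 4)) (-1) ^+ t.1 *
    (alt2 a (nth 0%N t.2 0) (nth 0%N t.2 1) * alt2 b (nth 0%N t.2 2) (nth 0%N t.2 3)) =
  4 * (a 0 1 * b 2 3 - a 0 2 * b 1 3 + a 0 3 * b 1 2
     + a 1 2 * b 0 3 - a 1 3 * b 0 2 + a 2 3 * b 0 1).
Proof. rewrite foldsumE /alt2 /= /foldsum /=. ring. Qed.

Lemma sum23 (a : nat -> nat -> R) (b : nat -> nat -> nat -> R) :
  \sum_(t <- signed_perms 5 (iota 0 5)) (-1) ^+ t.1 *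
    (alt2 a (nth 0%N t.2 0) (nth 0%N t.2 1) * alt3 b (nth 0%N t.2 2) (nth 0%N t.2 3)
      (nth 0%N t.2 4)) =
  12 * shuffle23 a b 0 1 2 3 4.
Proof. rewrite foldsumE /alt2 /alt3 /shuffle23 /= /foldsum /=. ring. Qed.

Lemma sum33 (a b : nat -> nat -> nat -> R) :
  \sum_(t <- signed_perms 6 (iota 0 6)) (-1) ^+ t.1 *
    (alt3 a (nth 0%N t.2 0) (nth 0%N t.2 1) (nth 0%N t.2 2) * alt3 b (nth 0%N t.2 3)
      (nth 0%N t.2 4) (nth 0%N t.2 5)) =
  36 * pair3 a b.
Proof.
set s := signed_perms _ _; vm_compute in s; rewrite {}/s foldsumE /foldsum /alt3 /pair3 /=; ring.
Qed.

Definition pf4 (w : nat -> nat -> R) i j k l := w i j * w k l - w i k * w j l + w i l * w j k.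

Definition pf6 (w : nat -> nat -> R) :=
  w 0 1 * pf4 w 2 3 4 5 - w 0 2 * pf4 w 1 3 4 5 + w 0 3 * pf4 w 1 2 4 5
  - w 0 4 * pf4 w 1 2 3 5 + w 0 5 * pf4 w 1 2 3 4.

(** 144 = 4! * 2! * 3: each perfect matching of the six indices occurs once for each choice of the
    pair assigned to the last factor. *)
Lemma sum42 (w : nat -> nat -> R) :
  \sum_(t <- signed_perms 6 (iota 0 6)) (-1) ^+ t.1 *
    (pf4 (alt2 w) (nth 0%N t.2 0) (nth 0%N t.2 1) (nth 0%N t.2 2) (nth 0%N t.2 3)
     * alt2 w (nth 0%N t.2 4) (nth 0%N t.2 5)) =
  144 * pf6 w.
Proof.
set s := signed_perms _ _; vm_compute in s; rewrite {}/s foldsumE /foldsum /alt2 /pf6 /pf4 /=; ring.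
Qed.

(** The analogue of the adjugate matrix for the Pfaffian. *)
Definition pf_adj (w : nat -> nat -> R) n j : R :=
  if j == n then 0 else
  let k := unbump n j in
  (-1) ^+ k * pf4 (alt2 w) (bump n (bump k 0)) (bump n (bump k 1))
    (bump n (bump k 2)) (bump n (bump k 3)).

(** Expansion of the Pfaffian along row [m]. For distinct [m] and [n] it expands the Pfaffian of a
    matrix in which the rows and columns [m] and [n] agree, which is 0. *)
Lemma pf6_adj (w : nat -> nat -> R) (m n : nat) : (m < 6)%N -> (n < 6)%N ->
  sum6 (fun j => alt2 w m j * pf_adj w n j) = (-1) ^+ m * (m == n)%:R * pf6 w.
Proof.
by move: m; apply: lt6P; move: n; apply: lt6P; rewrite /sum6 /pf_adj /unbump /pf6 /pf4 /alt2 /=;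
  ring.
Qed.

Lemma pf4_sorted (w : nat -> nat -> R) :
  (forall n j, (n < 6)%N -> (j < 6)%N -> pf_adj w n j = 0) ->
  forall a b c d, (a < b)%N -> (b < c)%N -> (c < d)%N -> (d < 6)%N -> pf4 (alt2 w) a b c d = 0.
Proof.
move=> h a b c d ab bc cd d6.
have h' n k : (n < 6)%N -> (k < 5)%N -> pf4 (alt2 w) (bump n (bump k 0)) (bump n (bump k 1))
    (bump n (bump k 2)) (bump n (bump k 3)) = 0.
  move=> n6 k5; have bn : (bump n k < 6)%N.
    apply: (@leq_ltn_trans k.+1) => //.
    by rewrite /bump; case: (n <= k)%N; rewrite ?add1n ?add0n ?leqnSn.
  have := h n _ n6 bn; rewrite /pf_adj eq_sym (negbTE (neq_bump n k)) bumpK.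
  by move=> /(congr1 ( *%R ((-1) ^+ k))); rewrite mulr0 mulrA -expr2 sqrr_sign mul1r.
have c6 := ltn_trans cd d6; have b6 := ltn_trans bc c6; have a6 := ltn_trans ab b6.
(* The pairs [k < n] are the complements of the fifteen 4-element index sets. *)
have := (h' 5%N 0%N isT isT, h' 5%N 1%N isT isT, h' 5%N 2%N isT isT, h' 5%N 3%N isT isT,
  h' 5%N 4%N isT isT,
  (h' 4%N 0%N isT isT, h' 4%N 1%N isT isT, h' 4%N 2%N isT isT, h' 4%N 3%N isT isT,
  (h' 3%N 0%N isT isT, h' 3%N 1%N isT isT, h' 3%N 2%N isT isT,
  (h' 2%N 0%N isT isT, h' 2%N 1%N isT isT, h' 1%N 0%N isT isT)))).
rewrite /= => -[[[[[p1 p2] p3] p4] p5] [[[[q1 q2] q3] q4] [[[r1 r2] r3] [[s1 s2] t1]]]].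
move: {h h'} a a6 b b6 ab c c6 bc d d6 cd; apply: lt6P; apply: lt6P => // _;
by apply: lt6P => // _; apply: lt6P.
Qed.

Lemma alt4_vanish N (g : nat -> nat -> nat -> nat -> R) :
  (forall a b c d, g b a c d = - g a b c d) ->
  (forall a b c d, g a c b d = - g a b c d) ->
  (forall a b c d, g a b d c = - g a b c d) ->
  (forall a c d, g a a c d = 0) ->
  (forall a b c d, (a < b)%N -> (b < c)%N -> (c < d)%N -> (d < N)%N -> g a b c d = 0) ->
  forall a b c d, (a < N)%N -> (b < N)%N -> (c < N)%N -> (d < N)%N -> g a b c d = 0.
Proof.
move=> s1 s2 s3 z1 h.
have z2 a b d : g a b b d = 0 by rewrite s1 s2 z1 !oppr0.
have z3 a b c : g a b c c = 0 by rewrite s2 s3 z2 !oppr0.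
have h1 a b c d : (b < c)%N -> (c < d)%N -> (a < N)%N -> (d < N)%N -> g a b c d = 0.
  move=> bc cd aN dN; case: (ltngtP a b) => [ab|ba|->]; [exact: h| |exact: z1].
  rewrite s1; case: (ltngtP a c) => [ac|ca|->]; [by rewrite h ?oppr0| |by rewrite z2 oppr0].
  rewrite s2; case: (ltngtP a d) => [ad|da|->]; [by rewrite h ?oppr0| |by rewrite z3 !oppr0].
  by rewrite s3 h ?oppr0.
have h2 a b c d : (c < d)%N -> (a < N)%N -> (b < N)%N -> (d < N)%N -> g a b c d = 0.
  move=> cd aN bN dN; case: (ltngtP b c) => [bc|cb|->]; [exact: h1| |exact: z2].
  rewrite s2; case: (ltngtP b d) => [bd|db|->]; [by rewrite h1 ?oppr0| |by rewrite z3 oppr0].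
  by rewrite s3 h1 ?oppr0.
move=> a b c d aN bN cN dN; case: (ltngtP c d) => [cd|dc|->]; [exact: h2| |exact: z3].
by rewrite s3 h2 ?oppr0.
Qed.

End Sums.

(** * Alternating coefficient tensors and the matrix T(f, g) *)

Section Tensor.
Variable R : comNzRingType.
Local Notation coef := ('I_6 -> 'I_6 -> 'I_6 -> R).
Implicit Types c d e : coef.

Definition alt_coef c := [/\ forall i j k, c j i k = - c i j k,
  forall i j k, c i k j = - c i j k & forall i k, c i i k = 0].

Definition nat_coef c (i j k : nat) : R := c (inord i) (inord j) (inord k).

Definition iwedge_mx c d : 'M[R]_6 := \matrix_(u, m) iwedge (nat_coef c) (nat_coef d) u m.
Definition pair_coef c d : R := pair3 (nat_coef c) (nat_coef d).

(** [mx_act] is the action of [E] as a derivation, [mx_act1] the insertion of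
    [E] in the first argument only. *)
Definition mx_act1 (E : 'M[R]_6) c : coef := fun i j k => \sum_n E i n * c n j k.
Definition mx_act (E : 'M[R]_6) c : coef := fun i j k =>
  \sum_n (E i n * c n j k + E j n * c i n k + E k n * c i j n).

Lemma sum6E (F : 'I_6 -> R) : \sum_n F n = sum6 (fun n => F (inord n)).
Proof.
rewrite (eq_bigr (fun n : 'I_6 => F (inord n))) => [|n _]; last by rewrite inord_val.
rewrite -(big_mkord xpredT (fun n => F (inord n))) /index_iota /= !big_cons big_nil.
by rewrite addr0 /sum6 !addrA.
Qed.

Lemma nat_coef_alt3 c : alt_coef c -> forall i j k, (i < 6)%N -> (j < 6)%N -> (k < 6)%N ->
  nat_coef c i j k = alt3 (nat_coef c) i j k.
Proof.
move=> [c12 c23 c0] i j k i6 j6 k6; rewrite /alt3 /nat_coef.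
have c0' x y : c x y y = 0 by rewrite c12 c23 c0 !oppr0.
have c0'' x y : c x y x = 0 by rewrite c23 c0 oppr0.
case: ltngtP => [ij|ji|->]; last by rewrite c0.
- case: ltngtP => [jk|kj|->]; rewrite ?c0' //.
  case: ltngtP => [ik|ki|->]; rewrite ?c0'' //.
  by rewrite c23 c12 opprK.
- case: ltngtP => [ik|ki|->]; rewrite ?c0'' //.
  case: ltngtP => [jk|kj|->]; rewrite ?c0' //.
    by rewrite c12 c23 opprK.
  by rewrite c12 c23 c12 opprK.
Qed.

Lemma iwedge_ext (f f' g g' : nat -> nat -> nat -> R) u m : (u < 6)%N -> (m < 6)%N ->
  (forall i j k, (i < 6)%N -> (j < 6)%N -> (k < 6)%N -> f i j k = f' i j k) ->
  (forall i j k, (i < 6)%N -> (j < 6)%N -> (k < 6)%N -> g i j k = g' i j k) ->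
  iwedge f g u m = iwedge f' g' u m.
Proof.
move=> u6 m6 ff gg; rewrite /iwedge /codim1_coef /shuffle23.
have b h : (h < 5)%N -> (bump m h < 6)%N.
  move=> h5; apply: (@leq_ltn_trans h.+1) => //.
  by rewrite /bump; case: (m <= h)%N; rewrite ?add1n ?add0n ?leqnSn.
by rewrite !ff ?gg ?b.
Qed.

Lemma pair3_ext (f f' g g' : nat -> nat -> nat -> R) : 
  (forall i j k, (i < 6)%N -> (j < 6)%N -> (k < 6)%N -> f i j k = f' i j k) ->
  (forall i j k, (i < 6)%N -> (j < 6)%N -> (k < 6)%N -> g i j k = g' i j k) ->
  pair3 f g = pair3 f' g'.
Proof. by move=> ff gg; rewrite /pair3 !ff ?gg. Qed.

Lemma iwedge_mxE c d u m : iwedge_mx c d u m = iwedge (nat_coef c) (nat_coef d) u m.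
Proof. by rewrite mxE. Qed.

Lemma iwedge_mx_ext c c' d d' : (forall i j k, c i j k = c' i j k) ->
  (forall i j k, d i j k = d' i j k) -> iwedge_mx c d = iwedge_mx c' d'.
Proof.
by move=> cc dd; apply/matrixP => u m; rewrite !mxE; apply: iwedge_ext => // *;
  rewrite /nat_coef ?cc ?dd.
Qed.

Lemma pair_coef_ext c c' d d' : (forall i j k, c i j k = c' i j k) ->
  (forall i j k, d i j k = d' i j k) -> pair_coef c d = pair_coef c' d'.
Proof. by move=> cc dd; apply: pair3_ext => // *; rewrite /nat_coef ?cc ?dd. Qed.

Lemma iwedge_alt3 c d u m : alt_coef c -> alt_coef d -> (u < 6)%N -> (m < 6)%N ->
  iwedge (nat_coef c) (nat_coef d) u m = iwedge (alt3 (nat_coef c)) (alt3 (nat_coef d)) u m.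
Proof. by move=> ac ad u6 m6; apply: iwedge_ext => //; exact: nat_coef_alt3. Qed.

Lemma pair_alt3 c d : alt_coef c -> alt_coef d -> 
  pair3 (nat_coef c) (nat_coef d) = pair3 (alt3 (nat_coef c)) (alt3 (nat_coef d)).
Proof. by move=> ac ad; apply: pair3_ext => //; exact: nat_coef_alt3. Qed.

Lemma iwedge_mx_asym c d : alt_coef c -> alt_coef d -> iwedge_mx c d - iwedge_mx d c =
  (pair_coef c d)%:M.
Proof.
move=> ac ad; apply/matrixP => u m; rewrite !mxE.
by rewrite !iwedge_alt3 // iwedge_asym // mulr_natr /pair_coef pair_alt3.
Qed.

Lemma nat_coef_mx_act (E : 'M[R]_6) c i j k : nat_coef (mx_act E c) i j k =
  nat_act (fun i n => E (inord i) (inord n)) (nat_coef c) i j k.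
Proof. by rewrite /nat_coef /mx_act sum6E /nat_act /nat_coef. Qed.

Lemma nat_coef_mx_act1 (E : 'M[R]_6) c i j k : nat_coef (mx_act1 E c) i j k =
  nat_act1 (fun i n => E (inord i) (inord n)) (nat_coef c) i j k.
Proof. by rewrite /nat_coef /mx_act1 sum6E /nat_act1 /nat_coef. Qed.

Lemma inord_val6 (u : 'I_6) : inord u = u.
Proof. exact: inord_val. Qed.

Lemma nat_act_ext E (f f' : nat -> nat -> nat -> R) i j k :
  (i < 6)%N -> (j < 6)%N -> (k < 6)%N ->
  (forall i j k, (i < 6)%N -> (j < 6)%N -> (k < 6)%N -> f i j k = f' i j k) ->
  nat_act E f i j k = nat_act E f' i j k.
Proof. by move=> i6 j6 k6 ff; rewrite /nat_act /sum6 !ff. Qed.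

Lemma nat_act1_ext E E' (f f' : nat -> nat -> nat -> R) i j k :
  (i < 6)%N -> (j < 6)%N -> (k < 6)%N ->
  (forall i j, (i < 6)%N -> (j < 6)%N -> E i j = E' i j) ->
  (forall i j k, (i < 6)%N -> (j < 6)%N -> (k < 6)%N -> f i j k = f' i j k) ->
  nat_act1 E f i j k = nat_act1 E' f' i j k.
Proof. by move=> i6 j6 k6 EE ff; rewrite /nat_act1 /sum6 !ff // !EE. Qed.

Lemma iwedge_mx_mx_act E c d : alt_coef c -> alt_coef d ->
  iwedge_mx (mx_act E c) d + iwedge_mx c (mx_act E d) =
    \tr E *: iwedge_mx c d + E *m iwedge_mx c d - iwedge_mx c d *m E.
Proof.
move=> ac ad; apply/matrixP => u m; rewrite !mxE.
have h c' d' : alt_coef c' -> alt_coef d' -> 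
    iwedge (nat_coef (mx_act E c')) (nat_coef d') u m =
    iwedge (nat_act (fun i n => E (inord i) (inord n)) (alt3 (nat_coef c'))) (alt3 (nat_coef d'))
      u m.
  move=> ac' ad'; apply: iwedge_ext => //; last exact: nat_coef_alt3.
  by move=> i j k *; rewrite nat_coef_mx_act; apply: nat_act_ext => //; exact: nat_coef_alt3.
have h' c' d' : alt_coef c' -> alt_coef d' -> 
    iwedge (nat_coef d') (nat_coef (mx_act E c')) u m =
    iwedge (alt3 (nat_coef d')) (nat_act (fun i n => E (inord i) (inord n)) (alt3 (nat_coef c')))
      u m.
  move=> ac' ad'; apply: iwedge_ext => //; first exact: nat_coef_alt3.
  by move=> i j k *; rewrite nat_coef_mx_act; apply: nat_act_ext => //; exact: nat_coef_alt3.
rewrite h // h' // iwedge_act // /mxtrace !sum6E iwedge_alt3 // /sum6 !mxE !inordK // !inord_val6.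
by rewrite !iwedge_alt3.
Qed.

Lemma pair_coef_mx_act E c d : alt_coef c -> alt_coef d ->
  pair_coef (mx_act E c) d = \tr (E *m iwedge_mx c d).
Proof.
move=> ac ad; rewrite /pair_coef /mxtrace sum6E.
transitivity (pair3 (nat_act (fun i n => E (inord i) (inord n)) (alt3 (nat_coef c)))
  (alt3 (nat_coef d))).
  apply: pair3_ext; last exact: nat_coef_alt3.
  by move=> i j k *; rewrite nat_coef_mx_act; apply: nat_act_ext => //; exact: nat_coef_alt3.
rewrite pair3_nat_act /sum6 !mxE !sum6E /sum6 !iwedge_mxE !inordK //.
by rewrite !iwedge_alt3.
Qed.

Lemma iwedge_mx_tr c : alt_coef c -> \tr (iwedge_mx c c) = 0.
Proof.
move=> ac; rewrite /mxtrace sum6E -[RHS](iwedge_tr (nat_coef c)) /sum6 !iwedge_mxE !inordK //.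
by rewrite !iwedge_alt3.
Qed.

Lemma mx_act1_alt c : alt_coef c -> alt_coef (mx_act1 (iwedge_mx c c) c).
Proof.
move=> ac; have [c12 c23 c0] := ac.
have h i j k : mx_act1 (iwedge_mx c c) c i j k =
  nat_act1 (iwedge (alt3 (nat_coef c)) (alt3 (nat_coef c))) (alt3 (nat_coef c)) i j k.
  rewrite -{1}(inord_val6 i) -{1}(inord_val6 j) -{1}(inord_val6 k) -/(nat_coef _ _ _ _)
    nat_coef_mx_act1.
  apply: nat_act1_ext => // => [|*]; last exact: nat_coef_alt3.
  by move=> i' j' i6 j6; rewrite iwedge_mxE !inordK //; apply: iwedge_alt3.
pose A := mx_act1 (iwedge_mx c c) c.
have z i k : A i i k = 0 by rewrite /A h nat_act1_alt0.
have a23 i j k : A i k j = - A i j k.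
  by rewrite /A /mx_act1 -sumrN; apply: eq_bigr => n _; rewrite c23 mulrN.
have z23 i j : A i j j = 0.
  by rewrite /A /mx_act1 big1 // => n _; rewrite c12 c23 c0 !oppr0 mulr0.
have s12 (i j k : 'I_6) : (i < j)%N -> (j < k)%N -> A j i k = - A i j k.
  by move=> ij jk; rewrite /A !h nat_act1_swap12.
have s13 (i j k : 'I_6) : (i < j)%N -> (j < k)%N -> A k i j = A i j k.
  move=> ij jk; have e : A k j i = - A i j k by rewrite /A !h nat_act1_swap13.
  by rewrite a23 e opprK.
have lt_swap (i j k : 'I_6) : (i < j)%N -> A j i k = - A i j k.
  move=> ij; case: (ltngtP k j) => [kj|jk|/val_inj ->]; last 2 first.
  - exact: s12.
  - by rewrite a23 !z23 z !oppr0.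
  case: (ltngtP i k) => [ik|ki|/val_inj <-]; last first.
  - by rewrite z23 a23 z !oppr0.
  - by rewrite (a23 j k i) (s13 k i j) // (a23 i k j) (s12 k i j) // opprK.
  - by rewrite (s13 i k j) // a23.
split=> // i j k; case: (ltngtP i j) => [|ji|/val_inj ->]; first exact: lt_swap.
- by rewrite -/(A _ _ _) -/(A i j k) (lt_swap j i) ?opprK.
- by rewrite -/(A _ _ _) z oppr0.
Qed.

(** When insertion in the first slot alternates, the three slots contribute equally to the
    derivation. *)
Lemma mx_act_act1 E c : alt_coef c -> alt_coef (mx_act1 E c) ->
  forall i j k, mx_act E c i j k = 3 * mx_act1 E c i j k.
Proof.
move=> [c12 c23 c0] [e12 e23 e0] i j k; rewrite /mx_act !big_split /=.
have -> : \sum_n E j n * c i n k = mx_act1 E c i j k.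
  by rewrite -[RHS]opprK -e12 /mx_act1 -sumrN; apply: eq_bigr => n _; rewrite c12 mulrN.
have -> : \sum_n E k n * c i j n = mx_act1 E c i j k.
  rewrite -[RHS]opprK -e23 -e12; apply: eq_bigr => n _.
  by rewrite -[c i j n]opprK -c23 -c12.
rewrite -/(mx_act1 E c i j k); ring.
Qed.

Lemma iwedge_mx_addl c c' d : iwedge_mx (fun i j k => c i j k + c' i j k) d =
  iwedge_mx c d + iwedge_mx c' d.
Proof. apply/matrixP => u m; rewrite !mxE /iwedge /codim1_coef /shuffle23 /nat_coef; ring. Qed.
Lemma iwedge_mx_addr c d d' : iwedge_mx c (fun i j k => d i j k + d' i j k) =
  iwedge_mx c d + iwedge_mx c d'.
Proof. apply/matrixP => u m; rewrite !mxE /iwedge /codim1_coef /shuffle23 /nat_coef; ring. Qed.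
Lemma iwedge_mx_scalel a c d : iwedge_mx (fun i j k => a * c i j k) d = a *: iwedge_mx c d.
Proof. apply/matrixP => u m; rewrite !mxE /iwedge /codim1_coef /shuffle23 /nat_coef; ring. Qed.
Lemma iwedge_mx_scaler a c d : iwedge_mx c (fun i j k => a * d i j k) = a *: iwedge_mx c d.
Proof. apply/matrixP => u m; rewrite !mxE /iwedge /codim1_coef /shuffle23 /nat_coef; ring. Qed.

Lemma iwedge_mx_mx_act1 E c d : iwedge_mx (mx_act1 E c) d = E *m iwedge_mx c d.
Proof.
apply/matrixP => u m; rewrite !mxE sum6E /sum6 /iwedge /codim1_coef /shuffle23 !nat_coef_mx_act1
  /nat_act1 /sum6 !iwedge_mxE /iwedge /codim1_coef /shuffle23.
rewrite !inordK // !inord_val6; ring.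
Qed.

Lemma pair_coef_addl c c' d : pair_coef (fun i j k => c i j k + c' i j k) d =
  pair_coef c d + pair_coef c' d.
Proof. rewrite /pair_coef /pair3 /nat_coef; ring. Qed.

Lemma pair_coef_scalel a c d : pair_coef (fun i j k => a * c i j k) d = a * pair_coef c d.
Proof. rewrite /pair_coef /pair3 /nat_coef; ring. Qed.
Lemma pair_coef_scaler a c d : pair_coef c (fun i j k => a * d i j k) = a * pair_coef c d.
Proof. rewrite /pair_coef /pair3 /nat_coef; ring. Qed.
Lemma pair_coef_swap c d : alt_coef c -> alt_coef d -> pair_coef d c = - pair_coef c d.
Proof.
move=> ac ad; have := iwedge_mx_asym ac ad;
  rewrite -opprB iwedge_mx_asym // => /matrixP /(_ ord0 ord0).
by rewrite !mxE eqxx !mulr1n => <-; rewrite opprK.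
Qed.

Definition closed_jet (dc : 'I_6 -> coef) := forall a i j k,
  dc a i j k - dc i a j k + dc j a i k - dc k a i j = 0.

(** For a closed form, [d (i_u f)] is the derivative of [f] along the constant field [e_u], by
    Cartan's formula. *)
Lemma iwedge_mx_div_left (dc : 'I_6 -> coef) d u : (forall a, alt_coef (dc a)) -> alt_coef d ->
  closed_jet dc -> \sum_m iwedge_mx (dc m) d u m = pair_coef (dc u) d.
Proof.
move=> adc ad cl; pose D (a : nat) := nat_coef (dc (inord a)).
transitivity (sum6 (fun m => iwedge (alt3 (D m)) (alt3 (nat_coef d)) u m)).
  by rewrite sum6E /sum6 !iwedge_mxE !inordK // !iwedge_alt3.
rewrite div_iwedge_left // /pair_coef; apply: pair3_ext => i j k i6 j6 k6; last first.
  by rewrite nat_coef_alt3.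
rewrite -!nat_coef_alt3 // /D /nat_coef inord_val6.
have /eqP := cl u (inord i) (inord j) (inord k).
rewrite -!addrA addr_eq0 => /eqP ->; ring.
Qed.

Lemma iwedge_mx_div_right c (dd : 'I_6 -> coef) u : alt_coef c -> (forall a, alt_coef (dd a)) ->
  closed_jet dd -> \sum_m iwedge_mx c (dd m) u m = 0.
Proof.
move=> ac add cl; pose D (a : nat) := nat_coef (dd (inord a)).
transitivity (sum6 (fun m => iwedge (alt3 (nat_coef c)) (alt3 (D m)) u m)).
  by rewrite sum6E /sum6 !iwedge_mxE !inordK // !iwedge_alt3.
apply: div_iwedge_right => // a i j k a6 i6 j6 k6.
by rewrite /dcoef -!nat_coef_alt3 // /D /nat_coef cl.
Qed.

End Tensor.

(** * The 1-jet of a closed form with closed F *)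

Section Jet.
Variable R : numFieldType.
Local Notation coef := ('I_6 -> 'I_6 -> 'I_6 -> R).
Implicit Types c d e : coef.

Lemma alt_coef_lin (a b : R) c d : alt_coef c -> alt_coef d ->
  alt_coef (fun i j k => a * c i j k + b * d i j k).
Proof.
move=> [c1 c2 c3] [d1 d2 d3]; split=> *.
- by rewrite c1 d1 !mulrN opprD.
- by rewrite c2 d2 !mulrN opprD.
- by rewrite c3 d3 !mulr0 addr0.
Qed.

Lemma alt_coef_ext c d : (forall i j k, c i j k = d i j k) -> alt_coef c -> alt_coef d.
Proof. by move=> cd [c1 c2 c3]; split=> *; rewrite -!cd. Qed.

Lemma iwedge_mx_suml (x : 'I_6 -> R) (h : 'I_6 -> coef) d :
  iwedge_mx (fun i j k => \sum_n x n * h n i j k) d = \sum_n x n *: iwedge_mx (h n) d.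
Proof.
apply/matrixP => u m; rewrite summxE sum6E /sum6 !mxE /iwedge /codim1_coef /shuffle23 /nat_coef
  !sum6E /sum6; ring.
Qed.

Lemma iwedge_mx_sumr (x : 'I_6 -> R) (h : 'I_6 -> coef) d :
  iwedge_mx d (fun i j k => \sum_n x n * h n i j k) = \sum_n x n *: iwedge_mx d (h n).
Proof.
apply/matrixP => u m; rewrite summxE sum6E /sum6 !mxE /iwedge /codim1_coef /shuffle23 /nat_coef
  !sum6E /sum6; ring.
Qed.

Lemma mx_act1_scale a E c i j k : mx_act1 (a *: E) c i j k = a * mx_act1 E c i j k.
Proof. by rewrite mulr_sumr; apply: eq_bigr => n _; rewrite mxE mulrA. Qed.

Lemma mx_act1_addl E E' c i j k : mx_act1 (E + E') c i j k = mx_act1 E c i j k + mx_act1 E' c i j k.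
Proof. by rewrite -big_split; apply: eq_bigr => n _; rewrite mxE mulrDl. Qed.

Lemma mx_act1_lin E (a b : R) c d i j k :
  mx_act1 E (fun i j k => a * c i j k + b * d i j k) i j k =
    a * mx_act1 E c i j k + b * mx_act1 E d i j k.
Proof.
by rewrite !mulr_sumr -big_split; apply: eq_bigr => n _ /=; ring.
Qed.

(** Polarization of [mx_act1_alt]. *)
Lemma dmx_act1_alt c d : alt_coef c -> alt_coef d ->
  alt_coef (fun i j k => mx_act1 (iwedge_mx d c + iwedge_mx c d) c i j k +
    mx_act1 (iwedge_mx c c) d i j k).
Proof.
move=> ac ad.
pose Z e := mx_act1 (iwedge_mx e e) e.
pose cp : coef := fun i j k => 1 * c i j k + 1 * d i j k.
pose cm : coef := fun i j k => 1 * c i j k + (-1) * d i j k.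
have acp : alt_coef cp by exact: alt_coef_lin.
have acm : alt_coef cm by exact: alt_coef_lin.
have TE (b : R) : iwedge_mx (fun i j k => 1 * c i j k + b * d i j k)
    (fun i j k => 1 * c i j k + b * d i j k) =
    iwedge_mx c c + b *: (iwedge_mx d c + iwedge_mx c d) + b ^+ 2 *: iwedge_mx d d.
  rewrite iwedge_mx_addl !iwedge_mx_addr !iwedge_mx_scalel !iwedge_mx_scaler !scale1r scalerDr
    scalerA -expr2.
  by rewrite -!addrA; congr (_ + _); rewrite addrCA.
(* The part of the cubic expression [Z (c + d)] that is odd in [d] is its linear part plus [Z d]. *)
apply: (@alt_coef_ext (fun i j k => 2^-1 * (1 * Z cp i j k + (-1) * Z cm i j k) +
  (-1) * Z d i j k)).
  move=> i j k; rewrite /Z TE TE !(mx_act1_lin, mx_act1_addl, mx_act1_scale).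
  by field.
apply: alt_coef_lin; last exact: mx_act1_alt.
by apply: alt_coef_lin; exact: mx_act1_alt.
Qed.

(** First-order version of [mx_act_act1]. Only the sum is known to alternate, so the two terms
    cannot be treated separately. *)
Lemma mx_act_act1_add E E' c c' : alt_coef c -> alt_coef c' ->
  alt_coef (fun i j k => mx_act1 E c i j k + mx_act1 E' c' i j k) ->
  forall i j k, mx_act E c i j k + mx_act E' c' i j k =
    3 * (mx_act1 E c i j k + mx_act1 E' c' i j k).
Proof.
move=> [c12 c23 c0] [d12 d23 d0] [e12 e23 e0] i j k; rewrite /mx_act !big_split /=.
have h (E1 : 'M[R]_6) (c1 : coef) : (forall i j k, c1 j i k = - c1 i j k) ->
    \sum_n E1 j n * c1 i n k = - mx_act1 E1 c1 j i k.
  by move=> c1a; rewrite -sumrN; apply: eq_bigr => n _; rewrite c1a mulrN.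
have h' (E1 : 'M[R]_6) (c1 : coef) : (forall i j k, c1 j i k = - c1 i j k) ->
  (forall i j k, c1 i k j = - c1 i j k) ->
    \sum_n E1 k n * c1 i j n = mx_act1 E1 c1 k i j.
  by move=> c1a c1b; apply: eq_bigr => n _; rewrite c1b c1a opprK.
rewrite !h // !h' // -!/(mx_act1 _ _ _ _ _).
have := e12 i j k; have := e23 i k j; have := e12 i k j.
move: (mx_act1 E c) (mx_act1 E' c') => F G.
move=> h1 h2 h3.
have -> : F i j k - F j i k + F k i j + (G i j k - G j i k + G k i j) =
   F i j k + G i j k - (F j i k + G j i k) + (F k i j + G k i j) by ring.
rewrite h3 h1 -h2; ring.
Qed.

(** [c] and [dc] stand for the value and the first partial derivatives of [phi] at
    a point, [rho] and [drho] for those of the Pfaffian of [omega]. *)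
Section Fixed.
Variables (c : coef) (dc : 'I_6 -> coef) (rho : R) (drho : 'I_6 -> R).
Hypotheses (ac : alt_coef c) (adc : forall a, alt_coef (dc a)) (rho0 : rho != 0).

(** The lock keeps K opaque under entrywise rewriting. *)
Definition Kmx : 'M[R]_6 := locked (- rho^-1 *: iwedge_mx c c).
Lemma KmxE : Kmx = - rho^-1 *: iwedge_mx c c. Proof. by rewrite /Kmx -lock. Qed.
(** The derivative of - T(c, c) / rho in direction [a], by the quotient rule. *)
Definition dKmx a : 'M[R]_6 := locked
  (- rho^-1 *: (iwedge_mx (dc a) c + iwedge_mx c (dc a)) - (drho a / rho) *: Kmx).
Lemma dKmxE a : dKmx a =
  - rho^-1 *: (iwedge_mx (dc a) c + iwedge_mx c (dc a)) - (drho a / rho) *: Kmx.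
Proof. by rewrite /dKmx -lock. Qed.
Definition Kcoef : coef := mx_act1 Kmx c.
Definition dKcoef a : coef := fun i j k => mx_act1 (dKmx a) c i j k + mx_act1 Kmx (dc a) i j k.

Lemma iwedge_mxK : iwedge_mx c c = - rho *: Kmx.
Proof. by rewrite KmxE scalerA mulrNN divff // scale1r. Qed.

Lemma diwedge_mxK a : iwedge_mx (dc a) c + iwedge_mx c (dc a) = - rho *: dKmx a - drho a *: Kmx.
Proof.
rewrite dKmxE; move: Kmx (_ + _) => A S.
by apply/matrixP => u m; rewrite !mxE; field.
Qed.

Lemma Kcoef_alt : alt_coef Kcoef.
Proof.
apply: (@alt_coef_ext (fun i j k => - rho^-1 * mx_act1 (iwedge_mx c c) c i j k + 0 * c i j k)).
  by move=> i j k; rewrite /Kcoef KmxE mx_act1_scale mul0r addr0.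
by apply: alt_coef_lin => //; exact: mx_act1_alt.
Qed.

Lemma dKcoef_alt a : alt_coef (dKcoef a).
Proof.
apply: (@alt_coef_ext (fun i j k => - rho^-1 *
  (mx_act1 (iwedge_mx (dc a) c + iwedge_mx c (dc a)) c i j k + mx_act1 (iwedge_mx c c) (dc a) i j k)
    + - (drho a / rho) * Kcoef i j k)); last first.
  by apply: alt_coef_lin; [exact: dmx_act1_alt | exact: Kcoef_alt].
move=> i j k; rewrite /dKcoef /Kcoef dKmxE KmxE -(scaleNr (drho a / rho)).
rewrite !(mx_act1_scale, mx_act1_addl); ring.
Qed.

Lemma tr_Kmx : \tr Kmx = 0.
Proof. by rewrite KmxE mxtraceZ iwedge_mx_tr // mulr0. Qed.

Lemma tr_dKmx a : \tr (dKmx a) = 0.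
Proof.
have : \tr (iwedge_mx (dc a) c + iwedge_mx c (dc a)) = 0.
  have : \tr (iwedge_mx (fun i j k => 1 * c i j k + 1 * dc a i j k) (fun i j k =>
    1 * c i j k + 1 * dc a i j k)) = 0.
    by apply: iwedge_mx_tr; exact: alt_coef_lin.
  rewrite iwedge_mx_addl !iwedge_mx_addr.
  rewrite !iwedge_mx_scalel !iwedge_mx_scaler.
  rewrite !scale1r.
  set A := iwedge_mx c c; set B := iwedge_mx _ _; set C := iwedge_mx _ c; set D := iwedge_mx _ _.
  have -> : \tr (A + B + (C + D)) = \tr A + \tr D + \tr (C + B).
    rewrite -!(raddfD (@mxtrace R 6)) /=; congr (\tr _).
    by rewrite [C + D]addrC addrACA [B + C]addrC.
  by rewrite /A /D !iwedge_mx_tr // !add0r.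
move=> t0.
rewrite dKmxE -(scaleNr (drho a / rho)) mxtraceD !mxtraceZ tr_Kmx t0; ring.
Qed.

Lemma three_neq0 : 3 != 0 :> R. Proof. by rewrite pnatr_eq0. Qed.
Lemma two_neq0 : 2 != 0 :> R. Proof. by rewrite pnatr_eq0. Qed.

Lemma mx_act_Kmx i j k : mx_act Kmx c i j k = 3 * Kcoef i j k.
Proof. by apply: mx_act_act1 => //; exact: Kcoef_alt. Qed.

Lemma dmx_act_Kmx a i j k : mx_act (dKmx a) c i j k + mx_act Kmx (dc a) i j k = 3 * dKcoef a i j k.
Proof. by apply: mx_act_act1_add => //; exact: dKcoef_alt. Qed.

Lemma iwedge_mx_Kcoefl : iwedge_mx Kcoef c = - rho *: (Kmx *m Kmx).
Proof. by rewrite iwedge_mx_mx_act1 iwedge_mxK -scalemxAr. Qed.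

(** Equivariance applied to [E = K]: the trace term vanishes because K is traceless, and the
    commutator because T(c, c) is a multiple of K. *)
Lemma iwedge_mx_Kcoef_sym0 : iwedge_mx Kcoef c + iwedge_mx c Kcoef = 0.
Proof.
apply: (@scalerI _ _ 3); first exact: three_neq0.
rewrite scaler0 scalerDr -iwedge_mx_scalel -iwedge_mx_scaler.
rewrite -(@iwedge_mx_ext _ (mx_act Kmx c) _ c c) //; last exact: mx_act_Kmx.
rewrite -(@iwedge_mx_ext _ c c (mx_act Kmx c)) //; last exact: mx_act_Kmx.
by rewrite iwedge_mx_mx_act // tr_Kmx scale0r add0r iwedge_mxK -scalemxAr -scalemxAl subrr.
Qed.

Lemma iwedge_mx_Kcoefr : iwedge_mx c Kcoef = (2^-1 * pair_coef c Kcoef)%:M.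
Proof.
have := iwedge_mx_asym ac Kcoef_alt; have := iwedge_mx_Kcoef_sym0; move/eqP;
  rewrite addr_eq0 => /eqP ->.
rewrite opprK -mulr2n -scaler_nat => h.
apply: (@scalerI _ _ 2); first exact: two_neq0.
by rewrite h scale_scalar_mx mulrA divff ?two_neq0 // mul1r.
Qed.

(** The scalar K^2: T(P, c) is - rho K^2, and it is also minus T(c, P), which is half the
    pairing. *)
Definition Ksq : R := pair_coef c Kcoef / (2 * rho).

Lemma Kmx_sqr : Kmx *m Kmx = Ksq%:M.
Proof.
apply: (@scalerI _ _ (- rho)); first by rewrite oppr_eq0.
rewrite -iwedge_mx_Kcoefl; have /eqP := iwedge_mx_Kcoef_sym0; rewrite addr_eq0 => /eqP ->.
rewrite iwedge_mx_Kcoefr -scaleN1r !scale_scalar_mx; congr (_%:M); rewrite /Ksq; field.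
by rewrite rho0.
Qed.

Lemma diwedge_mx_Kcoef_sym0 a : iwedge_mx (dKcoef a) c + iwedge_mx Kcoef (dc a) +
  (iwedge_mx (dc a) Kcoef + iwedge_mx c (dKcoef a)) = 0.
Proof.
apply: (@scalerI _ _ 3); first exact: three_neq0.
rewrite scaler0 !scalerDr -(iwedge_mx_scalel 3 (dKcoef a) c) -(iwedge_mx_scalel 3 Kcoef (dc a))
  -(iwedge_mx_scaler 3 (dc a) Kcoef) -(iwedge_mx_scaler 3 c (dKcoef a)).
have hd : iwedge_mx (fun i j k => 3 * dKcoef a i j k) c =
  iwedge_mx (mx_act (dKmx a) c) c + iwedge_mx (mx_act Kmx (dc a)) c.
  by rewrite -iwedge_mx_addl; apply: iwedge_mx_ext => // i j k; rewrite dmx_act_Kmx.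
have hd' : iwedge_mx c (fun i j k => 3 * dKcoef a i j k) =
  iwedge_mx c (mx_act (dKmx a) c) + iwedge_mx c (mx_act Kmx (dc a)).
  by rewrite -iwedge_mx_addr; apply: iwedge_mx_ext => // i j k; rewrite dmx_act_Kmx.
have h : iwedge_mx (fun i j k => 3 * Kcoef i j k) (dc a) = iwedge_mx (mx_act Kmx c) (dc a).
  by apply: iwedge_mx_ext => // i j k; rewrite mx_act_Kmx.
have h' : iwedge_mx (dc a) (fun i j k => 3 * Kcoef i j k) = iwedge_mx (dc a) (mx_act Kmx c).
  by apply: iwedge_mx_ext => // i j k; rewrite mx_act_Kmx.
rewrite hd hd' h h'.
(* Grouped in this way, equivariance turns the sum into the derivative of the commutator of K with
   T(c, c), which is 0 because T(c, c) = - rho K. *)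
transitivity ((iwedge_mx (mx_act (dKmx a) c) c + iwedge_mx c (mx_act (dKmx a) c)) +
   ((iwedge_mx (mx_act Kmx (dc a)) c + iwedge_mx (dc a) (mx_act Kmx c)) +
    (iwedge_mx (mx_act Kmx c) (dc a) + iwedge_mx c (mx_act Kmx (dc a))))).
  move: (iwedge_mx (mx_act (dKmx a) c) c) (iwedge_mx (mx_act Kmx (dc a)) c)
    (iwedge_mx (mx_act Kmx c) (dc a))
    (iwedge_mx (dc a) (mx_act Kmx c)) (iwedge_mx c (mx_act (dKmx a) c))
      (iwedge_mx c (mx_act Kmx (dc a))).
  by move=> X1 X2 X3 X4 X5 X6; apply/matrixP => u m; rewrite !mxE; ring.
rewrite !iwedge_mx_mx_act // tr_Kmx !scale0r !add0r.
have -> : Kmx *m iwedge_mx (dc a) c - iwedge_mx (dc a) c *m Kmx +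
  (Kmx *m iwedge_mx c (dc a) - iwedge_mx c (dc a) *m Kmx) =
  Kmx *m (iwedge_mx (dc a) c + iwedge_mx c (dc a)) - (iwedge_mx (dc a) c + iwedge_mx c (dc a)) *m
    Kmx.
  by rewrite mulmxDr mulmxDl opprD addrACA.
rewrite tr_dKmx scale0r add0r diwedge_mxK iwedge_mxK mulmxBr mulmxBl -!scalemxAr -!scalemxAl.
move: (dKmx a *m _) (Kmx *m dKmx a) (Kmx *m Kmx) => A B C.
by apply/matrixP => u m; rewrite !mxE; ring.
Qed.

Definition dpair a : R := pair_coef (dc a) Kcoef + pair_coef c (dKcoef a).

Lemma diwedge_mx_Kcoefr a : iwedge_mx (dc a) Kcoef + iwedge_mx c (dKcoef a) = (2^-1 * dpair a)%:M.
Proof.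
have h1 := iwedge_mx_asym (adc a) Kcoef_alt; have h2 := iwedge_mx_asym ac (dKcoef_alt a).
have := diwedge_mx_Kcoef_sym0 a; move/eqP; rewrite addr_eq0 => /eqP h.
have h3 : (dpair a)%:M = iwedge_mx (dc a) Kcoef +
  iwedge_mx c (dKcoef a) - (iwedge_mx (dKcoef a) c + iwedge_mx Kcoef (dc a)).
  by rewrite /dpair raddfD /= -h1 -h2 opprD addrACA [X in _ + X]addrC.
rewrite -scale_scalar_mx h3 h opprK -mulr2n -scaler_nat scalerA mulVf ?two_neq0 //.
by rewrite scale1r.
Qed.

Hypotheses (cl : closed_jet dc) (clP : closed_jet dKcoef).

(** Both sides compute the divergence of row [u] of [T(phi, P)]. *)
Lemma pair_coef_dcK u : pair_coef (dc u) Kcoef = 2^-1 * dpair u.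
Proof.
transitivity (\sum_m (iwedge_mx (dc m) Kcoef + iwedge_mx c (dKcoef m)) u m).
  rewrite (eq_bigr (fun m => iwedge_mx (dc m) Kcoef u m + iwedge_mx c (dKcoef m) u m)) => [|m _];
    last by rewrite mxE.
  by rewrite big_split /= (iwedge_mx_div_left u adc Kcoef_alt cl)
    (iwedge_mx_div_right u ac dKcoef_alt clP) addr0.
rewrite (bigD1 u) //= big1 => [|m mu']; first by rewrite addr0 diwedge_mx_Kcoefr mxE eqxx mulr1n.
by rewrite diwedge_mx_Kcoefr mxE eq_sym (negbTE mu') mulr0n.
Qed.

Lemma pair_coef_cdK u : pair_coef c (dKcoef u) = 2^-1 * dpair u.
Proof.
have h := pair_coef_dcK u; apply: (addrI (pair_coef (dc u) Kcoef)).
rewrite -/(dpair u) {1}h; by field.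
Qed.

Lemma pair_coef_Kcoef d : alt_coef d -> 3 * pair_coef d Kcoef = - \tr (Kmx *m iwedge_mx c d).
Proof.
move=> ad; rewrite (pair_coef_swap Kcoef_alt ad) mulrN -pair_coef_mx_act //; congr (- _).
by rewrite -pair_coef_scalel; apply: pair_coef_ext => // i j k; rewrite mx_act_Kmx.
Qed.

Lemma tr_Kmx_sqr : \tr (Kmx *m Kmx) * rho = 3 * pair_coef c Kcoef.
Proof. by rewrite pair_coef_Kcoef // iwedge_mxK -scalemxAr mxtraceZ mulNr opprK mulrC. Qed.

(** Both sides of <dc, P> = <c, dP> are written as traces against T. The matrices T(dc, c) and T(c,
    dc) differ by a scalar, which the traceless K does not see, so only the trace of dK T(c, c)
    survives. *)
Lemma tr_Kmx_dKmx a : \tr (Kmx *m dKmx a) = 0.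
Proof.
have := pair_coef_dcK a; rewrite -pair_coef_cdK => /(congr1 (fun x => 3 * x)).
rewrite pair_coef_Kcoef // (pair_coef_swap (dKcoef_alt a) ac) mulrN.
have -> : 3 * pair_coef (dKcoef a) c = \tr (dKmx a *m iwedge_mx c c) +
  \tr (Kmx *m iwedge_mx (dc a) c).
  rewrite -!pair_coef_mx_act // -pair_coef_addl -pair_coef_scalel; apply: pair_coef_ext => // i j k.
  by rewrite dmx_act_Kmx.
have -> : iwedge_mx (dc a) c = iwedge_mx c (dc a) + (pair_coef (dc a) c)%:M.
  by rewrite -(iwedge_mx_asym (adc a) ac) addrC subrK.
rewrite mulmxDr mul_mx_scalar mxtraceD mxtraceZ tr_Kmx mulr0 addr0 iwedge_mxK -scalemxAr.
rewrite mxtraceZ opprD -[LHS]add0r => /addIr /eqP.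
rewrite mulNr opprK eq_sym mulf_eq0 (negbTE rho0) /= => /eqP.
by rewrite mxtrace_mulC.
Qed.

(** This says that <c, P> / rho has derivative 0. Up to the factor 6, <dc, P> is minus the trace of
    K against the derivative of - rho K, and by [tr_Kmx_dKmx] only the term with [drho] remains. *)
Lemma dpairE a : dpair a = drho a / rho * pair_coef c Kcoef.
Proof.
have h : 3 * (2 * (2^-1 * dpair a)) = drho a * \tr (Kmx *m Kmx).
  rewrite -pair_coef_dcK mulrCA pair_coef_Kcoef // mulrN.
  have -> : 2 * \tr (Kmx *m iwedge_mx c (dc a)) =
    \tr (Kmx *m (iwedge_mx (dc a) c + iwedge_mx c (dc a))).
    have -> : iwedge_mx (dc a) c = iwedge_mx c (dc a) + (pair_coef (dc a) c)%:M.
      by rewrite -(iwedge_mx_asym (adc a) ac) addrC subrK.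
    rewrite !mulmxDr mul_mx_scalar !mxtraceD mxtraceZ tr_Kmx mulr0 addr0.
    by rewrite mulr_natl mulr2n.
  rewrite diwedge_mxK mulmxBr -!scalemxAr raddfB /= !mxtraceZ tr_Kmx_dKmx mulr0 sub0r opprK.
  by [].
apply: (mulfI three_neq0); rewrite mulrCA -tr_Kmx_sqr mulrC -[LHS](_ :
  3 * (2 * (2^-1 * dpair a)) = _).
  by rewrite h; field; rewrite rho0.
by field.
Qed.

(** The derivative of K^2, which is a scalar proportional to <c, P> / rho and so has derivative
    0. *)
Lemma dKmx_anticomm a : dKmx a *m Kmx + Kmx *m dKmx a = 0.
Proof.
apply: (@scalerI _ _ (- rho)); first by rewrite oppr_eq0.
have h : iwedge_mx (dKcoef a) c + iwedge_mx Kcoef (dc a) =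
  - rho *: (dKmx a *m Kmx + Kmx *m dKmx a) - drho a *: (Kmx *m Kmx).
  rewrite /dKcoef iwedge_mx_addl !iwedge_mx_mx_act1 iwedge_mxK -addrA -mulmxDr diwedge_mxK mulmxBr
    -!scalemxAr.
  by rewrite scalerDr addrA.
have := diwedge_mx_Kcoef_sym0 a; rewrite diwedge_mx_Kcoefr h dpairE Kmx_sqr scaler0 => /eqP.
rewrite -addrA addr_eq0 => /eqP ->; rewrite scale_scalar_mx opprD opprK.
apply/eqP; rewrite subr_eq0; apply/eqP; congr (_%:M).
by rewrite /Ksq; field.
Qed.

Definition dKrow i : 'M[R]_6 := \matrix_(a, m) dKmx a i m.

Lemma closed_jet_solve (x y z t : R) : x - y + z - t = 0 -> x = y - z + t.
Proof. by move=> h; rewrite -[LHS]subr0 -h; ring. Qed.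

(** Cartan's formula: the derivative of [phi] along [K e_i] is that of [P] along
    [e_i], up to the Jacobian [dKrow i] of [K e_i]. *)
Lemma Kdir_coefE i j k l : \sum_a Kmx i a * dc a j k l =
  dKcoef i j k l + (-1) * mx_act (dKrow i) c j k l.
Proof.
have clP' : dKcoef i j k l = dKcoef j i k l - dKcoef k i j l + dKcoef l i j k.
  exact: closed_jet_solve (clP i j k l).
rewrite clP' /dKcoef /mx_act.
have -> : \sum_a Kmx i a * dc a j k l = mx_act1 Kmx (dc j) i k l - mx_act1 Kmx (dc k) i j l +
  mx_act1 Kmx (dc l) i j k.
  rewrite /mx_act1 -sumrB -big_split; apply: eq_bigr => a _ /=.
  by rewrite (closed_jet_solve (cl a j k l)); ring.
have [c12 c23 _] := ac.
rewrite !big_split /=.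
have -> : \sum_n dKrow i j n * c n k l = mx_act1 (dKmx j) c i k l.
  by apply: eq_bigr => n _; rewrite mxE.
have -> : \sum_n dKrow i k n * c j n l = - mx_act1 (dKmx k) c i j l.
  by rewrite -sumrN; apply: eq_bigr => n _; rewrite mxE c12 mulrN.
have -> : \sum_n dKrow i l n * c j k n = mx_act1 (dKmx l) c i j k.
  by apply: eq_bigr => n _; rewrite mxE c23 c12 opprK.
ring.
Qed.

(** Obtained by differentiating T(c, c) = - rho K along K e_i, where [Kdir_coefE] gives the
    derivative [h] of phi. The multiples of K are collected in [s]: [nijmx_eq0] works for any such
    scalar. *)
Lemma dKmx_Kdir i : exists s : R, \sum_a Kmx i a *: dKmx a =
  dKmx i *m Kmx - dKrow i *m Kmx + Kmx *m dKrow i + s *: Kmx.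
Proof.
pose h : coef := fun j k l => \sum_a Kmx i a * dc a j k l.
have hE j k l : h j k l = dKcoef i j k l + (-1) * mx_act (dKrow i) c j k l by exact: Kdir_coefE.
have s1 : \sum_a Kmx i a *: dKmx a =
    - rho^-1 *: (iwedge_mx h c + iwedge_mx c h) - (\sum_a Kmx i a * (drho a / rho)) *: Kmx.
  rewrite iwedge_mx_suml iwedge_mx_sumr -big_split scaler_sumr scaler_suml -sumrB.
  by apply: eq_bigr => a _ /=; rewrite dKmxE scalerBr -scalerDr !scalerA [_ * - _]mulrC.
have s2 : iwedge_mx h c + iwedge_mx c h = - (iwedge_mx Kcoef (dc i) + iwedge_mx (dc i) Kcoef) -
    (\tr (dKrow i) *: iwedge_mx c c + dKrow i *m iwedge_mx c c - iwedge_mx c c *m dKrow i).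
  rewrite -(iwedge_mx_mx_act _ ac ac) (iwedge_mx_ext (d' := c) hE) //
    (iwedge_mx_ext (c' := c) _ hE) //.
  rewrite iwedge_mx_addl iwedge_mx_addr iwedge_mx_scalel iwedge_mx_scaler !scaleN1r addrACA
    -opprD; congr (_ - _).
  move: (iwedge_mx (dKcoef i) c) (iwedge_mx Kcoef (dc i)) (iwedge_mx (dc i) Kcoef)
    (iwedge_mx c (dKcoef i)) (diwedge_mx_Kcoef_sym0 i).
  by move=> D1 D2 D3 D4 h0; apply/eqP; rewrite -addr_eq0 addrACA [D4 + _]addrC h0.
(* The scalar <dc_i, P> cancels the term - drho K^2 that comes from K times the derivative of T(c,
   c), by [dpairE]. *)
have s3 : iwedge_mx Kcoef (dc i) + iwedge_mx (dc i) Kcoef =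
  - rho *: (Kmx *m dKmx i) + pair_coef c (dc i) *: Kmx.
  have -> : iwedge_mx (dc i) Kcoef = iwedge_mx Kcoef (dc i) + (pair_coef (dc i) Kcoef)%:M.
    by rewrite -(iwedge_mx_asym (adc i) Kcoef_alt) addrC subrK.
  rewrite addrA /Kcoef iwedge_mx_mx_act1 -mulmxDr.
  have -> : iwedge_mx c (dc i) + iwedge_mx c (dc i) =
    iwedge_mx (dc i) c + iwedge_mx c (dc i) + (pair_coef c (dc i))%:M.
    by rewrite -(iwedge_mx_asym ac (adc i)) addrA [in RHS]addrAC [X in _ = X - _ + _]addrC addrK.
  rewrite mulmxDr mul_mx_scalar diwedge_mxK mulmxBr -!scalemxAr Kmx_sqr pair_coef_dcK dpairE.
  rewrite -!addrA; congr (_ + _); rewrite addrC -addrA -[RHS]addr0; congr (_ + _).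
  rewrite scale_scalar_mx -raddfB /= /Ksq; apply/matrixP => u m; rewrite !mxE.
  by rewrite (_ : _ - _ = 0) ?mul0rn //; field.
have aK : Kmx *m dKmx i = - (dKmx i *m Kmx).
  by apply/eqP; rewrite -addr_eq0 addrC dKmx_anticomm.
eexists; rewrite s1 s2 s3 aK iwedge_mxK -!scalemxAr -!scalemxAl.
set A := dKmx i *m Kmx; set B := dKrow i *m Kmx; set C := Kmx *m dKrow i.
set D := \sum_a _.
rewrite !scalerA.
have -> : - rho^-1 *: (- (- rho *: (- A) + pair_coef c (dc i) *: Kmx) -
   ((\tr (dKrow i) * - rho) *: Kmx + - rho *: B - - rho *: C)) =
   A - B + C + (rho^-1 * pair_coef c (dc i) - \tr (dKrow i)) *: Kmx.
  by apply/matrixP => u m; rewrite !mxE; field.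
by rewrite -addrA -scalerBl.
Qed.

End Fixed.
End Jet.

(** * The Nijenhuis tensor *)

Section Nij.
Variables (R : fieldType) (n : nat) (K : 'M[R]_n) (dK : 'I_n -> 'M[R]_n).

Definition dirmx (v : 'rV[R]_n) : 'M[R]_n := \sum_a v 0 a *: dK a.

(** [N_K(x, y)] for constant fields [x], [y]; endomorphisms act on row vectors
    from the right. *)
Definition nijmx (x y : 'rV[R]_n) : 'rV[R]_n :=
  (y *m dirmx x - x *m dirmx y) *m K - y *m dirmx (x *m K) + x *m dirmx (y *m K).

Hypothesis dKmx_Kdir : forall i, exists s : R, \sum_a K i a *: dK a =
  dK i *m K - (\matrix_(a, m) dK a i m) *m K + K *m (\matrix_(a, m) dK a i m) + s *: K.

Lemma nijmx_eq0 x y : nijmx x y = 0.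
Proof.
have [s sE] := fin_all_exists dKmx_Kdir.
pose S (v : 'rV[R]_n) := \sum_i v 0 i * s i.
pose E i : 'M[R]_n := \matrix_(a, m) dK a i m.
(* The Jacobian of the field v K, contracted with [u], is the derivative of K along [u] applied to
   [v]. *)
have sumE (u v : 'rV[R]_n) : u *m (\sum_i v 0 i *: E i) = v *m dirmx u.
  apply/rowP => m; rewrite !mxE.
  under eq_bigr do rewrite summxE mulr_sumr.
  rewrite exchange_big /=; apply: eq_bigr => i _.
  rewrite summxE mulr_sumr; apply: eq_bigr => a _; rewrite !mxE; ring.
have dirK (v : 'rV[R]_n) : dirmx (v *m K) =
   dirmx v *m K - (\sum_i v 0 i *: E i) *m K + K *m (\sum_i v 0 i *: E i) + S v *: K.
  rewrite /dirmx.
  transitivity (\sum_i v 0 i *: (\sum_a K i a *: dK a)).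
    under eq_bigr do rewrite mxE scaler_suml.
    rewrite exchange_big /=; apply: eq_bigr => i _.
    by rewrite scaler_sumr; apply: eq_bigr => a _; rewrite scalerA.
  under eq_bigr do rewrite sE !(scalerDr, scalerN).
  rewrite !big_split /= sumrN !mulmx_suml mulmx_sumr scaler_suml.
  congr (_ + _ + _ + _); last by apply: eq_bigr => i _; rewrite scalerA.
  - by apply: eq_bigr => i _; rewrite scalemxAl.
  - by congr (- _); apply: eq_bigr => i _; rewrite scalemxAl.
  - by apply: eq_bigr => i _; rewrite scalemxAr.
have N_S u v : nijmx u v = - (S u *: (v *m K)).
  have h : v *m dirmx (u *m K) = v *m dirmx u *m K - u *m dirmx v *m K + u *m dirmx (v *m K) +
    S u *: (v *m K).
    rewrite dirK !mulmxDr mulmxN !mulmxA sumE -(mulmxA v) -scalemxAr; congr (_ + _ + _).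
    by rewrite mulmxA sumE.
  rewrite /nijmx h mulmxBl.
  by move: (v *m dirmx u *m K) (u *m dirmx v *m K) (u *m dirmx (v *m K)) (S u *: (v *m K)) =>
    p q r t;
     apply/rowP => m; rewrite !mxE; ring.
have N_anti u v : nijmx u v = - nijmx v u.
  rewrite /nijmx !mulmxBl.
  move: (v *m dirmx u *m K) (u *m dirmx v *m K) (u *m dirmx (v *m K)) (v *m dirmx (u *m K)) =>
    p q r t.
  by apply/rowP => m; rewrite !mxE; ring.
(* For nonzero K take [v] with v K nonzero: N(v, v) = 0 gives S v = 0, and antisymmetry for the pair
   [x], [v] then gives S x = 0. *)
rewrite N_S; have [->|K0] := eqVneq K 0; first by rewrite mulmx0 scaler0 oppr0.
have [j vK] : exists j, row j K != 0.
  apply/existsP; apply: contraNT K0 => /existsPn h; apply/eqP/row_matrixP => j.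
  by rewrite row0; apply/eqP; move: (h j); rewrite negbK.
pose v : 'rV[R]_n := delta_mx 0 j.
have vK0 : v *m K != 0 by rewrite -rowE.
have SS u w : S u *: (w *m K) + S w *: (u *m K) = 0.
  by have := N_anti u w; rewrite !N_S opprK => /eqP; rewrite -subr_eq0 -opprD oppr_eq0 => /eqP.
have Sv0 : S v = 0.
  have : nijmx v v = 0 by rewrite /nijmx subrr mul0mx sub0r addNr.
  by rewrite N_S => /eqP; rewrite oppr_eq0 scaler_eq0 (negbTE vK0) orbF => /eqP.
have := SS x v; rewrite Sv0 scale0r addr0 => /eqP.
by rewrite scaler_eq0 (negbTE vK0) orbF => /eqP ->; rewrite scale0r oppr0.
Qed.
End Nij.

Import numFieldNormedType.Exports.

(** * Alternating forms and wedge products *)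

Section Perms.
Variable R : comNzRingType.

Lemma sum_perm_recl n (F : 'S_n.+1 -> R) :
  \sum_s F s = \sum_j \sum_(s : 'S_n) F (lift_perm ord0 j s).
Proof.
pose h (p : 'I_n.+1 * 'S_n) := lift_perm ord0 p.1 p.2.
have hI : injective h.
  move=> [j s] [j' s'] /permP e.
  have jj : j = j' by move: (e ord0); rewrite !lift_perm_id.
  rewrite /h /= -jj in e *; congr (_, _); apply/permP => k.
  by move: (e (lift ord0 k)); rewrite !lift_perm_lift => /lift_inj.
have hB : bijective h.
  by apply: inj_card_bij => //; rewrite card_prod !card_Sn card_ord factS.
by rewrite (reindex h) /= ?pair_big //; exact: onW_bij.
Qed.

Lemma sum_flatten (I : Type) (ss : seq (seq I)) (F : I -> R) :
  \sum_(t <- flatten ss) F t = \sum_(s <- ss) \sum_(t <- s) F t.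
Proof. by elim: ss => [|s ss IH]; rewrite ?big_nil //= big_cat big_cons IH. Qed.

(** A permutation sending [ord0] to [j] is a [lift_perm], whose extra sign is the parity of [j];
    this is the recursion of [signed_perms]. *)
Lemma sum_signed_perms n (l : seq nat) (g : seq nat -> R) : size l = n ->
  \sum_(s : 'S_n) (-1) ^+ s * g [seq nth 0%N l (s i) | i <- enum 'I_n] =
  \sum_(p <- signed_perms n l) (-1) ^+ p.1 * g p.2.
Proof.
elim: n l g => [|n IH] l g sl.
  rewrite /= big_seq1 (bigD1 1%g) //= big1 ?addr0; last first.
    by move=> s; case/eqP; apply/permP => -[].
  by rewrite odd_perm1 (_ : enum _ = [::]) //; apply: size0nil; rewrite size_enum_ord.
rewrite sum_perm_recl.
have -> : signed_perms n.+1 l = flatten [seq [seq (odd j (+) p.1, nth 0%N l j :: p.2)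
    | p <- signed_perms n (take j l ++ drop j.+1 l)] | j <- map val (enum 'I_n.+1)].
  by rewrite val_enum_ord.
rewrite sum_flatten !big_map /=.
rewrite [RHS](eq_bigl xpredT) //; apply: eq_bigr => j _; rewrite big_map /=.
pose l' := take j l ++ drop j.+1 l.
have sl' : size l' = n.
  rewrite size_cat size_take size_drop sl ltn_ord subSS.
  by rewrite subnKC // -ltnS.
have nl' (k : 'I_n) : nth 0%N l' k = nth 0%N l (lift j k).
  rewrite nth_cat size_take sl ltn_ord /= /bump.
  case: ltnP => jk; first by rewrite nth_take // leqNgt jk.
  by rewrite nth_drop addSn subnKC.
transitivity (\sum_(s : 'S_n) (-1) ^+ s *
  ((-1) ^+ odd j * g (nth 0%N l j :: [seq nth 0%N l' (s i) | i <- enum 'I_n]))).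
  apply: eq_bigr => s _; rewrite mulrA -signr_addb odd_lift_perm addbC /=.
  congr (_ ^+ nat_of_bool _ * g _).
  rewrite enum_ordSl /= lift_perm_id; congr (_ :: _).
  by rewrite -map_comp; apply: eq_map => k /=; rewrite lift_perm_lift nl'.
rewrite (IH l' (fun t => (-1) ^+ odd j * g (nth 0%N l j :: t))) //.
by apply: eq_bigr => p _; rewrite mulrA -signr_addb [_ (+) p.1]addbC.
Qed.

End Perms.

Section Rows.
Variables (R : realType) (n : nat).
Local Notation V := 'rV[R]_n.

(** Arguments of a form given as a list, so that permuting them is a computation on [seq]; missing
    entries default to 0. *)
Definition rowsmx k (l : seq V) : 'M[R]_(k, n) := \matrix_(r < k) nth 0 l r.

Lemma rowsmx_row k (l : seq V) r : row r (rowsmx k l) = nth 0 l r.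
Proof. by rewrite /rowsmx rowK. Qed.

Lemma rowsmxE k l (r : 'I_k) j : rowsmx k l r j = (nth 0 l r) 0 j.
Proof. by rewrite /rowsmx !mxE. Qed.

Lemma col_rowsmx k X l : col_mx X (rowsmx k l) = rowsmx (1 + k) (X :: l).
Proof.
apply/matrixP => i j; rewrite mxE rowsmxE; case: splitP => [i' ->|i' ->].
  by rewrite ord1.
by rewrite rowsmxE.
Qed.

Lemma usub_rowsmx p q l : usubmx (rowsmx (p + q) l) = rowsmx p l.
Proof. by apply/matrixP => i j; rewrite mxE !rowsmxE. Qed.

Lemma dsub_rowsmx p q l : dsubmx (rowsmx (p + q) l) = rowsmx q (drop p l).
Proof. by apply/matrixP => i j; rewrite mxE !rowsmxE nth_drop. Qed.

Lemma row_perm_rowsmx k l (s : 'S_k) :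
  row_perm s (rowsmx k l) = rowsmx k [seq nth 0 l (s i) | i <- enum 'I_k].
Proof.
apply/matrixP => i j; rewrite mxE !rowsmxE (nth_map i) ?size_enum_ord //.
by rewrite nth_ord_enum.
Qed.

Lemma rowsmx_ext k l l' : (forall i, (i < k)%N -> nth 0 l i = nth 0 l' i) -> rowsmx k l =
  rowsmx k l'.
Proof. by move=> h; apply/matrixP => i j; rewrite !rowsmxE h. Qed.

Lemma wedge_signed_perms p q (a : 'M[R]_(p, n) -> R) (b : 'M[R]_(q, n) -> R) l :
  wedge a b (rowsmx (p + q) l) = (p`! * q`!)%:R^-1 *
  \sum_(t <- signed_perms (p + q) (iota 0 (p + q)))
     (-1) ^+ t.1 * (a (rowsmx p [seq nth 0 l i | i <- t.2])
                   * b (rowsmx q (drop p [seq nth 0 l i | i <- t.2]))).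
Proof.
rewrite /wedge; congr (_ * _).
rewrite -(sum_signed_perms (fun t => a (rowsmx p [seq nth 0 l i | i <- t]) *
  b (rowsmx q (drop p [seq nth 0 l i | i <- t])))) ?size_iota //.
apply: eq_bigr => s _; rewrite -mulrA; congr (_ * (a _ * b _)).
  rewrite row_perm_rowsmx usub_rowsmx; congr rowsmx; rewrite -map_comp.
  by apply: eq_map => i /=; rewrite nth_iota.
rewrite row_perm_rowsmx dsub_rowsmx; congr (rowsmx _ (drop _ _)); rewrite -map_comp.
by apply: eq_map => i /=; rewrite nth_iota.
Qed.

Lemma row_row_perm k (s : 'S_k) (A : 'M[R]_(k, n)) i : row i (row_perm s A) = row (s i) A.
Proof. by apply/rowP => j; rewrite !mxE. Qed.

Definition setrow k (i : 'I_k) (v : V) (A : 'M[R]_(k, n)) : 'M[R]_(k, n) :=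
  \matrix_r (if r == i then v else row r A).

Lemma setrow_row k (i r : 'I_k) v A : row r (setrow i v A) = if r == i then v else row r A.
Proof. by rewrite rowK. Qed.

Lemma setrow_id k (i : 'I_k) A : setrow i (row i A) A = A.
Proof. by apply/row_matrixP => r; rewrite setrow_row; case: eqP => [->|]. Qed.

Lemma row'_eq k (i : 'I_k) (A B : 'M[R]_(k, n)) :
  (forall r, r != i -> row r A = row r B) -> row' i A = row' i B.
Proof.
move=> h; apply/row_matrixP => r; apply/rowP => j.
have := h (lift i r); rewrite eq_sym neq_lift => /(_ isT) /rowP /(_ j).
by rewrite !mxE.
Qed.

Lemma row'_eqP k (i : 'I_k) (A B : 'M[R]_(k, n)) :
  row' i A = row' i B -> forall r, r != i -> row r A = row r B.
Proof.
move=> h r ri; case: (unliftP i r) ri => [r' ->|->]; last by rewrite eqxx.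
by move=> _; apply/rowP => j; move/matrixP: h => /(_ r' j); rewrite !mxE.
Qed.

Section Alt.
Variables (k : nat) (a : 'M[R]_(k, n) -> R).
Hypothesis ma : multilinear_rows a.

Lemma setrow_lin i (b c : R) u v A :
  a (setrow i (b *: u + c *: v) A) = b * a (setrow i u A) + c * a (setrow i v A).
Proof.
apply: (ma (i := i)); first by rewrite !setrow_row eqxx.
  by apply: row'_eq => r ri; rewrite !setrow_row (negbTE ri).
by apply: row'_eq => r ri; rewrite !setrow_row (negbTE ri).
Qed.

Lemma setrowD i u v A : a (setrow i (u + v) A) = a (setrow i u A) + a (setrow i v A).
Proof. by rewrite -[u]scale1r -[v]scale1r setrow_lin !mul1r !scale1r. Qed.

Lemma setrowZ i b u A : a (setrow i (b *: u) A) = b * a (setrow i u A).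
Proof. by rewrite -[b *: u]addr0 -[0](scale0r u) setrow_lin mul0r addr0. Qed.

Lemma setrow_sum i (I : finType) (x : I -> R) (u : I -> V) A :
  a (setrow i (\sum_j x j *: u j) A) = \sum_j x j * a (setrow i (u j) A).
Proof.
elim/big_rec2: _ => [|j s v _ <-]; first by rewrite -(scale0r 0) setrowZ mul0r.
by rewrite setrowD setrowZ.
Qed.

End Alt.

Lemma agree_basis k (a b : 'M[R]_(k, n) -> R) : multilinear_rows a -> multilinear_rows b ->
  (forall s : 'I_k -> 'I_n, a (rowsub s 1%:M) = b (rowsub s 1%:M)) ->
  forall A, a A = b A.
Proof.
move=> ma mb ab A.
(* Rows of index at least [m] are assumed to be basis vectors; the inductive step expands row
   [m]. *)
have h m : (m <= k)%N -> forall A : 'M[R]_(k, n),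
    (forall i : 'I_k, (m <= i)%N -> exists j, row i A = delta_mx 0 j) -> a A = b A.
  elim: m => [_|m IH mk] {}A hA.
    have [s sE] := fin_all_exists (fun i => hA i (leq0n i)).
    have -> : A = rowsub s 1%:M by apply/row_matrixP => i; rewrite row_rowsub row1 sE.
    exact: ab.
  pose i := Ordinal mk.
  rewrite -(setrow_id i A) (row_sum_delta (row i A)) !setrow_sum //.
  apply: eq_bigr => j _; congr (_ * _); apply: IH; first exact: ltnW.
  move=> r mr; rewrite setrow_row; case: eqP => [_|ri]; first by exists j.
  by apply: hA; rewrite ltn_neqAle mr andbT; apply/eqP => e; apply: ri; apply: val_inj.
by apply: (h k) => // i; rewrite leqNgt ltn_ord.
Qed.

Section AltForms.
Variables (k : nat) (a : 'M[R]_(k, n) -> R).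
Hypothesis aa : @alt_forms R n k a.
Let ma : multilinear_rows a. Proof. by case: aa. Qed.
Let la : alternating_rows a. Proof. by case: aa. Qed.

Lemma alt_tperm i j A : i != j -> a (row_perm (tperm i j) A) = - a A.
Proof.
move=> ij; apply/eqP; rewrite -addr_eq0; apply/eqP.
pose S u v := setrow i u (setrow j v A).
have Szz u : a (S u u) = 0.
  apply: (la ij); rewrite !setrow_row !eqxx.
  by rewrite eq_sym (negbTE ij).
have SC u v : S u v = setrow j v (setrow i u A).
  apply/row_matrixP => r; rewrite !setrow_row; case: eqP => [->|//].
  by rewrite (negbTE ij).
have := Szz (row i A + row j A).
have e u v x : a (S (u + v) x) = a (S u x) + a (S v x) by exact: setrowD.
have e' u v x : a (S x (u + v)) = a (S x u) + a (S x v) by rewrite !SC setrowD.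
rewrite e !e' !Szz add0r addr0.
have -> : S (row i A) (row j A) = A by rewrite /S !setrow_id.
have -> : S (row j A) (row i A) = row_perm (tperm i j) A => [|<-]; last by rewrite addrC.
apply/row_matrixP => r; rewrite !setrow_row row_row_perm /=.
case: tpermP => [->|->|/eqP/negbTE -> /eqP/negbTE -> //].
  by rewrite eqxx.
by rewrite eq_sym (negbTE ij) eqxx.
Qed.

Lemma alt_row_perm (s : 'S_k) A : a (row_perm s A) = (-1) ^+ s * a A.
Proof.
case: (prod_tpermP s) => ts -> /allP; elim: ts A => [|t ts IH] A hts.
  by rewrite big_nil row_perm1 odd_perm1 mul1r.
have tn : t.1 != t.2 by apply: hts; rewrite mem_head.
rewrite big_cons row_permM alt_tperm // IH; last first.
  by move=> x xts; apply: hts; rewrite inE xts orbT.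
by rewrite odd_mul_tperm tn signr_addb expr1 mulN1r mulNr.
Qed.

Lemma alt_rowsub_noninj (s : 'I_k -> 'I_n) A : ~ injective s -> a (rowsub s A) = 0.
Proof.
move=> sI; have [i [j [ij sij]]] : exists i j, i != j /\ s i = s j.
  apply: contrapT => h; apply: sI => i j sij; apply/eqP; apply: contrapT => /negP ij.
  by apply: h; exists i, j.
by apply: (la ij); rewrite !row_rowsub sij.
Qed.

End AltForms.

End Rows.

Section Wedge.
Variables (R : realType) (n : nat).

Lemma row_usub p q (A : 'M[R]_(p + q, n)) i : row i (usubmx A) = row (lshift q i) A.
Proof. by apply/rowP => j; rewrite !mxE. Qed.
Lemma row_dsub p q (A : 'M[R]_(p + q, n)) i : row i (dsubmx A) = row (rshift p i) A.
Proof. by apply/rowP => j; rewrite !mxE. Qed.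

Lemma wedge_multilinear p q (a : 'M[R]_(p, n) -> R) (b : 'M[R]_(q, n) -> R) :
  multilinear_rows a -> multilinear_rows b -> multilinear_rows (wedge a b).
Proof.
move=> ma mb i A B C x y rA /row'_eqP BA /row'_eqP CA.
rewrite /wedge !(mulrCA _ (_^-1)) -mulrDr; congr (_ * _).
rewrite !mulr_sumr -big_split /=; apply: eq_bigr => s _.
rewrite -!mulrA !(mulrCA _ ((-1) ^+ s)) -mulrDr; congr (_ * _).
case: (split_ordP ((s^-1)%g i)) => k kE.
- have ski : s (lshift q k) = i by rewrite -kE permKV.
  have e D : (forall r, r != i -> row r D = row r A) ->
      dsubmx (row_perm s D) = dsubmx (row_perm s A).
    move=> h; apply/row_matrixP => r; rewrite !row_dsub !row_row_perm h //.
    by rewrite -ski (inj_eq perm_inj) eq_rlshift.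
  have e' D : (forall r, r != i -> row r D = row r A) ->
      row' k (usubmx (row_perm s D)) = row' k (usubmx (row_perm s A)).
    move=> h; apply: row'_eq => r rk; rewrite !row_usub !row_row_perm h //.
    by rewrite -ski (inj_eq perm_inj) eq_lshift.
  rewrite (e B) // (e C) // !mulrA -mulrDl; congr (_ * _).
  apply: (ma k); rewrite ?e' //.
  by rewrite !row_usub !row_row_perm ski.
- have ski : s (rshift p k) = i by rewrite -kE permKV.
  have e D : (forall r, r != i -> row r D = row r A) ->
      usubmx (row_perm s D) = usubmx (row_perm s A).
    move=> h; apply/row_matrixP => r; rewrite !row_usub !row_row_perm h //.
    by rewrite -ski (inj_eq perm_inj) eq_lrshift.
  have e' D : (forall r, r != i -> row r D = row r A) ->
      row' k (dsubmx (row_perm s D)) = row' k (dsubmx (row_perm s A)).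
    move=> h; apply: row'_eq => r rk; rewrite !row_dsub !row_row_perm h //.
    by rewrite -ski (inj_eq perm_inj) eq_rshift.
  rewrite (e B) // (e C) // !(mulrCA _ (a _)) -mulrDr; congr (_ * _).
  apply: (mb k); rewrite ?e' //.
  by rewrite !row_dsub !row_row_perm ski.
Qed.

Lemma wedge_alternating p q (a : 'M[R]_(p, n) -> R) (b : 'M[R]_(q, n) -> R) :
  alternating_rows (wedge a b).
Proof.
move=> A i j ij rij; rewrite /wedge.
set S := \sum_s _; suff : S = - S.
  by move/eqP; rewrite -addr_eq0 -mulr2n mulrn_eq0 /= => /eqP ->; rewrite mulr0.
have At : row_perm (tperm i j) A = A.
  by apply/row_matrixP => r; rewrite row_row_perm; case: tpermP => [->|->|].
rewrite {1}/S (reindex_inj (mulIg (tperm i j))) /= -sumrN.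
apply: eq_bigr => s _; rewrite row_permM At odd_permM odd_tperm ij.
by rewrite signr_addb expr1 mulrN1 !mulNr.
Qed.

Lemma wedge_alt p q (a : 'M[R]_(p, n) -> R) (b : 'M[R]_(q, n) -> R) :
  multilinear_rows a -> multilinear_rows b -> @alt_forms R n (p + q) (wedge a b).
Proof. by move=> ma mb; split; [exact: wedge_multilinear | exact: wedge_alternating]. Qed.

Lemma alt_scale k x (a : 'M[R]_(k, n) -> R) :
  @alt_forms R n k a -> @alt_forms R n k (fun A => x * a A).
Proof.
move=> [ma la]; split=> [i A B C b c rA rB rC|A i j ij rij].
  by rewrite (ma i A B C b c rA rB rC) mulrDr !(mulrCA x).
by rewrite (la A i j) ?mulr0.
Qed.

Lemma interior_alt k X (a : 'M[R]_(1 + k, n) -> R) :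
  @alt_forms R n (1 + k) a -> @alt_forms R n k (interior_product X a).
Proof.
move=> [ma la]; split=> [i A B C b c rA /row'_eqP rB /row'_eqP rC|A i j ij rij].
  apply: (ma (rshift 1 i)); rewrite ?rowKd //.
  - apply: row'_eq => r; case: (split_ordP r) => r' -> ri; first by rewrite !rowKu.
    by rewrite !rowKd rB //; apply: contraNneq ri => ->.
  - apply: row'_eq => r; case: (split_ordP r) => r' -> ri; first by rewrite !rowKu.
    by rewrite !rowKd rC //; apply: contraNneq ri => ->.
by apply: (la _ (rshift 1 i) (rshift 1 j)); rewrite ?eq_rshift ?rowKd.
Qed.

Lemma pullback_alt m k (g : 'M[R]_(m, n)) (a : 'M[R]_(k, n) -> R) :
  @alt_forms R n k a -> @alt_forms R m k (fun A => a (A *m g)).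
Proof.
move=> [ma la]; split=> [i A B C b c rA /row'_eqP rB /row'_eqP rC|A i j ij rij].
  apply: (ma i); first by rewrite !row_mul rA mulmxDl -!scalemxAl.
    by apply: row'_eq => r ri; rewrite !row_mul rB.
  by apply: row'_eq => r ri; rewrite !row_mul rC.
by apply: (la _ i j) => //; rewrite !row_mul rij.
Qed.

Lemma wedge_pullback p q (a : 'M[R]_(p, n) -> R) (b : 'M[R]_(q, n) -> R)
  (g : 'M[R]_n) (A : 'M[R]_(p + q, n)) :
  wedge a b (A *m g) = wedge (fun B => a (B *m g)) (fun B => b (B *m g)) A.
Proof.
rewrite /wedge; congr (_ * _); apply: eq_bigr => s _.
have -> : row_perm s (A *m g) = row_perm s A *m g by rewrite !row_permE mulmxA.
by rewrite mul_usub_mx mul_dsub_mx.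
Qed.

Lemma det_alt : @alt_forms R n n (fun A => \det A).
Proof.
split=> [i A B C b c rA rB rC|A i j ij rij]; first exact: determinant_multilinear rA rB rC.
by apply: determinant_alternate ij _ => k; move/rowP: rij => /(_ k); rewrite !mxE.
Qed.

Lemma top_form (a : 'M[R]_n -> R) : @alt_forms R n n a -> forall A, a A = a 1%:M * \det A.
Proof.
move=> aa; have da := alt_scale (a 1%:M) det_alt.
apply: agree_basis; [by case: aa|by case: da|move=> s].
have [sI|sI] := pselect (injective s); last first.
  by rewrite (alt_rowsub_noninj aa) // (alt_rowsub_noninj da).
have -> : rowsub s 1%:M = row_perm (perm sI) 1%:M :> 'M[R]_n.
  by apply/matrixP => i j; rewrite !mxE permE.
by rewrite (alt_row_perm aa) -/(perm_mx _) det_perm mulrC.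
Qed.

End Wedge.

Section CodimOne.
Variables (R : realType) (n : nat).

Lemma agree_codim1 (a b : 'M[R]_(n, n.+1) -> R) :
  @alt_forms R n.+1 n a -> @alt_forms R n.+1 n b ->
  (forall m : 'I_n.+1, a (row' m 1%:M) = b (row' m 1%:M)) -> forall A, a A = b A.
Proof.
move=> aa ab h; apply: agree_basis; [by case: aa|by case: ab|move=> s].
have [sI|sI] := pselect (injective s); last first.
  by rewrite (alt_rowsub_noninj aa) // (alt_rowsub_noninj ab).
have /existsP [m mC] : [exists m, m \notin codom s].
  rewrite -[X in is_true X]negbK negb_exists; apply/negP => /forallP hm.
  have : (#|'I_n.+1| <= #|codom s|)%N.
    by apply: subset_leq_card; apply/fintype.subsetP => m _; move: (hm m); rewrite negbK.
  by rewrite card_codom // !card_ord ltnn.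
have mP i : s i != m by apply: contraNneq mC => <-; exact: codom_f.
pose t i := odflt i (unlift m (s i)).
have tE i : lift m (t i) = s i.
  rewrite /t; case: (unliftP m (s i)) => [j ->|/eqP]; first by [].
  by rewrite (negbTE (mP i)).
have tI : injective t by move=> i j e; apply: sI; rewrite -!tE e.
have -> : rowsub s 1%:M = row_perm (perm tI) (row' m 1%:M) :> 'M[R]_(n, n.+1).
  by apply/matrixP => i j; rewrite !mxE permE tE.
by rewrite (alt_row_perm aa) (alt_row_perm ab) h.
Qed.

Lemma det_basis_row (Y : 'rV[R]_n.+1) (m : 'I_n.+1) :
  \det (col_mx Y (row' m 1%:M) : 'M[R]_(1 + n, n.+1)) = (-1) ^+ m * Y 0 m.
Proof.
have E (j : 'I_n.+1) : (col_mx Y (row' m 1%:M) : 'M[R]_(1 + n, n.+1)) ord0 j = Y 0 j.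
  by rewrite mxE; case: splitP => [i _|i] //; rewrite ord1.
have C j : cofactor (col_mx Y (row' m 1%:M) : 'M[R]_(1 + n, n.+1)) ord0 j =
    (-1) ^+ j * (j == m)%:R.
  rewrite /cofactor add0n; congr (_ * _).
  have -> : row' ord0 (col' j (col_mx Y (row' m 1%:M) : 'M[R]_(1 + n, n.+1))) =
    col' j (row' m 1%:M).
    apply/matrixP => i k; rewrite !mxE; case: splitP => [i'|i' e]; first by rewrite ord1.
    by rewrite !mxE (_ : i' = i) //; apply: val_inj; move: e => /= /eqP;
      rewrite /bump leq0n eqn_add2l => /eqP.
  have [->|jm] := eqVneq j m.
    rewrite -[RHS](det1 R n); congr (\det _); apply/matrixP => i k.
    by rewrite !mxE (inj_eq lift_inj).
  case: (unliftP m j) jm => [k jE _|->]; last by rewrite eqxx.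
  rewrite (expand_det_row _ k) big1 // => i _; rewrite !mxE -jE.
  by rewrite (negbTE (neq_lift _ _)) mul0r.
rewrite (expand_det_row _ (ord0 : 'I_(1 + n))) (bigD1 m) //= big1 => [|j jm].
  by rewrite addr0 E C eqxx mulr1 mulrC.
by rewrite C (negbTE jm) !mulr0.
Qed.

End CodimOne.

Section Lists.
Variables (R : realType) (n : nat).
Local Notation V := 'rV[R]_n.

Lemma rowsmx_set k (l : seq V) (i : 'I_k) v : rowsmx k (set_nth 0 l i v) = setrow i v (rowsmx k l).
Proof.
apply/row_matrixP => r; rewrite setrow_row !rowsmx_row nth_set_nth /=.
by rewrite (inj_eq val_inj).
Qed.

Lemma rowsmx_swap k (l l' : seq V) (i j : 'I_k) :
  (forall r : 'I_k, nth 0 l' r = nth 0 l (tperm i j r)) ->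
  rowsmx k l' = row_perm (tperm i j) (rowsmx k l).
Proof. by move=> h; apply/row_matrixP => r; rewrite row_row_perm !rowsmx_row h. Qed.

Lemma alt2_swap (a : 'M[R]_(2, n) -> R) : @alt_forms R n 2 a ->
  forall x y, a (rowsmx 2 [:: y; x]) = - a (rowsmx 2 [:: x; y]).
Proof.
move=> aa x y; rewrite (@rowsmx_swap 2 [:: x; y] _ 0 1); last first.
  by case=> [[|[|]]] //= h; rewrite permE /=.
by rewrite alt_row_perm // odd_tperm mulN1r.
Qed.

Lemma alt2_diag (a : 'M[R]_(2, n) -> R) : @alt_forms R n 2 a ->
  forall x, a (rowsmx 2 [:: x; x]) = 0.
Proof. by move=> [_ la] x; apply: (la _ 0 1) => //; rewrite !rowsmx_row. Qed.

Lemma alt3_swap12 (a : 'M[R]_(3, n) -> R) : @alt_forms R n 3 a ->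
  forall x y z, a (rowsmx 3 [:: y; x; z]) = - a (rowsmx 3 [:: x; y; z]).
Proof.
move=> aa x y z; rewrite (@rowsmx_swap 3 [:: x; y; z] _ 0 1); last first.
  by case=> [[|[|[|]]]] //= h; rewrite permE /=.
by rewrite alt_row_perm // odd_tperm mulN1r.
Qed.

Lemma alt3_swap23 (a : 'M[R]_(3, n) -> R) : @alt_forms R n 3 a ->
  forall x y z, a (rowsmx 3 [:: x; z; y]) = - a (rowsmx 3 [:: x; y; z]).
Proof.
move=> aa x y z; rewrite (@rowsmx_swap 3 [:: x; y; z] _ (inord 1) (inord 2)); last first.
  by case=> [[|[|[|]]]] //= h; rewrite permE /= -!val_eqE /= !inordK.
by rewrite alt_row_perm // odd_tperm -val_eqE /= !inordK // mulN1r.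
Qed.

Lemma alt3_diag (a : 'M[R]_(3, n) -> R) : @alt_forms R n 3 a ->
  forall x z, a (rowsmx 3 [:: x; x; z]) = 0.
Proof. by move=> [_ la] x z; apply: (la _ 0 1) => //; rewrite !rowsmx_row. Qed.

Lemma multilinear_sum1 (a : 'M[R]_(3, n) -> R) : multilinear_rows a ->
  forall (I : finType) (x : I -> R) (u : I -> V) y z,
  a (rowsmx 3 [:: \sum_j x j *: u j; y; z]) = \sum_j x j * a (rowsmx 3 [:: u j; y; z]).
Proof.
move=> ma I x u y z; have e v : rowsmx 3 [:: v; y; z] = setrow 0 v (rowsmx 3 [:: 0; y; z]).
  by rewrite -rowsmx_set.
by rewrite e setrow_sum //; apply: eq_bigr => j _; rewrite -e.
Qed.

Lemma multilinear_sum2 (a : 'M[R]_(3, n) -> R) : multilinear_rows a ->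
  forall (I : finType) (x : I -> R) (u : I -> V) y z,
  a (rowsmx 3 [:: y; \sum_j x j *: u j; z]) = \sum_j x j * a (rowsmx 3 [:: y; u j; z]).
Proof.
move=> ma I x u y z; have e v : rowsmx 3 [:: y; v; z] = setrow 1 v (rowsmx 3 [:: y; 0; z]).
  by rewrite -rowsmx_set.
by rewrite e setrow_sum //; apply: eq_bigr => j _; rewrite -e.
Qed.

End Lists.

Lemma signed_perms_lt m t : t \in signed_perms m (iota 0 m) -> all (fun i => (i < m)%N) t.2.
Proof.
have h k l u : size l = k -> u \in signed_perms k l -> {subset u.2 <= l}.
  elim: k l u => [|k IH] l u sl; first by rewrite mem_seq1 => /eqP ->.
  move=> /flatten_mapP [j]; rewrite mem_iota add0n => /andP [_ jk] /mapP [v hv ->] x /=.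
  rewrite inE => /orP [/eqP ->|xv]; first by rewrite mem_nth // sl.
  have sl' : size (take j l ++ drop j.+1 l) = k.
    by rewrite size_cat size_take size_drop sl jk subSS subnKC // -ltnS.
  have := IH _ _ sl' hv x xv.
  by rewrite mem_cat => /orP [/mem_take|/mem_drop].
move=> ht; apply/allP => x xt; have := h _ _ _ (size_iota 0 m) ht x xt.
by rewrite mem_iota add0n => /andP [].
Qed.

Section WedgeLists.
Variables (R : realType) (n : nat).
Local Notation V := 'rV[R]_n.
Implicit Types x : nat -> V.

Definition idx2 (a : 'M[R]_(2, n) -> R) x i j := a (rowsmx 2 [:: x i; x j]).
Definition idx3 (a : 'M[R]_(3, n) -> R) x i j k := a (rowsmx 3 [:: x i; x j; x k]).

Lemma idx2_alt2 a x : @alt_forms R n 2 a -> forall i j, idx2 a x i j = alt2 (idx2 a x) i j.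
Proof.
move=> aw i j; rewrite /alt2 /idx2; case: ltngtP => [//|ji|->].
  exact: alt2_swap.
exact: alt2_diag.
Qed.

Lemma idx3_alt3 a x : @alt_forms R n 3 a -> forall i j k, idx3 a x i j k = alt3 (idx3 a x) i j k.
Proof.
move=> aw i j k; rewrite /alt3 /idx3.
have c12 := alt3_swap12 aw; have c23 := alt3_swap23 aw; have c0 := alt3_diag aw.
have c0' u v : a (rowsmx 3 [:: u; v; v]) = 0 by rewrite c12 c23 c0 !oppr0.
have c0'' u v : a (rowsmx 3 [:: u; v; u]) = 0 by rewrite c23 c0 oppr0.
case: (ltngtP i j) => [ij|ji|->]; last by rewrite c0.
- case: (ltngtP j k) => [jk|kj|->]; rewrite ?c0' //.
  case: (ltngtP i k) => [ik|ki|->]; rewrite ?c0'' //.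
  by rewrite c23 c12 opprK.
- case: (ltngtP i k) => [ik|ki|->]; rewrite ?c0'' //.
  case: (ltngtP j k) => [jk|kj|->]; rewrite ?c0' //.
    by rewrite c12 c23 opprK.
  by rewrite c12 c23 c12 opprK.
Qed.

(** [F] is any convenient form of the product of the two values; below it is written with [alt2],
    [alt3] or [pf4], for which the sums are known. *)
Lemma wedge_list p q (a : 'M[R]_(p, n) -> R) (b : 'M[R]_(q, n) -> R) x
    (F : seq nat -> R) : 
  (forall t, size t = (p + q)%N -> all (fun i => (i < p + q)%N) t ->
     F t = a (rowsmx p [seq x i | i <- t]) * b (rowsmx q [seq x i | i <- drop p t])) ->
  wedge a b (rowsmx (p + q) [seq x i | i <- iota 0 (p + q)]) =
  (p`! * q`!)%:R^-1 *
  \sum_(t <- signed_perms (p + q) (iota 0 (p + q))) (-1) ^+ t.1 * F t.2.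
Proof.
move=> FE; rewrite wedge_signed_perms; congr (_ * _).
apply: eq_big_seq => t ht; have t6 := signed_perms_lt ht.
have st : size t.2 = (p + q)%N.
  apply/eqP; move: {FE t6} t ht; apply/allP.
  elim: (p + q)%N (iota _ _) => [//|m IH] l /=.
  rewrite all_cat; apply/andP; split.
    rewrite all_map; apply/allP => u hu /=; rewrite eqSS.
    exact: (allP (IH _) _ hu).
  apply/allP => u /flatten_mapP [j _] /mapP [v hv ->] /=.
  by rewrite eqSS (allP (IH _) _ hv).
rewrite FE //; congr (_ * (a (rowsmx _ _) * b (rowsmx _ _))).
  apply/eq_in_map => i it; have ip := allP t6 i it.
  by rewrite (nth_map 0%N) ?size_iota // nth_iota.
rewrite -map_drop; apply/eq_in_map => i /mem_drop it; have ip := allP t6 i it.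
by rewrite (nth_map 0%N) ?size_iota // nth_iota.
Qed.

Lemma all_nth_lt (t : seq nat) k i : all (fun i => (i < k)%N) t -> (i < size t)%N ->
  (nth 0 t i < k)%N.
Proof. by move=> /all_nthP h it; exact: h. Qed.

Lemma wedge23 (a : 'M[R]_(2, n) -> R) (b : 'M[R]_(3, n) -> R) x :
  @alt_forms R n 2 a -> @alt_forms R n 3 b ->
  wedge a b (rowsmx 5 [seq x i | i <- iota 0 5]) = shuffle23 (idx2 a x) (idx3 b x) 0 1 2 3 4.
Proof.
move=> aa ab.
rewrite (@wedge_list 2 3 a b x (fun t => alt2 (idx2 a x) (nth 0%N t 0) (nth 0%N t 1) *
   alt3 (idx3 b x) (nth 0%N t 2) (nth 0%N t 3) (nth 0%N t 4))); last first.
  move=> t st _; rewrite -idx2_alt2 // -idx3_alt3 // /idx2 /idx3.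
  congr (a _ * b _); apply: rowsmx_ext => -[|[|[|]]] //= _;
    by rewrite ?(nth_map 0%N) ?size_drop ?st // nth_drop.
by rewrite sum23 mulrA mulVf ?mul1r // pnatr_eq0.
Qed.

(** Alternation is asked only of the values on [x], because for F it is available through the
    coefficients. *)
Lemma wedge33 (a b : 'M[R]_(3, n) -> R) x :
  (forall i j k, (i < 6)%N -> (j < 6)%N -> (k < 6)%N -> idx3 a x i j k = alt3 (idx3 a x) i j k) ->
  (forall i j k, (i < 6)%N -> (j < 6)%N -> (k < 6)%N -> idx3 b x i j k = alt3 (idx3 b x) i j k) ->
  wedge a b (rowsmx 6 [seq x i | i <- iota 0 6]) = pair3 (idx3 a x) (idx3 b x).
Proof.
move=> aa ab.
rewrite (@wedge_list 3 3 a b x (fun t => alt3 (idx3 a x) (nth 0%N t 0) (nth 0%N t 1) (nth 0%N t 2) *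
   alt3 (idx3 b x) (nth 0%N t 3) (nth 0%N t 4) (nth 0%N t 5))); last first.
  move=> t st t6; have tl i : (i < 6)%N -> (nth 0 t i < 6)%N by move=> ?; apply: all_nth_lt;
    rewrite ?st.
  rewrite -aa ?tl // -ab ?tl // /idx3.
  congr (a _ * b _); apply: rowsmx_ext => -[|[|[|]]] //= _;
    by rewrite ?(nth_map 0%N) ?size_drop ?st // nth_drop.
by rewrite sum33 mulrA mulVf ?mul1r // pnatr_eq0.
Qed.

Lemma wedge22 (w : 'M[R]_(2, n) -> R) x :
  @alt_forms R n 2 w ->
  wedge w w (rowsmx 4 [seq x i | i <- iota 0 4]) = 2 * pf4 (idx2 w x) 0 1 2 3.
Proof.
move=> aw.
rewrite (@wedge_list 2 2 w w x (fun t => alt2 (idx2 w x) (nth 0%N t 0) (nth 0%N t 1) *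
   alt2 (idx2 w x) (nth 0%N t 2) (nth 0%N t 3))); last first.
  move=> t st t6; rewrite -!idx2_alt2 // /idx2.
  congr (w _ * w _); apply: rowsmx_ext => -[|[|]] //= _;
    by rewrite ?(nth_map 0%N) ?size_drop ?st // nth_drop.
rewrite sum22 /pf4; rewrite (_ : (2`! * 2`!)%N = 4%N) //.
by field.
Qed.

Lemma wedge42 (w : 'M[R]_(2, n) -> R) x :
  @alt_forms R n 2 w ->
  wedge (wedge w w) w (rowsmx 6 [seq x i | i <- iota 0 6]) = 6 * pf6 (idx2 w x).
Proof.
move=> aw.
rewrite (@wedge_list 4 2 (wedge w w) w x (fun t =>
  2 * (pf4 (alt2 (idx2 w x)) (nth 0%N t 0) (nth 0%N t 1) (nth 0%N t 2) (nth 0%N t 3) *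
   alt2 (idx2 w x) (nth 0%N t 4) (nth 0%N t 5)))); last first.
  move=> t st t6; rewrite /pf4 -!idx2_alt2 // mulrA.
  have := wedge22 (fun i => x (nth 0%N t i)) aw; rewrite /pf4 => <-; rewrite /idx2.
  congr (wedge w w _ * w _); apply: rowsmx_ext => -[|[|[|[|]]]] //= _;
    by rewrite ?(nth_map 0%N) ?size_drop ?st // nth_drop.
under eq_bigr do rewrite mulrCA.
rewrite -mulr_sumr sum42; rewrite (_ : (4`! * 2`!)%N = 48%N) //.
by field.
Qed.

End WedgeLists.

(** * Coefficients on the standard basis, the volume form and the Pfaffian *)

Section Six.
Variable R : realType.
Local Notation V := 'rV[R]_6.

Definition ebase (i : 'I_6) : V := delta_mx 0 i.
Definition coef3 (f : 'M[R]_(3, 6) -> R) (i j k : 'I_6) : R :=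
  f (rowsmx 3 [:: ebase i; ebase j; ebase k]).
Definition coef2 (w : 'M[R]_(2, 6) -> R) (i j : 'I_6) : R := w (rowsmx 2 [:: ebase i; ebase j]).
Definition nat_coef2 (w : 'M[R]_(2, 6) -> R) (i j : nat) : R := coef2 w (inord i) (inord j).

Lemma coef3_alt f : @alt_forms R 6 3 f -> alt_coef (coef3 f).
Proof.
move=> af; split=> *; rewrite /coef3.
- exact: alt3_swap12.
- exact: alt3_swap23.
- exact: alt3_diag.
Qed.

Lemma nat_coef2_alt2 w : @alt_forms R 6 2 w ->
  forall i j, (i < 6)%N -> (j < 6)%N -> nat_coef2 w i j = alt2 (nat_coef2 w) i j.
Proof.
move=> aw i j i6 j6; rewrite /alt2 /nat_coef2 /coef2; case: ltngtP => [//|ji|->].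
  exact: alt2_swap.
exact: alt2_diag.
Qed.

Lemma one_rowsmx : 1%:M = rowsmx 6 [seq ebase (inord i) | i <- iota 0 6].
Proof.
apply/row_matrixP => i; rewrite rowsmx_row row1 (nth_map 0%N) ?size_iota //.
by rewrite nth_iota // add0n inord_val.
Qed.

Lemma row'_rowsmx (m : 'I_6) :
  row' m 1%:M = rowsmx 5 [seq ebase (inord (bump m i)) | i <- iota 0 5].
Proof.
apply/row_matrixP => i; rewrite rowsmx_row (nth_map 0%N) ?size_iota //.
rewrite nth_iota // add0n; apply/rowP => j; rewrite !mxE eqxx /=.
by congr (_ %:R); congr nat_of_bool; rewrite (_ : inord _ = lift m i) 1?eq_sym //; apply: val_inj;
  rewrite /= inordK // (leq_trans (ltn_ord (lift m i))).
Qed.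

Variables (w : 'M[R]_(2, 6) -> R).
Hypothesis aw : @alt_forms R 6 2 w.

Definition pfaffian : R := pf6 (nat_coef2 w).

Lemma volume_alt : @alt_forms R 6 6 (volume w).
Proof.
have mw : multilinear_rows w by case: aw.
apply: alt_scale; apply: (@wedge_alt R 6 4 2) => //.
by have [] := wedge_alt mw mw.
Qed.

Lemma volume1 : volume w 1%:M = pfaffian.
Proof.
rewrite /volume one_rowsmx (wedge42 (fun i => ebase (inord i)) aw) mulrA mulVf ?mul1r // pnatr_eq0.
Qed.

Lemma volumeE A : volume w A = pfaffian * \det A.
Proof. by rewrite (top_form volume_alt) volume1. Qed.

Lemma form2_sum (I : finType) (u : V) (x : I -> R) (v : I -> V) :
  w (rowsmx 2 [:: u; \sum_i x i *: v i]) = \sum_i x i * w (rowsmx 2 [:: u; v i]).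
Proof.
have [mw _] := aw.
have e z : rowsmx 2 [:: u; z] = setrow 1 z (rowsmx 2 [:: u; 0]) by rewrite -rowsmx_set.
by rewrite e setrow_sum //; apply: eq_bigr => j _; rewrite -e.
Qed.

(** If the Pfaffian vanishes, then by [pf6_adj] the rows of [pf_adj] lie in the kernel of [w], so
    all 4x4 sub-Pfaffians are 0. Each of these is itself the pairing of a basis vector with a
    combination of three others, which again lies in the kernel; this forces w(e_m, e_0) = 0 for all
    m, so that e_0 is in the kernel. *)
Lemma pfaffian_neq0 : (forall u : V, (forall v, w (col_mx u v) = 0) -> u = 0) -> pfaffian != 0.
Proof.
move=> nd; apply/eqP => r0.
have colE (u v : V) : w (col_mx u v) = w (rowsmx 2 [:: u; v]).
  have e : rowsmx 1 [:: v] = v by apply/rowP => j; rewrite rowsmxE.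
  by have := @col_rowsmx R 6 1 u [:: v]; rewrite e => ->.
have ker (u : V) : (forall m : 'I_6, w (rowsmx 2 [:: ebase m; u]) = 0) -> u = 0.
  move=> h; apply: nd => v; rewrite colE.
  rewrite (row_sum_delta v) form2_sum big1 // => i _.
  by rewrite (alt2_swap aw) -/(ebase i) h oppr0 mulr0.
have ker' (x : nat -> R) :
    (forall m, (m < 6)%N -> sum6 (fun j => alt2 (nat_coef2 w) m j * x j) = 0) ->
    forall j, (j < 6)%N -> x j = 0.
  move=> h; have u0 : \sum_(j < 6) x j *: ebase j = 0.
    apply: ker => m; rewrite form2_sum -[RHS](h m) // sum6E /sum6 !inordK //.
    rewrite -!(nat_coef2_alt2 aw) // /nat_coef2 /coef2 !inord_val.
    by congr (_ + _ + _ + _ + _ + _); rewrite mulrC.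
  move=> j j6; have /rowP/(_ (inord j)) := u0; rewrite summxE mxE.
  rewrite (bigD1 (inord j)) //= big1 => [|i ij].
    by rewrite !mxE !eqxx mulr1 addr0 inordK.
  by rewrite !mxE eqxx eq_sym (negbTE ij) mulr0.
have padj0 n j : (n < 6)%N -> (j < 6)%N -> pf_adj (nat_coef2 w) n j = 0.
  move=> n6; apply: ker' => m m6; rewrite pf6_adj //.
  by move: r0; rewrite /pfaffian => ->; rewrite mulr0.
have A12 i j : alt2 (nat_coef2 w) j i = - alt2 (nat_coef2 w) i j.
  by rewrite /alt2; case: (ltngtP i j); rewrite ?opprK ?oppr0.
have A0 i : alt2 (nat_coef2 w) i i = 0 by rewrite /alt2 ltnn eqxx.
have pf0 a b c d : (a < 6)%N -> (b < 6)%N -> (c < 6)%N -> (d < 6)%N ->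
    pf4 (alt2 (nat_coef2 w)) a b c d = 0.
  apply: alt4_vanish; rewrite /pf4.
  - by move=> i j k l; rewrite (A12 i j); ring.
  - by move=> i j k l; rewrite (A12 j k); ring.
  - by move=> i j k l; rewrite (A12 k l); ring.
  - by move=> i j k; rewrite A0; ring.
  - exact: pf4_sorted padj0.
have w0 m : (m < 6)%N -> alt2 (nat_coef2 w) m 0 = 0.
  move=> m6; have [->|m0] := eqVneq m 0%N; first exact: A0.
  (* Any index other than 0 and [m] would do. *)
  pose i := if m == 1%N then 2%N else 1%N.
  have i6 : (i < 6)%N by rewrite /i; case: ifP.
  have im : i != m by rewrite /i; have [->|] := eqVneq m 1%N; rewrite // eq_sym.
  have i0 : i != 0%N by rewrite /i; case: ifP.
  (* The pairing of [e_l] with this vector is the sub-Pfaffian on [l], [i], [m], 0. *)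
  pose x l : R := (l == i)%:R * alt2 (nat_coef2 w) m 0 - (l == m)%:R * alt2 (nat_coef2 w) i 0
     + (l == 0%N)%:R * alt2 (nat_coef2 w) i m.
  have -> : alt2 (nat_coef2 w) m 0 = x i.
    by rewrite /x eqxx (negbTE im) (negbTE i0) mulr1n !mulr0n; ring.
  apply: ker' => // l l6; rewrite -[RHS](pf0 l i m 0%N) // /pf4 /x.
  have dl (y : nat -> R) k : (k < 6)%N -> sum6 (fun j => y j * (j == k)%:R) = y k.
    by move: k; apply: lt6P; rewrite /sum6 /= !(mulr0n, mulr1n); ring.
  rewrite -(dl (fun j => alt2 (nat_coef2 w) l j) i) // -(dl (fun j => alt2 (nat_coef2 w) l j) m) //.
  rewrite -(dl (fun j => alt2 (nat_coef2 w) l j) 0%N) // /sum6.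
  ring.
have e0 : ebase 0 = 0.
  apply: ker => m; have := w0 m (ltn_ord m);
    rewrite -(nat_coef2_alt2 aw) // /nat_coef2 /coef2 inord_val.
  by rewrite (_ : inord 0 = 0) //; apply: val_inj; rewrite /= inordK.
by move/rowP: e0 => /(_ 0); rewrite !mxE !eqxx => /eqP; rewrite oner_eq0.
Qed.

End Six.

(** * K, F and Q in coordinates *)

Section KQ.
Variable R : realType.
Local Notation V := 'rV[R]_6.
Variables (w : 'M[R]_(2, 6) -> R) (f : 'M[R]_(3, 6) -> R).
Hypotheses (aw : @alt_forms R 6 2 w) (af : @alt_forms R 6 3 f).
Local Notation rho := (pfaffian w).
Hypothesis rho0 : rho != 0.
Local Notation c := (coef3 f).
Let mf : multilinear_rows f. Proof. by case: af. Qed.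

Lemma interior_rowsmx k (a : 'M[R]_(1 + k, 6) -> R) X (l : seq V) :
  interior_product X a (rowsmx k l) = a (rowsmx (1 + k) (X :: l)).
Proof. by rewrite /interior_product col_rowsmx. Qed.

Lemma multilinear_row1 (X : V) y z :
  f (rowsmx 3 [:: X; y; z]) = \sum_u X 0 u * f (rowsmx 3 [:: ebase R u; y; z]).
Proof. by rewrite {1}(row_sum_delta X) multilinear_sum1. Qed.

Lemma shuffle23_sum (X : 'I_6 -> R) (a : 'I_6 -> nat -> nat -> R) b i j k l m :
  shuffle23 (fun i j => \sum_u X u * a u i j) b i j k l m =
    \sum_u X u * shuffle23 (a u) b i j k l m.
Proof.
rewrite /shuffle23; under [RHS]eq_bigr do rewrite !(mulrDr, mulrN, mulrA).
by rewrite !(big_split, sumrN) /= !mulr_suml.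
Qed.

Lemma wedge_row' X (m : 'I_6) :
  wedge (interior_product X f) f (row' m 1%:M) = (-1) ^+ m * (X *m iwedge_mx c c) 0 m.
Proof.
have aX : @alt_forms R 6 2 (interior_product X f) by exact: interior_alt.
rewrite row'_rowsmx (wedge23 (fun i => ebase R (inord (bump m i))) aX af).
have iX i j : idx2 (interior_product X f) (fun i => ebase R (inord (bump m i))) i j =
    \sum_u X 0 u * nat_coef c u (bump m i) (bump m j).
  rewrite /idx2 interior_rowsmx multilinear_row1; apply: eq_bigr => u _.
  by rewrite /nat_coef inord_val.
rewrite mxE mulr_sumr -[LHS](_ : shuffle23 (fun i j =>
  \sum_u X 0 u * nat_coef c u (bump m i) (bump m j))
  (fun i j k => nat_coef c (bump m i) (bump m j) (bump m k)) 0 1 2 3 4 = _);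
    last by rewrite /shuffle23 !iX.
rewrite shuffle23_sum; apply: eq_bigr => u _.
by rewrite iwedge_mxE /iwedge [RHS]mulrCA signrMK.
Qed.

(** As rho is nonzero, a vector is determined by its contraction with the volume form, so the choice
    made by [xget] is forced. *)
Lemma K_atE X : K_at w f X = X *m Kmx c rho.
Proof.
pose P (Y : V) := forall A : 'M[R]_(5, 6),
    interior_product Y (volume w) A = - wedge (interior_product X f) f A.
have aX : @alt_forms R 6 2 (interior_product X f) by exact: interior_alt.
have volrow (Y : V) (m : 'I_6) : interior_product Y (volume w) (row' m 1%:M) =
  rho * ((-1) ^+ m * Y 0 m).
  by rewrite /interior_product volumeE // (det_basis_row Y m).
have P0 : P (X *m Kmx c rho).
  move=> A.
  rewrite -mulN1r; apply: (@agree_codim1 R 5 (interior_product (X *m Kmx c rho) (volume w))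
     (fun A => -1 * wedge (interior_product X f) f A)).
  - by apply: interior_alt; exact: volume_alt.
  - apply: alt_scale; apply: (@wedge_alt R 6 2 3) => //; by case: aX.
  - move=> m; rewrite volrow wedge_row' KmxE -scalemxAr mxE mulN1r.
    by rewrite mulrCA (mulrA rho) mulrN divff // mulN1r mulrN.
have PU Y : P Y -> Y = X *m Kmx c rho.
  move=> PY; apply/rowP => m; have := PY (row' m 1%:M); rewrite -(P0 (row' m 1%:M)).
  rewrite !volrow => /(mulfI rho0) /(congr1 ( *%R ((-1) ^+ m))).
  by rewrite !mulrA -expr2 sqrr_sign !mul1r.
by apply: PU; apply: (@xgetPex _ 0 P); exists (X *m Kmx c rho).
Qed.

Lemma F_atE A : F_at w f A = - 2 * f (col_mx (usubmx A *m Kmx c rho) (dsubmx A)).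
Proof. by rewrite /F_at K_atE. Qed.

Lemma coef3_F i j k : coef3 (F_at w f) i j k = - 2 * Kcoef c rho i j k.
Proof.
rewrite /coef3 F_atE; congr (_ * _).
rewrite (_ : usubmx _ = ebase R i); last first.
  by apply/rowP => a; rewrite mxE rowsmxE.
rewrite (_ : dsubmx _ = rowsmx 2 [:: ebase R j; ebase R k]); last exact: (@dsub_rowsmx R 6 1 2).
rewrite col_rowsmx multilinear_row1 /Kcoef /mx_act1; apply: eq_bigr => u _; congr (_ * _).
by rewrite -rowE mxE.
Qed.

Lemma multilinear_mul_row0 (g : 'M[R]_6) :
  multilinear_rows (fun A : 'M[R]_(1 + 2, 6) => f (col_mx (usubmx A *m g) (dsubmx A))).
Proof.
move=> i A B C x y rA /row'_eqP rB /row'_eqP rC.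
have E (D : 'M[R]_(1 + 2, 6)) r : row r (col_mx (usubmx D *m g) (dsubmx D) : 'M[R]_(1 + 2, 6)) =
   match fintype.split r with inl _ => row r D *m g | inr _ => row r D end.
  case: splitP => r' rE.
    by rewrite (_ : r = lshift 2 r') ?rowKu ?row_mul ?row_usub //; apply: val_inj.
  by rewrite (_ : r = rshift 1 r') ?rowKd ?row_dsub //; apply: val_inj.
apply: (mf (i := i)).
- by rewrite !E; case: fintype.split => _; rewrite rA // mulmxDl -!scalemxAl.
- by apply: row'_eq => r ri; rewrite !E rB.
- by apply: row'_eq => r ri; rewrite !E rC.
Qed.

Lemma F_multilinear : multilinear_rows (F_at w f).
Proof.
move=> i A B C x y rA rB rC.
rewrite !F_atE !(mulrCA _ (- 2)) -mulrDr; congr (_ * _).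
exact: (multilinear_mul_row0 _ rA rB rC).
Qed.

Lemma wedge_F1 : wedge f (F_at w f) 1%:M = - 2 * pair_coef c (Kcoef c rho).
Proof.
have aP : alt_coef (Kcoef c rho) by exact: Kcoef_alt (coef3_alt af).
have aF : alt_coef (coef3 (F_at w f)).
  apply: (@alt_coef_ext _ (fun i j k => - 2 * Kcoef c rho i j k + 0 * Kcoef c rho i j k)).
    by move=> i j k; rewrite coef3_F; ring.
  exact: alt_coef_lin.
rewrite one_rowsmx wedge33; first last.
- exact: nat_coef_alt3 aF.
- exact: nat_coef_alt3 (coef3_alt af).
rewrite -[LHS]/(pair_coef c (coef3 (F_at w f))) -pair_coef_scaler.
by apply: pair_coef_ext => // i j k; rewrite coef3_F.
Qed.

Lemma Q_atE : Q_at w f = 2 * pair_coef c (Kcoef c rho) / rho.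
Proof.
pose P (q : R) := forall A : 'M[R]_(6, 6), wedge f (F_at w f) A = - q * volume w A.
have aF : @alt_forms R 6 6 (wedge f (F_at w f)).
  by apply: (@wedge_alt R 6 3 3) => //; exact: F_multilinear.
have P0 : P (2 * pair_coef c (Kcoef c rho) / rho).
  move=> A; rewrite (top_form aF) wedge_F1 volumeE //.
  by rewrite mulrA; congr (_ * _); field.
have PU q : P q -> q = 2 * pair_coef c (Kcoef c rho) / rho.
  move=> /(_ 1%:M); rewrite P0 !volume1 // => /(mulIf rho0) /oppr_inj -> //.
by apply: PU; apply: (@xgetPex _ 0 P); exists (2 * pair_coef c (Kcoef c rho) / rho).
Qed.

End KQ.

(** * Derivatives of K, P and Q *)

Section JetCalculus.
Variables (R : realType) (x0 : 'rV[R]_6).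
Local Notation V := 'rV[R]_6.
Local Notation coef := ('I_6 -> 'I_6 -> 'I_6 -> R).

(** Differentiability is bundled with the partial derivatives, so that both are computed together by
    the rules for sums, products and inverses. *)
Definition jet (phi : V -> R) (g : 'I_6 -> R) : Prop :=
  differentiable phi x0 /\ forall v, 'D_v phi x0 = \sum_a v 0 a * g a.

Lemma jet_diff phi : differentiable phi x0 -> jet phi (fun a => 'D_(ebase R a) phi x0).
Proof.
move=> d; split=> // v; rewrite deriveE // {1}(row_sum_delta v) linear_sum /=.
by apply: eq_bigr => a _; rewrite linearZ /= deriveE.
Qed.

Lemma jet_eq phi g g' : jet phi g -> (forall a, g a = g' a) -> jet phi g'.
Proof. by move=> [d h] e; split=> // v; rewrite h; apply: eq_bigr => a _; rewrite e. Qed.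

Lemma jet_cst (k : R) : jet (fun=> k) (fun=> 0).
Proof.
split; first exact: differentiable_cst.
by move=> v; rewrite derive_cst big1 // => a _; rewrite mulr0.
Qed.

Lemma jetD phi psi g h : jet phi g -> jet psi h ->
  jet (fun x => phi x + psi x) (fun a => g a + h a).
Proof.
move=> [dp ep] [dq eq]; split; first exact: (differentiableD dp dq).
move=> v; rewrite (deriveD (diff_derivable dp) (diff_derivable dq)) ep eq -big_split.
by apply: eq_bigr => a _; rewrite mulrDr.
Qed.

Lemma jetN phi g : jet phi g -> jet (fun x => - phi x) (fun a => - g a).
Proof.
move=> [dp ep]; split; first exact: (differentiableN dp).
move=> v; rewrite (deriveN (diff_derivable dp)) ep -sumrN.
by apply: eq_bigr => a _; rewrite mulrN.
Qed.

Lemma jetM phi psi g h : jet phi g -> jet psi h ->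
  jet (fun x => phi x * psi x) (fun a => g a * psi x0 + phi x0 * h a).
Proof.
move=> [dp ep] [dq eq]; split; first exact: (differentiableM dp dq).
move=> v; rewrite (deriveM (diff_derivable dp) (diff_derivable dq)) ep eq.
rewrite /GRing.scale /= !mulr_sumr -big_split.
by apply: eq_bigr => a _ /=; ring.
Qed.

Lemma jetV phi g : phi x0 != 0 -> jet phi g ->
  jet (fun x => (phi x)^-1) (fun a => - g a / phi x0 ^+ 2).
Proof.
move=> p0 [dp ep]; split; first exact: (differentiableV dp p0).
move=> v; rewrite (deriveV p0 (diff_derivable dp)) ep /GRing.scale /= mulr_sumr.
by apply: eq_bigr => a _; field.
Qed.

Lemma jet_sum (I : finType) (phi : I -> V -> R) g : (forall i, jet (phi i) (g i)) ->
  jet (fun x => \sum_i phi i x) (fun a => \sum_i g i a).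
Proof.
move=> h; elim: (index_enum I) => [|i s IH].
  by under eq_fun do rewrite big_nil; apply: jet_eq (jet_cst 0) _ => a; rewrite big_nil.
under eq_fun do rewrite big_cons.
by apply: jet_eq (jetD (h i) IH) _ => a; rewrite big_cons.
Qed.

Lemma jet_derive phi g a : jet phi g -> 'D_(ebase R a) phi x0 = g a.
Proof.
move=> [_ ->]; rewrite (bigD1 a) //= big1 => [|b ba].
  by rewrite mxE !eqxx mul1r addr0.
by rewrite mxE eqxx (negbTE ba) mul0r.
Qed.

Lemma jet_iwedge_mx (c d : V -> coef) (dc dd : 'I_6 -> coef) u m :
  (forall i j k, jet (fun x => c x i j k) (fun a => dc a i j k)) ->
  (forall i j k, jet (fun x => d x i j k) (fun a => dd a i j k)) ->
  jet (fun x => iwedge_mx (c x) (d x) u m) (fun a =>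
    (iwedge_mx (dc a) (d x0) + iwedge_mx (c x0) (dd a)) u m).
Proof.
move=> hc hd; under eq_fun do rewrite iwedge_mxE /iwedge /codim1_coef /shuffle23 /nat_coef.
apply: jet_eq.
  apply: jetM; first exact: jet_cst.
  do ![apply: jetD | apply: jetN | apply: jetM | exact: hc | exact: hd].
by move=> a /=; rewrite mxE !iwedge_mxE /iwedge /codim1_coef /shuffle23 /nat_coef; ring.
Qed.

Lemma jet_pair (c d : V -> coef) (dc dd : 'I_6 -> coef) :
  (forall i j k, jet (fun x => c x i j k) (fun a => dc a i j k)) ->
  (forall i j k, jet (fun x => d x i j k) (fun a => dd a i j k)) ->
  jet (fun x => pair_coef (c x) (d x)) (fun a => pair_coef (dc a) (d x0) + pair_coef (c x0) (dd a)).
Proof.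
move=> hc hd; rewrite /pair_coef /pair3 /nat_coef.
apply: jet_eq.
  do ![apply: jetD | apply: jetN | apply: jetM | exact: hc | exact: hd].
by move=> a /=; ring.
Qed.

Lemma jet_pf6 (w : V -> nat -> nat -> R) (dw : 'I_6 -> nat -> nat -> R) :
  (forall i j, jet (fun x => w x i j) (fun a => dw a i j)) ->
  exists g, jet (fun x => pf6 (w x)) g.
Proof.
move=> hw; eexists; rewrite /pf6 /pf4.
do ![apply: jetD | apply: jetN | apply: jetM | exact: hw].
Qed.

Section Fields.
Variables (c : V -> coef) (rho : V -> R) (dc : 'I_6 -> coef) (drho : 'I_6 -> R).
Hypotheses (hc : forall i j k, jet (fun x => c x i j k) (fun a => dc a i j k))
  (hr : jet rho drho) (r0 : rho x0 != 0).

Lemma jet_K u m : jet (fun x => Kmx (c x) (rho x) u m)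
  (fun a => dKmx (c x0) dc (rho x0) drho a u m).
Proof.
have -> : (fun x => Kmx (c x) (rho x) u m) = (fun x => - (rho x)^-1 * iwedge_mx (c x) (c x) u m).
  by apply/funext => x; rewrite KmxE mxE.
apply: jet_eq; first by apply: jetM; [apply: jetN; exact: jetV r0 hr|exact: jet_iwedge_mx hc hc].
move=> a /=; rewrite dKmxE KmxE; move: (iwedge_mx (c x0) (c x0)) (iwedge_mx (dc a) _ + _) => A S.
by rewrite !mxE; field.
Qed.

Lemma jet_Kcoef i j k : jet (fun x => Kcoef (c x) (rho x) i j k)
  (fun a => dKcoef (c x0) dc (rho x0) drho a i j k).
Proof.
apply: jet_eq.
  by apply: jet_sum => n; apply: jetM; [exact: jet_K|exact: hc].
by move=> a /=; rewrite big_split.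
Qed.

Lemma jet_Q : (forall a, alt_coef (dc a)) -> alt_coef (c x0) -> closed_jet dc ->
  closed_jet (dKcoef (c x0) dc (rho x0) drho) ->
  jet (fun x => 2 * pair_coef (c x) (Kcoef (c x) (rho x)) / rho x) (fun=> 0).
Proof.
move=> adc ac cl clP.
apply: jet_eq.
  apply: jetM; last exact: jetV r0 hr.
  apply: jetM; first exact: jet_cst.
  exact: jet_pair hc jet_Kcoef.
move=> a /=; have := dpairE ac adc r0 cl clP a; rewrite /dpair => ->.
by field.
Qed.

Definition vjet (Z : V -> V) (DZ : 'M[R]_6) := forall m, jet (fun x => Z x 0 m) (fun a => DZ a m).

Lemma vjet_derive Z DZ v : vjet Z DZ -> 'D_v Z x0 = v *m DZ.
Proof.
move=> h; rewrite derive_mx; last first.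
  by apply/derivable_mxP => i m; rewrite ord1; apply: diff_derivable; case: (h m).
by apply/rowP => m; rewrite !mxE; case: (h m) => _ ->.
Qed.

Lemma vjetK Z DZ : vjet Z DZ ->
  exists2 DKZ, vjet (fun x => Z x *m Kmx (c x) (rho x)) DKZ &
    forall v, v *m DKZ = v *m DZ *m Kmx (c x0) (rho x0)
       + Z x0 *m dirmx (dKmx (c x0) dc (rho x0) drho) v.
Proof.
move=> h; exists (\matrix_(a, m) \sum_u (DZ a u * Kmx (c x0) (rho x0) u m
     + Z x0 0 u * dKmx (c x0) dc (rho x0) drho a u m)).
  move=> m; under eq_fun do rewrite mxE.
  apply: jet_eq; first by apply: jet_sum => u; apply: jetM; [exact: h|exact: jet_K].
  by move=> a /=; rewrite mxE.
move=> v; apply/rowP => m; rewrite !mxE.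
under eq_bigr do rewrite mxE big_split /= mulrDr.
rewrite big_split /=; congr (_ + _).
  under [RHS]eq_bigr do rewrite mxE mulr_suml.
  rewrite exchange_big /=; apply: eq_bigr => a _; rewrite mulr_sumr.
  by apply: eq_bigr => u _; rewrite mulrA.
under [RHS]eq_bigr do rewrite summxE mulr_sumr.
rewrite exchange_big /=; apply: eq_bigr => a _; rewrite mulr_sumr.
by apply: eq_bigr => u _; rewrite mxE mulrCA.
Qed.

End Fields.
End JetCalculus.

(** * Constancy of Q and vanishing of N_K on an open set of coordinates *)

Section Local.
Variables (R : realType) (D : set 'rV[R]_6).
Local Notation V := 'rV[R]_6.
Variables (w : V -> 'M[R]_(2, 6) -> R) (f : V -> 'M[R]_(3, 6) -> R).
Hypotheses (oD : open D)
  (aw : forall x, D x -> @alt_forms R 6 2 (w x))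
  (af : forall x, D x -> @alt_forms R 6 3 (f x))
  (dw : forall x A, D x -> differentiable (fun x => w x A) x)
  (df : forall x A, D x -> differentiable (fun x => f x A) x)
  (nd : forall x, D x -> forall u : V, (forall v, w x (col_mx u v) = 0) -> u = 0)
  (clf : forall x, D x -> forall A, ext_derivative f x A = 0)
  (clF : forall x, D x -> forall A, ext_derivative (fun y => F_at (w y) (f y)) x A = 0).

Let c x := coef3 (f x).
Let rho x := pfaffian (w x).

Variables (x0 : V) (Dx0 : D x0).

Let r0 x : D x -> rho x != 0. Proof. by move=> Dx; apply: pfaffian_neq0; [exact: aw|exact: nd]. Qed.

Let nearD : \forall x \near x0, D x. Proof. exact: open_nbhs_nbhs. Qed.

Let dc a : 'I_6 -> 'I_6 -> 'I_6 -> R := fun i j k => 'D_(ebase R a) (fun x => c x i j k) x0.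

Let hc i j k : jet x0 (fun x => c x i j k) (fun a => dc a i j k).
Proof. by apply: jet_diff; exact: df. Qed.

Let jr : exists g, jet x0 rho g.
Proof.
apply: (@jet_pf6 _ x0 (fun x => nat_coef2 (w x)) (fun a i j =>
  'D_(ebase R a) (fun x => nat_coef2 (w x) i j) x0)).
by move=> i j; apply: jet_diff; exact: dw.
Qed.

Lemma row'_rowsmx4 (r : 'I_4) (s : seq V) : size s = 4%N ->
  row' r (rowsmx 4 s) = rowsmx 3 (take r s ++ drop r.+1 s).
Proof.
move=> s4; apply/row_matrixP => i; apply/rowP => j.
rewrite !mxE; congr (fun_of_matrix _ _ _).
rewrite nth_cat size_take s4 ltn_ord /= /bump; case: leqP => ri.
  by rewrite nth_drop addSn subnKC.
by rewrite nth_take.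
Qed.

Lemma ext_derivative4 (g : V -> 'M[R]_(3, 6) -> R) a i j k :
  ext_derivative g x0 (rowsmx 4 [:: ebase R a; ebase R i; ebase R j; ebase R k]) =
  'D_(ebase R a) (fun y => coef3 (g y) i j k) x0 - 'D_(ebase R i) (fun y => coef3 (g y) a j k) x0
  + 'D_(ebase R j) (fun y => coef3 (g y) a i k) x0 - 'D_(ebase R k) (fun y => coef3 (g y) a i j) x0.
Proof.
rewrite /ext_derivative !big_ord_recl big_ord0 addr0 !rowsmx_row !row'_rowsmx4 //=.
by rewrite /coef3 expr0 expr1 !mul1r !mulN1r !addrA sqrrN !expr1n !mul1r exprS expr2 mulN1r
  !mulrNN !mul1r !mulN1r.
Qed.

Let adc a : alt_coef (dc a).
Proof.
have e (g g' : V -> R) : (forall x, D x -> g x = - g' x) -> differentiable g' x0 ->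
    'D_(ebase R a) g x0 = - 'D_(ebase R a) g' x0.
  move=> h dg; rewrite -(deriveN (diff_derivable dg)).
  by apply: near_eq_derive; apply: filterS nearD => x /h.
split=> [i j k|i j k|i k].
- by apply: e => [x Dx|]; [have [h _ _] := coef3_alt (af Dx); exact: h|exact: df].
- by apply: e => [x Dx|]; [have [_ h _] := coef3_alt (af Dx); exact: h|exact: df].
- rewrite /dc -(derive_cst (0 : R) x0 (ebase R a)); apply: near_eq_derive.
  by apply: filterS nearD => x Dx; have [_ _ h] := coef3_alt (af Dx); exact: h.
Qed.

Let cl : closed_jet dc.
Proof. by move=> a i j k; rewrite -(clf Dx0
  (rowsmx 4 [:: ebase R a; ebase R i; ebase R j; ebase R k])) ext_derivative4. Qed.

(** Near the point F is - 2 P, so dF = 0 gives dP = 0. *)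
Lemma closed_jet_dKcoef drho : jet x0 rho drho -> closed_jet (dKcoef (c x0) dc (rho x0) drho).
Proof.
move=> hr a i j k.
have DF b i' j' k' : 'D_(ebase R b) (fun y => coef3 (F_at (w y) (f y)) i' j' k') x0 =
    - 2 * dKcoef (c x0) dc (rho x0) drho b i' j' k'.
  transitivity ('D_(ebase R b) (fun y => - 2 * Kcoef (c y) (rho y) i' j' k') x0).
    apply: near_eq_derive; apply: filterS nearD => x Dx.
    by rewrite coef3_F //; [exact: aw|exact: af|exact: r0].
  rewrite (jet_derive _ (jetM (jet_cst x0 (- 2)) (jet_Kcoef hc hr (r0 Dx0) i' j' k'))).
  by rewrite mul0r add0r.
have := clF Dx0 (rowsmx 4 [:: ebase R a; ebase R i; ebase R j; ebase R k]).
rewrite ext_derivative4 !DF => h.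
apply: (@mulfI _ (- 2)); first by rewrite oppr_eq0 pnatr_eq0.
by rewrite mulr0 -[RHS]h; ring.
Qed.

Lemma Q_at_derive0 v : is_derive x0 v (fun x => Q_at (w x) (f x)) 0.
Proof.
have [drho hr] := jr.
have [dQ eQ] := jet_Q hc hr (r0 Dx0) adc (coef3_alt (af Dx0)) cl (closed_jet_dKcoef hr).
apply: (@near_eq_is_derive _ _ _ (fun x => 2 * pair_coef (c x) (Kcoef (c x) (rho x)) / rho x)).
  by apply: filterS nearD => x Dx; rewrite Q_atE //; [exact: aw|exact: af|exact: r0].
apply: DeriveDef; first exact: diff_derivable.
by rewrite eQ big1 // => a _; rewrite mulr0.
Qed.

Lemma differentiable_vjet (X : V -> V) : differentiable X x0 ->
  vjet x0 X (\matrix_(a, m) 'D_(ebase R a) (fun x => X x 0 m) x0).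
Proof.
move=> dX m; apply: jet_eq; last by move=> a; rewrite mxE.
apply: jet_diff.
exact: (@differentiable_comp _ _ _ _ X (fun Z : V => Z 0 m) x0 dX (differentiable_coord _ _ _)).
Qed.

Lemma nijenhuis_K_at0 (X Y : V -> V) : differentiable X x0 -> differentiable Y x0 ->
  nijenhuis (fun y => K_at (w y) (f y)) X Y x0 = 0.
Proof.
move=> dX dY; have [drho hr] := jr.
have hX := differentiable_vjet dX; have hY := differentiable_vjet dY.
set DX := \matrix_(a, m) _ in hX; set DY := \matrix_(a, m) _ in hY.
have [DKX hKX KXE] := vjetK hc hr (r0 Dx0) hX.
have [DKY hKY KYE] := vjetK hc hr (r0 Dx0) hY.
have KE Z x : D x -> K_at (w x) (f x) Z = Z *m Kmx (c x) (rho x).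
  by move=> Dx; apply: K_atE; [exact: aw|exact: af|exact: r0].
have DK (Z : V -> V) v : 'D_v (fun y => K_at (w y) (f y) (Z y)) x0 =
    'D_v (fun y => Z y *m Kmx (c y) (rho y)) x0.
  by apply: near_eq_derive; apply: filterS nearD => x Dx; rewrite KE.
rewrite /nijenhuis /lie_bracket !DK !(vjet_derive _ hX) !(vjet_derive _ hY)
  !(vjet_derive _ hKX) !(vjet_derive _ hKY) !KXE !KYE !KE //.
set K := Kmx _ _; set x := X x0; set y := Y x0; set dir := dirmx _.
have := @nijmx_eq0 _ _ K (dKmx (c x0) dc (rho x0) drho)
  (dKmx_Kdir (coef3_alt (af Dx0)) adc (r0 Dx0) cl (closed_jet_dKcoef hr)) x y.
rewrite /nijmx -/dir => <-.
(* The terms with the Jacobians of X and Y cancel: this is the tensoriality of N_K. *)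
rewrite !(mulmxBl, mulmxDl, mulNmx, mulmxA).
move: (x *m DY *m K *m K) (y *m DX *m K *m K) (x *m K *m DY *m K)
  (x *m dir y *m K) (y *m dir x *m K) (y *m K *m DX *m K) (x *m dir (y *m K)) (y *m dir (x *m K)).
move=> *; apply/rowP => m; rewrite !mxE; ring.
Qed.

End Local.

(** * Equivariance *)

Section Equivariance.
Variable R : realType.
Local Notation V := 'rV[R]_6.

(** Hitchin's quartic invariant of a 3-form, relative to the volume form [det]. *)
Definition quartic (f : 'M[R]_(3, 6) -> R) : R := Ksq (coef3 f) 1.
Definition Kunit (f : 'M[R]_(3, 6) -> R) : 'M[R]_6 := - iwedge_mx (coef3 f) (coef3 f).

Lemma KunitE f : Kmx (coef3 f) 1 = Kunit f.
Proof. by rewrite KmxE invr1 scaleN1r. Qed.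

Lemma Kunit_sqr f : @alt_forms R 6 3 f -> Kunit f *m Kunit f = (quartic f)%:M.
Proof. by move=> af; rewrite -KunitE Kmx_sqr // ?oner_neq0 //; exact: coef3_alt. Qed.

Lemma Kcoef_scale c (rho : R) : rho != 0 -> forall i j k, Kcoef c rho i j k =
  rho^-1 * Kcoef c 1 i j k.
Proof.
move=> r0 i j k; rewrite /Kcoef (_ : Kmx c rho = rho^-1 *: Kmx c 1) ?mx_act1_scale //.
by rewrite !KmxE invr1 scaleN1r scalerN scaleNr.
Qed.

Lemma Q_at_quartic w f : @alt_forms R 6 2 w -> @alt_forms R 6 3 f -> pfaffian w != 0 ->
  Q_at w f = 4 * quartic f / pfaffian w ^+ 2.
Proof.
move=> aw af r0; rewrite Q_atE // /quartic /Ksq.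
rewrite (pair_coef_ext (c' := coef3 f) (d' := fun i j k =>
  (pfaffian w)^-1 * Kcoef (coef3 f) 1 i j k)) //.
  by rewrite pair_coef_scaler; field.
by move=> i j k; exact: Kcoef_scale.
Qed.

(** A description of T valid on arbitrary arguments [A], as needed when the frame changes. *)
Lemma wedge_interior f X A : @alt_forms R 6 3 f ->
  wedge (interior_product X f) f A = \det (col_mx (X *m iwedge_mx (coef3 f) (coef3 f)) A :
    'M[R]_(1 + 5, 6)).
Proof.
move=> af; have aX : @alt_forms R 6 2 (interior_product X f) by exact: interior_alt.
apply: (@agree_codim1 R 5 (wedge (interior_product X f) f)
  (interior_product (X *m iwedge_mx (coef3 f) (coef3 f)) (fun A : 'M[R]_(1 + 5, 6) => \det A))).
- by apply: (@wedge_alt R 6 2 3) => //; [case: aX | case: af].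
- by apply: interior_alt; exact: (@det_alt R 6).
- by move=> m; rewrite wedge_row' // /interior_product (det_basis_row (X *m _) m).
Qed.

Lemma iwedge_mx_pullback f (g : 'M[R]_6) : @alt_forms R 6 3 f -> g \in unitmx ->
  Kunit (fun A => f (A *m g)) = \det g *: (g *m Kunit f *m invmx g).
Proof.
move=> af ug; rewrite /Kunit mulmxN mulNmx scalerN; congr (- _).
set f' := fun A => f (A *m g).
have af' : @alt_forms R 6 3 f' by exact: pullback_alt.
apply/row_matrixP => u; apply/rowP => m.
rewrite !rowE; set X := delta_mx 0 u.
have h := wedge_row' af' X m.
have : wedge (interior_product X f') f' (row' m 1%:M) =
    (-1) ^+ m * (X *m (\det g *: (g *m iwedge_mx (coef3 f) (coef3 f) *m invmx g))) 0 m.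
  transitivity (wedge (interior_product (X *m g) f) f (row' m 1%:M *m g)).
    rewrite (@wedge_pullback R 6 2 3); congr wedge; apply/funext => B.
    exact: (congr1 f (mul_col_mx X B g)).
  rewrite wedge_interior //.
  have -> : col_mx (X *m g *m iwedge_mx (coef3 f) (coef3 f)) (row' m 1%:M *m g) =
    (col_mx (X *m (g *m iwedge_mx (coef3 f) (coef3 f) *m invmx g)) (row' m 1%:M) :
      'M[R]_(1 + 5, 6)) *m g.
    by rewrite mul_col_mx !mulmxA mulmxKV.
  rewrite det_mulmx (det_basis_row (X *m _) m) -scalemxAr [in RHS]mxE mulrC.
  by rewrite mulrCA.
by rewrite h => /(congr1 ( *%R ((-1) ^+ m))); rewrite !signrMK.
Qed.

Lemma quartic_pullback f (g : 'M[R]_6) : @alt_forms R 6 3 f -> g \in unitmx ->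
  quartic (fun A => f (A *m g)) = \det g ^+ 2 * quartic f.
Proof.
move=> af ug; have af' : @alt_forms R 6 3 (fun A => f (A *m g)) by exact: pullback_alt.
have := Kunit_sqr af'; rewrite iwedge_mx_pullback // -scalemxAl -scalemxAr scalerA -expr2.
rewrite -!mulmxA (mulmxA (invmx g)) mulVmx // mul1mx (mulmxA (Kunit f)) Kunit_sqr //.
rewrite mul_scalar_mx -scalemxAr mulmxV // scalemx1 scale_scalar_mx.
by move/matrixP => /(_ 0 0); rewrite !mxE eqxx !mulr1n => <-.
Qed.

Lemma pfaffian_pullback w (g : 'M[R]_6) : @alt_forms R 6 2 w ->
  pfaffian (fun A => w (A *m g)) = \det g * pfaffian w.
Proof.
move=> aw; have aw' : @alt_forms R 6 2 (fun A => w (A *m g)) by exact: pullback_alt.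
rewrite -volume1 // -[X in X * _]mul1r -[pfaffian w]mul1r mulrCA mul1r mul1r.
transitivity (volume w (1%:M *m g)); last by rewrite volumeE // mul1mx mulrC.
rewrite /volume (@wedge_pullback R 6 4 2); congr (_ * wedge _ _ _).
by apply/funext => B; rewrite (@wedge_pullback R 6 2 2).
Qed.

End Equivariance.

(** * Normal form and stability *)

Section Trilinear.
Variables (R : realType) (f : 'M[R]_(3, 6) -> R).
Hypothesis af : @alt_forms R 6 3 f.
Local Notation V := 'rV[R]_6.
Let mf : multilinear_rows f. Proof. by case: af. Qed.

Definition f3 (x y z : V) : R := f (rowsmx 3 [:: x; y; z]).

Lemma f3_swap12 x y z : f3 y x z = - f3 x y z. Proof. exact: alt3_swap12. Qed.
Lemma f3_swap23 x y z : f3 x z y = - f3 x y z. Proof. exact: alt3_swap23. Qed.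

Lemma f3_lin (a b : R) x x' y z : f3 (a *: x + b *: x') y z = a * f3 x y z + b * f3 x' y z.
Proof.
have e v : rowsmx 3 [:: v; y; z] = setrow 0 v (rowsmx 3 [:: 0; y; z]) by rewrite -rowsmx_set.
by rewrite /f3 (e (_ + _)) setrow_lin // -!e.
Qed.

Lemma f3_scale a x y z : f3 (a *: x) y z = a * f3 x y z.
Proof. by rewrite -[a *: x]addr0 -[0](scale0r x) f3_lin mul0r addr0. Qed.

Lemma f3_coef3 x y z : f3 x y z = \sum_i \sum_j \sum_k x 0 i * (y 0 j * (z 0 k * coef3 f i j k)).
Proof.
rewrite /f3 {1}(row_sum_delta x) multilinear_sum1 //; apply: eq_bigr => i _.
under eq_bigr do rewrite -mulr_sumr; rewrite -mulr_sumr; congr (_ * _).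
rewrite {1}(row_sum_delta y) multilinear_sum2 //; apply: eq_bigr => j _.
rewrite -mulr_sumr; congr (_ * _).
rewrite {1}(row_sum_delta z) -[LHS]/(f3 _ _ _) f3_swap23 f3_swap12 opprK /f3 multilinear_sum1 //.
apply: eq_bigr => k _; congr (_ * _).
by rewrite -[LHS]/(f3 _ _ _) f3_swap12 f3_swap23 opprK.
Qed.

Local Notation K := (Kunit f).

Lemma f3_K x y z : f3 (x *m K) y z =
  \sum_i \sum_j \sum_k x 0 i * (y 0 j * (z 0 k * Kcoef (coef3 f) 1 i j k)).
Proof.
rewrite mulmx_sum_row {1}/f3 multilinear_sum1 //; apply: eq_bigr => i _.
rewrite -[f _]/(f3 _ _ _) f3_coef3 exchange_big /= mulr_sumr; apply: eq_bigr => j _.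
rewrite exchange_big /= mulr_sumr; apply: eq_bigr => k _.
rewrite /Kcoef /mx_act1 KunitE !mulr_sumr; apply: eq_bigr => n _.
by rewrite mxE; ring.
Qed.

Lemma f3_K12 x y z : f3 (y *m K) x z = - f3 (x *m K) y z.
Proof.
rewrite !f3_K exchange_big /= -sumrN; apply: eq_bigr => i _.
rewrite -sumrN; apply: eq_bigr => j _; rewrite -sumrN; apply: eq_bigr => k _.
by have [-> _ _] := Kcoef_alt 1 (coef3_alt af); ring.
Qed.

Lemma f3_sym x y z : f3 x (y *m K) z = f3 (x *m K) y z.
Proof. by rewrite f3_swap12 f3_K12 opprK. Qed.

Lemma f3_sym3 x y z : f3 x y (z *m K) = f3 (x *m K) y z.
Proof. by rewrite f3_swap23 f3_sym f3_swap23 opprK. Qed.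

Lemma Kunit_ker c : (forall i j k, mx_act1 (K - c%:M) (coef3 f) i j k = 0) -> (K - c%:M) *m K = 0.
Proof.
move=> h; rewrite {2}/Kunit mulmxN -iwedge_mx_mx_act1.
rewrite (iwedge_mx_ext (c' := fun i j k => 0 * coef3 f i j k) (d' := coef3 f)) //; last first.
  by move=> i j k; rewrite h mul0r.
by rewrite iwedge_mx_scalel scale0r oppr0.
Qed.

Lemma Kunit_tr : \tr K = 0.
Proof. by rewrite /Kunit raddfN /= iwedge_mx_tr ?oppr0 //; exact: coef3_alt. Qed.

Hypothesis l0 : quartic f != 0.

(** Otherwise (K - s) T(f, f) = 0, that is K^2 = s K. Taking traces contradicts the fact that K is
    traceless with nonzero scalar square. *)
Lemma f3_nscalar (s : R) : exists x y z, f3 (x *m K) y z != s * f3 x y z.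
Proof.
apply: contrapT => h; have {}h x y z : f3 (x *m K) y z = s * f3 x y z.
  by apply/eqP; apply: contrapT => /negP h'; apply: h; exists x, y, z.
have ks : (K - s%:M) *m K = 0.
  apply: Kunit_ker => i j k.
  have e0 : f3 (1 *: (ebase R i *m K) + (- s) *: ebase R i) (ebase R j) (ebase R k) = 0.
    by rewrite f3_lin h; ring.
  rewrite -[RHS]e0 /f3 multilinear_row1 //; apply: eq_bigr => n _; congr (_ * _).
  rewrite -rowE; move: K => K'; rewrite !mxE eqxx /= eq_sym.
  by case: eqP => _; rewrite ?mulr1n ?mulr0n; ring.
move/eqP: ks; rewrite mulmxBl Kunit_sqr // subr_eq0 => /eqP /(congr1 mxtrace).
rewrite mul_scalar_mx mxtrace_scalar mxtraceZ Kunit_tr mulr0 => /eqP.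
by rewrite mulrn_eq0 /= (negbTE l0).
Qed.

(** When [quartic f = s^2 > 0], [f] splits along the eigenspaces of [K] for [s] and
    [- s]; a triple on which both parts are nonzero is assembled from one triple
    for each. *)
Lemma f3_unit : exists x y z, f3 (x *m K) y z ^+ 2 != quartic f * f3 x y z ^+ 2.
Proof.
apply: contrapT => h; have {}h x y z : f3 (x *m K) y z ^+ 2 = quartic f * f3 x y z ^+ 2.
  by apply/eqP; apply: contrapT => /negP h'; apply: h; exists x, y, z.
have [ln|lp] := ltP (quartic f) 0.
  have [x [y [z]]] := f3_nscalar 0; rewrite mul0r; apply/negP; rewrite negbK.
  have := h x y z => e; rewrite -sqrf_eq0 -(inj_eq (@oppr_inj _)) oppr0.
  have p1 := sqr_ge0 (f3 (x *m K) y z); have p2 := sqr_ge0 (f3 x y z).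
  by apply/eqP; nra.
have {lp} lp : 0 < quartic f by rewrite lt_neqAle eq_sym l0.
pose s := Num.sqrt (quartic f); have s2 : s ^+ 2 = quartic f by rewrite sqr_sqrtr // ltW.
have s0 : s != 0 by rewrite gt_eqF // sqrtr_gt0.
have K2 x : x *m K *m K = s ^+ 2 *: x by rewrite -mulmxA Kunit_sqr // s2 mul_mx_scalar.
have [x [y [z hp]]] := f3_nscalar (- s).
have [x' [y' [z' hm]]] := f3_nscalar s.
(* For e equal to s or - s, [p e] is 2 e times the projection onto the eigenspace of K for e. *)
pose p (e : R) (v : V) := v *m K + e *: v.
have pK e v : p e v *m K = p e (v *m K) by rewrite /p mulmxDl -scalemxAl.
have f3p e u v t : f3 u (p e v) t = f3 (p e u) v t.
  rewrite /p f3_swap12 -[v *m K]scale1r f3_lin -[u *m K]scale1r f3_lin.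
  by rewrite (f3_K12 u v) (f3_swap12 u v); ring.
have f3p' e u v t : f3 u v (p e t) = f3 (p e u) v t.
  by rewrite f3_swap23 f3p f3_swap23 opprK.
have pp e v : p e (p e v) = (e + e) *: (p e v) + (s ^+ 2 - e ^+ 2) *: v.
  by rewrite /p mulmxDl -scalemxAl K2; apply/rowP => m; rewrite !mxE; ring.
have pn e v : p e (p (- e) v) = (s ^+ 2 - e ^+ 2) *: v.
  by rewrite /p mulmxDl -scalemxAl K2; apply/rowP => m; rewrite !mxE; ring.
have pD e u v : p e (u + v) = p e u + p e v.
  by rewrite /p mulmxDl scalerDr addrACA.
(* Since [p e] may be moved from slot to slot and [p e] kills the image of [p (- e)], mixed terms
   vanish; each slot contributes a factor 2 e. *)
have G e x1 y1 z1 x2 y2 z2 : e ^+ 2 = s ^+ 2 ->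
    f3 (p e (p e x1 + p (- e) x2)) (p e y1 + p (- e) y2) (p e z1 + p (- e) z2) =
    (e + e) ^+ 3 * f3 (p e x1) y1 z1.
  move=> e2.
  have n0 v : p e (p (- e) v) = 0 by rewrite pn e2 subrr scale0r.
  have n0' v : p (- e) (p e v) = 0 by rewrite -{2}[e]opprK pn sqrrN e2 subrr scale0r.
  have p2 v : p e (p e v) = (e + e) *: p e v by rewrite pp e2 subrr scale0r addr0.
  rewrite pD n0 addr0 p2 f3_scale.
  have -> : f3 (p e x1) (p e y1 + p (- e) y2) (p e z1 + p (- e) z2) =
      f3 (p e x1) (p e y1) (p e z1 + p (- e) z2).
    rewrite f3_swap12 [RHS]f3_swap12 -[p e y1]scale1r -[p (- e) y2]scale1r f3_lin scale1r.
    rewrite [X in _ + _ * X](_ : _ = 0) ?mulr0 ?addr0 ?mul1r ?scale1r //.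
    by rewrite f3_swap12 f3p n0' -(scale0r (0 : V)) f3_scale mul0r oppr0.
  have -> : f3 (p e x1) (p e y1) (p e z1 + p (- e) z2) =
      f3 (p e x1) (p e y1) (p e z1).
    rewrite f3_swap23 [RHS]f3_swap23 f3_swap12 [in RHS]f3_swap12.
    rewrite -[p e z1]scale1r -[p (- e) z2]scale1r f3_lin scale1r.
    rewrite [X in _ + _ * X](_ : _ = 0) ?mulr0 ?addr0 ?mul1r ?scale1r //.
    by rewrite f3_swap12 f3p n0' -(scale0r (0 : V)) f3_scale mul0r oppr0.
  rewrite (f3p e (p e x1) y1 (p e z1)) (f3p' e _ y1 z1).
  by rewrite p2 f3_scale p2 f3_scale; ring.
pose X := p s x + p (- s) x'; pose Y := p s y + p (- s) y'; pose Z := p s z + p (- s) z'.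
(* The difference of squares factors into the values of [f] with [p (- s)] and with [p s] in the
   first slot. *)
have := h X Y Z; apply/eqP; rewrite -s2 -subr_eq0 -exprMn subr_sqr mulf_eq0.
have pE e u v t : f3 (p e u) v t = f3 (u *m K) v t + e * f3 u v t.
  by rewrite /p -[u *m K]scale1r f3_lin scale1r mul1r.
have -> : f3 (X *m K) Y Z - s * f3 X Y Z = f3 (p (- s) X) Y Z by rewrite pE mulNr.
rewrite -pE.
have := G (- s) x' y' z' x y z; rewrite opprK sqrrN => /(_ erefl).
rewrite ![p (- s) _ + p s _]addrC => ->.
have ss0 : s + s != 0 by rewrite -mulr2n mulrn_eq0 negb_or.
rewrite (G s x y z x' y' z' erefl) negb_or; apply/andP; split.
  apply: mulf_neq0; first by rewrite expf_neq0 // -opprD oppr_eq0.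
  by rewrite pE mulNr subr_eq0.
apply: mulf_neq0; first by rewrite expf_neq0.
by rewrite pE addr_eq0 -mulNr.
Qed.

Lemma rowsmx3E k (A : 'M[R]_(3, k)) : A = rowsmx 3 [:: row 0 A; row 1 A; row (inord 2) A].
Proof.
apply/row_matrixP => r; rewrite rowsmx_row.
by case: r => [[|[|[|//]]] h] /=; congr (row _ A); apply: val_inj; rewrite /= ?inordK.
Qed.

Definition Kform (A : 'M[R]_(3, 6)) : R :=
  f (col_mx (usubmx (A : 'M[R]_(1 + 2, 6)) *m K) (dsubmx (A : 'M[R]_(1 + 2, 6)))).

Lemma Kform_rowsmx x y z : Kform (rowsmx 3 [:: x; y; z]) = f3 (x *m K) y z.
Proof.
rewrite /Kform (_ : usubmx _ = x); last by apply/rowP => a; rewrite mxE rowsmxE.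
rewrite (_ : dsubmx _ = rowsmx 2 [:: y; z]); last exact: (@dsub_rowsmx R 6 1 2).
by rewrite col_rowsmx.
Qed.

Lemma f3_Kdiag x z : f3 (x *m K) x z = 0.
Proof.
have := f3_K12 x x z => /eqP; rewrite -addr_eq0 -mulr2n mulrn_eq0 /=.
by move/eqP.
Qed.

Lemma Kform_alt : @alt_forms R 6 3 Kform.
Proof.
split; first exact: (multilinear_mul_row0 af K).
move=> A i j ij rij; rewrite (rowsmx3E A) Kform_rowsmx.
have r01 : row 0 A = row 1 A -> f3 (row 0 A *m K) (row 1 A) (row (inord 2) A) = 0.
  by move=> <-; exact: f3_Kdiag.
have r02 : row 0 A = row (inord 2) A -> f3 (row 0 A *m K) (row 1 A) (row (inord 2) A) = 0.
  by move=> <-; rewrite f3_swap23 f3_Kdiag oppr0.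
have r12 : row 1 A = row (inord 2) A -> f3 (row 0 A *m K) (row 1 A) (row (inord 2) A) = 0.
  move=> <-; rewrite -f3_sym f3_swap23 f3_sym3 f3_swap23 opprK.
  have := f3_swap23 (row 0 A *m K) (row 1 A) (row 1 A) => /eqP.
  by rewrite -addr_eq0 -mulr2n mulrn_eq0 /= => /eqP.
have e0 (k : 'I_3) : nat_of_ord k = 0%N -> k = 0 by move=> h; apply: val_inj.
have e1 (k : 'I_3) : nat_of_ord k = 1%N -> k = 1 by move=> h; apply: val_inj.
have e2 (k : 'I_3) : nat_of_ord k = 2%N -> k = inord 2 by move=> h; apply: val_inj;
  rewrite /= inordK.
move: ij rij; case: (posnP i) => [/e0 ->|i0].
  case: (posnP j) => [/e0 -> //|j0]; have [/eqP/e1 ->|j1] := boolP (nat_of_ord j == 1%N);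
    first by move=> _ /r01.
  rewrite (e2 j) => [_ /r02 //|]; have := ltn_ord j; lia.
have [/eqP/e1 ->|i1] := boolP (nat_of_ord i == 1%N).
  case: (posnP j) => [/e0 -> _ /esym/r01 //|j0];
    have [/eqP/e1 -> //|j1] := boolP (nat_of_ord j == 1%N).
  rewrite (e2 j) => [_ /r12 //|]; have := ltn_ord j; lia.
rewrite (e2 i); last by have := ltn_ord i; lia.
case: (posnP j) => [/e0 -> _ /esym/r02 //|j0];
  have [/eqP/e1 -> _ /esym/r12 //|j1] := boolP (nat_of_ord j == 1%N).
rewrite (e2 j) => [/eqP //|]; have := ltn_ord j; lia.
Qed.

(** With [J] a multiple of [K] of square [1] or [-1], the values of [f] on the basis
    [E], [E J] depend on the sign of [quartic f] only. *)
Lemma normal_frame : exists E : 'M[R]_(3, 6), f E = 1 /\ Kform E = 0.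
Proof.
have [x [y [z h]]] := f3_unit.
set a := f3 x y z in h; set b := f3 (x *m K) y z in h.
pose d := quartic f * a ^+ 2 - b ^+ 2.
have d0 : d != 0 by rewrite subr_eq0 eq_sym.
(* The two coefficients solve the 2x2 linear system for f = 1 and [Kform] = 0, whose determinant is
   [d]. *)
exists (rowsmx 3 [:: (quartic f * a / d) *: x + (- b / d) *: (x *m K); y; z]); split.
  rewrite -[f _]/(f3 _ _ _) f3_lin -/a -/b.
  transitivity ((quartic f * a ^+ 2 - b ^+ 2) / d); [by field|exact: divff].
rewrite Kform_rowsmx mulmxDl -!scalemxAl -mulmxA Kunit_sqr // mul_mx_scalar scalerA f3_lin -/a -/b.
by field.
Qed.

Lemma pullback3 (E : 'M[R]_(3, 6)) (g : 'M[R]_(3, 6) -> R) : @alt_forms R 6 3 g ->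
  forall u v t : 'rV[R]_3, g (rowsmx 3 [:: u *m E; v *m E; t *m E]) =
    g E * \det (rowsmx 3 [:: u; v; t]).
Proof.
move=> ag u v t; have := top_form (pullback_alt E ag) (rowsmx 3 [:: u; v; t]).
rewrite mul1mx => <-; congr g; apply/row_matrixP => r; rewrite row_mul !rowsmx_row.
by case: r => [[|[|[|//]]] h].
Qed.

Definition Jmx : 'M[R]_6 := (Num.sqrt `|quartic f|)^-1 *: K.
Local Notation J := Jmx.
Definition quartic_sg : R := Num.sg (quartic f).

Lemma Jmx_sqr : J *m J = quartic_sg%:M.
Proof.
rewrite /Jmx -scalemxAl -scalemxAr scalerA Kunit_sqr // scale_scalar_mx; congr (_%:M).
rewrite -invfM -expr2 sqr_sqrtr // /quartic_sg {2}[quartic f]numEsg mulrCA mulVf ?mulr1 //.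
by rewrite normr_eq0.
Qed.

Definition Jpow (b : bool) (v : V) := if b then v *m J else v.

Lemma f3_J12 x y z : f3 x (y *m J) z = f3 (x *m J) y z.
Proof. by rewrite /Jmx -!scalemxAr f3_swap12 !f3_scale f3_swap12 f3_sym; ring. Qed.

Lemma f3_J13 x y z : f3 x y (z *m J) = f3 (x *m J) y z.
Proof. by rewrite f3_swap23 f3_J12 f3_swap23 opprK. Qed.

(** All factors J can be moved to the first slot, where pairs of them collapse to [quartic_sg]. A
    single remaining J gives a multiple of [Kform E], which is 0. *)
Lemma f3_frame (E : 'M[R]_(3, 6)) : f E = 1 -> Kform E = 0 -> forall b1 b2 b3 (u v t : 'rV[R]_3),
  f3 (Jpow b1 (u *m E)) (Jpow b2 (v *m E)) (Jpow b3 (t *m E)) =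
  (if odd (b1 + b2 + b3) then 0 else if (b1 + b2 + b3 == 2)%N then quartic_sg else 1) * \det
    (rowsmx 3 [:: u; v; t]).
Proof.
move=> fE PE b1 b2 b3 u v t.
have v0 : f3 (u *m E) (v *m E) (t *m E) = \det (rowsmx 3 [:: u; v; t]).
  by rewrite /f3 pullback3 // fE mul1r.
have v1 : f3 (u *m E *m J) (v *m E) (t *m E) = 0.
  rewrite /Jmx -scalemxAr f3_scale -Kform_rowsmx (pullback3 E Kform_alt) PE mul0r mulr0 //.
have JJ (x : V) : x *m J *m J = quartic_sg *: x by rewrite -mulmxA Jmx_sqr mul_mx_scalar.
by case: b1 b2 b3 => [] [] [] /=; rewrite ?f3_J12 ?f3_J13 ?JJ ?f3_scale ?v0 ?v1 ?mulr0 ?mul0r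
  ?mul1r.
Qed.

(** Insert a relation x E + y E J = 0 into [f] together with two combinations of rows of E: the
    J-part drops out, so x has determinant 0 with every pair of vectors and must vanish. Multiplying
    by J treats y in the same way. *)
Lemma frame_unit (E : 'M[R]_(3, 6)) : f E = 1 -> Kform E = 0 ->
  (col_mx E (E *m J) : 'M[R]_(3 + 3, 6)) \in unitmx.
Proof.
move=> fE PE; rewrite -row_free_unit; apply/inj_row_free => v vB.
have FE := f3_frame fE PE.
rewrite -[v]hsubmxK; set x := lsubmx (v : 'rV[R]_(3 + 3)); set y := rsubmx (v : 'rV[R]_(3 + 3)).
have xy0 : x *m E + y *m E *m J = 0 by rewrite -mulmxA -mul_row_col hsubmxK.
have dx (z : 'rV[R]_3) : (forall s t, \det (rowsmx 3 [:: z; s; t]) = 0) -> z = 0.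
  move=> h; apply/rowP => m; rewrite mxE.
  have := det_basis_row z m; set M := row' m 1%:M.
  have -> : M = rowsmx 2 [:: row 0 M; row 1 M].
    apply/row_matrixP => r; rewrite rowsmx_row.
    by case: r => [[|[|//]] hr] /=; congr (row _ M); apply: val_inj.
  by rewrite col_rowsmx h => /esym/eqP; rewrite mulf_eq0 signr_eq0 => /eqP.
have x0 : x = 0.
  apply: dx => s t; have := FE false false false x s t; rewrite /= mul1r => <-.
  have h := FE true false false y s t; rewrite /= mul0r in h.
  have := f3_lin 1 1 (x *m E) (y *m E *m J) (s *m E) (t *m E).
  rewrite !scale1r xy0 h !mul1r addr0 => <-.
  by rewrite -(scale0r (0 : V)) f3_scale mul0r.
have y0 : y = 0.
  apply: dx => s t; have := FE false false false y s t; rewrite /= mul1r => <-.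
  have : y *m E *m J *m J = 0 by move: xy0; rewrite x0 mul0mx add0r => ->; rewrite mul0mx.
  rewrite -mulmxA Jmx_sqr mul_mx_scalar => /eqP;
    rewrite scaler_eq0 /quartic_sg sgr_eq0 (negbTE l0) /=.
  by move/eqP => ->; rewrite -(scale0r (0 : V)) f3_scale mul0r.
by rewrite x0 y0 row_mx0.
Qed.

End Trilinear.

Section Orbit.
Variable R : realType.

(** On the frames B and B' the two forms have the same values, so the change of frame carries one to
    the other. *)
Lemma same_orbit (f f' : 'M[R]_(3, 6) -> R) : @alt_forms R 6 3 f -> @alt_forms R 6 3 f' ->
  0 < quartic f * quartic f' -> GL_orbit f f'.
Proof.
move=> af af' ll.
have l0 : quartic f != 0 by apply: contraTneq ll => ->; rewrite mul0r ltxx.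
have l0' : quartic f' != 0 by apply: contraTneq ll => ->; rewrite mulr0 ltxx.
have ss : quartic_sg f = quartic_sg f'.
  rewrite /quartic_sg; have := sgrM (quartic f) (quartic f'); rewrite gtr0_sg // => /esym h.
  have := mulr_sg_eq1 (quartic f) (quartic f'). 
  by move: h; case: (sgrP (quartic f)) => _; case: (sgrP (quartic f')) => _ //=;
    rewrite ?mul0r ?mulr0 ?mul1r ?mulr1 // => /eqP;
      rewrite ?oner_eq0 // eq_sym ?oner_eq0 // ?eqNr ?oner_eq0 // eq_sym eqNr ?oner_eq0.
have [E [fE PE]] := normal_frame af l0.
have [E' [fE' PE']] := normal_frame af' l0'.
set B := (col_mx E (E *m Jmx f) : 'M[R]_(3 + 3, 6));
  set B' := (col_mx E' (E' *m Jmx f') : 'M[R]_(3 + 3, 6)).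
have uB : B \in unitmx by exact: frame_unit.
have uB' : B' \in unitmx by exact: frame_unit.
have agree (A : 'M[R]_(3, 6)) : f (A *m B) = f' (A *m B').
  have aB : @alt_forms R 6 3 (fun A => f (A *m B)) by exact: (pullback_alt B af).
  have aB' : @alt_forms R 6 3 (fun A => f' (A *m B')) by exact: (pullback_alt B' af').
  apply: (@agree_basis R 6 3 (fun A => f (A *m B)) (fun A => f' (A *m B')));
    [by case: aB|by case: aB'|].
  move=> s /=.
  have rE (g : 'M[R]_(3, 6) -> R) (F : 'M[R]_(3, 6)) (i : 'I_6) : exists (b : bool) (u : 'rV[R]_3),
      forall (g : 'M[R]_(3, 6) -> R) (F : 'M[R]_(3, 6)),
      row i (col_mx F (F *m Jmx g) : 'M[R]_(3 + 3, 6)) = Jpow g b (u *m F).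
    case: (@split_ordP 3 3 i) => k ->.
      by exists false, (delta_mx 0 k) => g' F'; rewrite /= -rowE; exact: rowKu.
    by exists true, (delta_mx 0 k) => g' F'; rewrite /= -mulmxA -rowE; exact: rowKd.
  have [b1 [u1 h1]] := rE f E (s 0); have [b2 [u2 h2]] := rE f E (s 1);
    have [b3 [u3 h3]] := rE f E (s (inord 2)).
  have rw (C : 'M[R]_6) : rowsub s 1%:M *m C =
    rowsmx 3 [:: row (s 0) C; row (s 1) C; row (s (inord 2)) C].
    by rewrite [LHS]rowsmx3E !row_mul !row_rowsub !row1 -!rowE.
  rewrite !rw /B /B' !h1 !h2 !h3.
  by rewrite -[LHS]/(f3 f _ _ _) -[RHS]/(f3 f' _ _ _) !f3_frame // ss.
exists (invmx B' *m B); first by rewrite unitmx_mul unitmx_inv uB uB'.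
by apply/funext => A; rewrite mulmxA agree mulmxKV.
Qed.

End Orbit.

(** * A form on which the quartic invariant equals 1 *)

Section SplitForm.
Variable R : realType.

(** [dx0 /\ dx1 /\ dx2 + dx3 /\ dx4 /\ dx5]. *)
Definition split_form (A : 'M[R]_(3, 6)) : R :=
  \det (lsubmx (A : 'M[R]_(3, 3 + 3))) + \det (rsubmx (A : 'M[R]_(3, 3 + 3))).

Lemma split_form_alt : @alt_forms R 6 3 split_form.
Proof.
have h (g : 'M[R]_(6, 3)) : @alt_forms R 6 3 (fun A => \det (A *m g)).
  exact: (pullback_alt g (@det_alt R 3)).
have -> : split_form = (fun A => \det (A *m (col_mx 1%:M 0 : 'M[R]_(3 + 3, 3))) +
  \det (A *m (col_mx 0 1%:M : 'M[R]_(3 + 3, 3)))).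
  apply/funext => A; rewrite /split_form.
  set l := lsubmx _; set r := rsubmx _.
  have e1 (P Q : 'M[R]_3) : A *m (col_mx P Q : 'M[R]_(3 + 3, 3)) = l *m P + r *m Q.
    have e : A = row_mx l r by rewrite hsubmxK.
    by rewrite {1}e; exact: (mul_row_col l r P Q).
  by rewrite !e1 !mulmx1 !mulmx0 addr0 add0r.
have [m1 a1] := h (col_mx 1%:M 0 : 'M[R]_(3 + 3, 3));
  have [m2 a2] := h (col_mx 0 1%:M : 'M[R]_(3 + 3, 3)).
split=> [i A B C b c rA rB rC|A i j ij rij].
  by rewrite (m1 i A B C b c) // (m2 i A B C b c) //; ring.
by rewrite (a1 A i j) // (a2 A i j) // addr0.
Qed.

Lemma det_row0 n (M : 'M[R]_n) i : row i M = 0 -> \det M = 0.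
Proof.
move=> h; rewrite (expand_det_row _ i) big1 // => j _.
by move/rowP: h => /(_ j); rewrite !mxE => ->; rewrite mul0r.
Qed.

Definition split_coef (i j k : nat) : R := ((i == 0%N) && (j == 1%N) && (k == 2%N))%:R
  + ((i == 3%N) && (j == 4%N) && (k == 5%N))%:R.

Lemma coef3_split_form i j k : (i < j)%N -> (j < k)%N -> (k < 6)%N ->
  nat_coef (coef3 split_form) i j k = split_coef i j k.
Proof.
move=> ij jk k6; have j6 := ltn_trans jk k6; have i6 := ltn_trans ij j6.
rewrite /nat_coef /coef3 /split_form /split_coef; set A := rowsmx 3 _.
have rowA (r : 'I_3) (c : 'I_6) : A r c = (nth 0%N [:: i; j; k] r == c)%:R.
  rewrite rowsmxE; case: r => [[|[|[|//]]] h] /=; rewrite mxE eqxx /=; congr (_ %:R);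
  by rewrite -val_eqE /= inordK // eq_sym.
congr (_ + _).
- have [k3|k3] := ltnP k 3.
    have [i0 j1 k2] : [/\ i = 0, j = 1 & k = 2]%N by split; lia.
    rewrite (_ : lsubmx _ = 1%:M) ?det1 ?i0 ?j1 ?k2 //.
    apply/matrixP => r c; rewrite mxE rowA [RHS]mxE i0 j1 k2; congr (_ %:R).
    by rewrite -val_eqE; case: r => [[|[|[|//]]] h].
  rewrite (@det_row0 3 _ (inord 2)); first by rewrite (_ : (k == 2%N) = false) ?andbF //; lia.
  apply/rowP => c; rewrite 2!mxE rowA [RHS]mxE inordK //= (_ : (k == c) = false) //.
  by have := ltn_ord c; lia.
- have [i3|i3] := ltnP i 3.
    rewrite (@det_row0 3 _ 0); first by rewrite (_ : (i == 3%N) = false) //; lia.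
    by apply/rowP => c; rewrite 2!mxE rowA [RHS]mxE /= (_ : (i == _) = false) //; lia.
  have [i0 j1 k2] : [/\ i = 3, j = 4 & k = 5]%N by split; lia.
  rewrite (_ : rsubmx _ = 1%:M) ?det1 ?i0 ?j1 ?k2 //.
  apply/matrixP => r c; rewrite mxE rowA [RHS]mxE i0 j1 k2; congr (_ %:R).
  by rewrite -val_eqE; case: r => [[|[|[|//]]] h].
Qed.

Lemma alt3_ext (f g : nat -> nat -> nat -> R) :
  (forall i j k, (i < j)%N -> (j < k)%N -> (k < 6)%N -> f i j k = g i j k) ->
  forall i j k, (i < 6)%N -> (j < 6)%N -> (k < 6)%N -> alt3 f i j k = alt3 g i j k.
Proof.
move=> h i j k i6 j6 k6; rewrite /alt3.
case: (ltngtP i j) => // ij; case: (ltngtP j k) => // jk; case: (ltngtP i k) => // ik;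
  rewrite ?h //; lia.
Qed.

Lemma quartic_split_form : quartic split_form = 1.
Proof.
have ar := coef3_alt split_form_alt.
have TE (u m : 'I_6) : iwedge_mx (coef3 split_form) (coef3 split_form) u m =
  iwedge (alt3 split_coef) (alt3 split_coef) u m.
  rewrite iwedge_mxE; apply: iwedge_ext => // i j k i6 j6 k6; rewrite (nat_coef_alt3 ar) //;
    by apply: alt3_ext => // *; exact: coef3_split_form.
have := Kunit_sqr split_form_alt => /matrixP /(_ 0 0); rewrite !mxE eqxx mulr1n => <-.
rewrite /Kunit sum6E /sum6 !mxE -!iwedge_mxE !TE !inordK //.
rewrite /iwedge /codim1_coef /shuffle23 /alt3 /split_coef /= !(mulr0n, mulr1n); ring.
Qed.

End SplitForm.

(** * Stability as nonvanishing of the quartic invariant *)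

Section Stable.
Variable R : realType.
Local Notation form := {ptws 'M[R]_(3, 6) -> R}.

Lemma cont_sum (X : topologicalType) (I : finType) (g : I -> X -> R) x :
  (forall i, {for x, continuous (g i)}) -> {for x, continuous (fun y => \sum_i g i y)}.
Proof.
move=> h; elim: (index_enum I) => [|i s IH].
  have -> : (fun y => \sum_(i <- [::]) g i y) = cst 0 by apply/funext => y; rewrite big_nil.
  exact: cvg_cst.
have -> : (fun y => \sum_(j <- i :: s) g j y) = (fun y => g i y + \sum_(j <- s) g j y).
  by apply/funext => y; rewrite big_cons.
by apply: cvgD; [exact: h|exact: IH].
Qed.

Section Cont.
Variables (X : topologicalType) (x : X).
Definition real_cont (f : X -> R) : Prop := f @ x --> f x.
Lemma contD f g : real_cont f -> real_cont g -> real_cont (fun y => f y + g y).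
Proof. exact: cvgD. Qed.
Lemma contN f : real_cont f -> real_cont (fun y => - f y).
Proof. exact: cvgN. Qed.
Lemma contM f g : real_cont f -> real_cont g -> real_cont (fun y => f y * g y).
Proof. exact: cvgM. Qed.
Lemma contC (a : R) : real_cont (fun=> a).
Proof. exact: cvg_cst. Qed.
End Cont.

(** Dispatching on the head symbol avoids expensive failing unifications. *)
Local Ltac cont_step := lazymatch goal with
  | |- real_cont _ (fun y => @?f y + @?g y) => apply: contD
  | |- real_cont _ (fun y => - @?f y) => apply: contN
  | |- real_cont _ (fun y => @?f y * @?g y) => apply: contM
  end.

Lemma cont_iwedge (X : topologicalType) (c d : X -> nat -> nat -> nat -> R) x u m :
  (forall i j k, real_cont x (fun y => c y i j k)) ->
  (forall i j k, real_cont x (fun y => d y i j k)) ->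
  real_cont x (fun y => iwedge (c y) (d y) u m).
Proof.
move=> hc hd; rewrite /iwedge /codim1_coef /shuffle23; apply: contM; first exact: contC.
by do ![cont_step | exact: hc | exact: hd].
Qed.

Lemma cont_pair (X : topologicalType) (c d : X -> nat -> nat -> nat -> R) x :
  (forall i j k, real_cont x (fun y => c y i j k)) ->
  (forall i j k, real_cont x (fun y => d y i j k)) ->
  real_cont x (fun y => pair3 (c y) (d y)).
Proof.
move=> hc hd; rewrite /pair3.
by do ![cont_step | exact: hc | exact: hd].
Qed.

Lemma cont_quartic (X : topologicalType) (F : X -> 'M[R]_(3, 6) -> R) x :
  (forall A, {for x, continuous (fun y => F y A)}) -> {for x, continuous (fun y => quartic (F y))}.
Proof.
move=> h.
have hc i j k : {for x, continuous (fun y => coef3 (F y) i j k)} by exact: h.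
have hK u m : {for x, continuous (fun y => Kmx (coef3 (F y)) 1 u m)}.
  have -> : (fun y => Kmx (coef3 (F y)) 1 u m) =
    (fun y => - (iwedge (nat_coef (coef3 (F y))) (nat_coef (coef3 (F y))) u m)).
    by apply/funext => y; rewrite KunitE /Kunit mxE iwedge_mxE.
  by apply: cvgN; apply: (@cont_iwedge _ (fun y => nat_coef (coef3 (F y))) (fun y =>
    nat_coef (coef3 (F y)))) => i j k; exact: hc.
have hP i j k : {for x, continuous (fun y => Kcoef (coef3 (F y)) 1 i j k)}.
  by apply: cont_sum => n; apply: cvgM; [exact: hK|exact: hc].
apply: (@cvgM _ _ _ _ (fun y => pair_coef (coef3 (F y)) (Kcoef (coef3 (F y)) 1)) (fun=>
  (2 * 1)^-1)); last exact: cvg_cst.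
apply: (@cont_pair _ (fun y => nat_coef (coef3 (F y))) (fun y =>
  nat_coef (Kcoef (coef3 (F y)) 1))) => i j k; first exact: hc.
exact: hP.
Qed.

(** Among alternating forms, the orbit is exactly the open set where the quartic has the same sign
    as at [f]: one inclusion is [same_orbit], the other holds because the quartic is scaled by a
    squared determinant. *)
Lemma quartic_neq0_stable (f : 'M[R]_(3, 6) -> R) : @alt_forms R 6 3 f -> quartic f != 0 ->
  stable f.
Proof.
move=> af l0; apply/open_subspaceP.
exists [set b : form | 0 < quartic f * quartic b].
  have c : continuous (fun b : form => quartic f * quartic b).
    move=> b; apply: (@contM form b (fun=> quartic f) (fun b : form => quartic b));
      first exact: contC.
    apply: (@cont_quartic form (fun b : form => (b : 'M[R]_(3, 6) -> R)) b) => A.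
    exact: (@proj_continuous _ (fun _ : 'M[R]_(3, 6) => R) A b).
  by apply: (@open_comp _ _ (fun b : form => quartic f * quartic b) [set r | 0 < r]) => [b _|];
    [exact: c|exact: open_gt].
apply/seteqP; split=> b [/=].
  by move=> lb ab; split=> //; exact: same_orbit.
move=> [g ug ->] ag; split=> //; rewrite quartic_pullback // mulrCA -expr2.
by rewrite mulr_gt0 // exprn_even_gt0 //= -?unitfE // -unitmxE.
Qed.

Lemma iwedge_mx_line (c r : 'I_6 -> 'I_6 -> 'I_6 -> R) t :
  - iwedge_mx (fun i j k => c i j k + t * r i j k) (fun i j k => c i j k + t * r i j k) =
  - iwedge_mx c c + t *: - (iwedge_mx c r + iwedge_mx r c) + t ^+ 2 *: - iwedge_mx r r.
Proof.
rewrite iwedge_mx_addl !iwedge_mx_addr !iwedge_mx_scalel !iwedge_mx_scaler.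
move: (iwedge_mx c c) (iwedge_mx c r) (iwedge_mx r c) (iwedge_mx r r) => T1 T2 T3 T4.
by apply/matrixP => u m; rewrite !mxE; ring.
Qed.

(** If [quartic f = 0], then [quartic] vanishes on the orbit of [f]; but along the
    line [f + t * split_form] it is a polynomial of degree 4 with leading
    coefficient 1, so that its fourth differences are nonzero. *)
Lemma stable_quartic_neq0 (f : 'M[R]_(3, 6) -> R) : @alt_forms R 6 3 f -> stable f ->
  quartic f != 0.
Proof.
move=> af /open_subspaceP [V oV VE]; apply/eqP => l0.
pose p (t : R) : form := fun A => f A + t * split_form A.
have pa t : @alt_forms R 6 3 (p t).
  have [mf lf] := af; have [mr lr] := @split_form_alt R.
  split=> [i A B C b c rA rB rC|A i j ij rij]; rewrite /p.
    by rewrite (mf i A B C b c) // (mr i A B C b c) //; ring.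
  by rewrite (lf A i j) // (lr A i j) // mulr0 addr0.
have p0 : p 0 = f by apply/funext => A; rewrite /p mul0r addr0.
have V0 : V (p 0).
  have : (V `&` alt_forms (n:=6) (k:=3)) f.
    rewrite VE; split=> //; exists 1%:M; first exact: unitmx1.
    by apply/funext => A; rewrite mulmx1.
  by rewrite p0 => -[].
have cp : {for (0 : R), continuous p}.
  have Fp : Filter (p @ nbhs (0 : R)) by exact: fmap_filter.
  have [_ hp] := @pointwise_cvgP _ _ (p @ nbhs (0 : R)) (p 0) Fp; apply: hp => A.
  apply: cvgD; first exact: cvg_cst.
  by apply: cvgM; [exact: cvg_id|exact: cvg_cst].
have : \forall t \near (0 : R), V (p t) by apply: cp; exact: open_nbhs_nbhs.
move=> /nbhs_ballP [e /= e0 he].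
have lp t : `|t| < e -> quartic (p t) = 0.
  move=> te; have : (V `&` alt_forms (n:=6) (k:=3)) (p t).
    by split=> //; apply: he; rewrite /ball /= sub0r normrN.
  by rewrite VE => -[[g ug ->] _]; rewrite quartic_pullback // l0 mulr0.
pose B := - (iwedge_mx (coef3 f) (coef3 (@split_form R)) +
  iwedge_mx (coef3 (@split_form R)) (coef3 f)); pose C := Kunit (@split_form R); pose A := Kunit f.
have K1p t : Kunit (p t) = A + t *: B + t ^+ 2 *: C.
  by rewrite /A /C /B /Kunit -iwedge_mx_line.
have [L0 [L1 [L2 [L3 L]]]] : exists L0 L1 L2 L3, forall t,
    quartic (p t) = L0 + t * L1 + t ^+ 2 * L2 + t ^+ 3 * L3 + t ^+ 4 * quartic (@split_form R).
  exists ((A *m A) 0 0), ((A *m B + B *m A) 0 0), ((A *m C + B *m B + C *m A) 0 0),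
    ((B *m C + C *m B) 0 0) => t.
  have -> : quartic (@split_form R) = (C *m C) 0 0 by rewrite Kunit_sqr ?mxE ?eqxx ?mulr1n //;
    exact: split_form_alt.
  have -> : quartic (p t) = (Kunit (p t) *m Kunit (p t)) 0 0 by rewrite Kunit_sqr // mxE eqxx
    mulr1n.
  rewrite K1p !(mulmxDl, mulmxDr) -!scalemxAl -!scalemxAr !scalerA.
  move: (A *m A) (A *m B) (A *m C) (B *m A) (B *m B) (B *m C) (C *m A) (C *m B) (C *m C).
  by move=> *; rewrite !mxE; ring.
(* The nodes 0, h, ..., 4h stay within e / 2 of the origin. *)
pose h := e / 8.
have h0 : 0 < h by rewrite divr_gt0.
have hz (n : nat) : (n < 5)%N -> quartic (p (n%:R * h)) = 0.
  move=> n5; apply: lp; rewrite ger0_norm; last by apply: mulr_ge0; [exact: ler0n|exact: ltW].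
  have : n%:R <= 4 :> R by rewrite ler_nat.
  by move=> n4; rewrite (le_lt_trans (ler_wpM2r (ltW h0) n4)) // /h; lra.
(* 24 = 4!, the fourth difference of t^4 with unit step. *)
have e24 : 24 * h ^+ 4 * quartic (@split_form R) =
  quartic (p (4%:R * h)) - 4 * quartic (p (3%:R * h))
    + 6 * quartic (p (2%:R * h)) - 4 * quartic (p (1%:R * h)) + quartic (p (0%:R * h)).
  by rewrite !L; ring.
move: e24; rewrite (hz 4%N) // (hz 3%N) // (hz 2%N) // (hz 1%N) // (hz 0%N) // quartic_split_form
  => /eqP; rewrite mulr1 !mulr0 !(subr0, addr0).
by rewrite mulf_eq0 pnatr_eq0 /= expf_eq0 /= gt_eqF.
Qed.

End Stable.

(** * The theorem on manifolds *)

Section BallConst.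
Variables (R : realType) (n : nat).

(** The mean value theorem on the segment from [x] to [y], which stays in the ball. *)
Lemma derive0_ball_const (g : 'rV[R]_n -> R) (x : 'rV[R]_n) (e : R) :
  (forall y v, ball x e y -> is_derive y v g 0) -> forall y, ball x e y -> g y = g x.
Proof.
move=> dg y xy; pose v := y - x; pose phi (t : R) := g (x + t *: v).
have seg (t : R) : 0 <= t <= 1 -> ball x e (x + t *: v).
  move=> /andP [t0 t1]; move: xy; rewrite -!ball_normE /ball_ /= => xy.
  rewrite opprD addrA subrr add0r normrN normrZ ger0_norm //.
  by rewrite (le_lt_trans (ler_piMl (normr_ge0 _) t1)) // /v distrC.
have dphi (t : R) : 0 <= t <= 1 -> is_derive t 1 phi 0.
  move=> t01; have [dv ev] := dg _ v (seg t t01).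
  have e1 : (fun h : R => h^-1 *: ((phi \o shift t) (h *: 1) - phi t)) =
            (fun h : R => h^-1 *: ((g \o shift (x + t *: v)) (h *: v) - g (x + t *: v))).
    apply/funext => h /=; rewrite /phi; congr (_ *: (g _ - _)).
    by rewrite scalerDl addrCA; congr (_ + (_ + _)); rewrite /GRing.scale /= mulr1.
  apply: DeriveDef; first by rewrite /derivable e1.
  by rewrite /derive e1.
have [t t01||c _] := @MVT_segment R phi (fun=> 0) 0 1 ler01.
- apply: dphi; move: t01; rewrite in_itv /= => /andP [a b].
  by rewrite !ltW.
- apply: derivable_within_continuous => t; rewrite in_itv /= => t01.
  by case: (dphi t t01).
rewrite mul0r /phi scale0r scale1r addr0 /v [x + (y - x)]addrC subrK => /eqP.
by rewrite subr_eq0 => /eqP.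
Qed.

End BallConst.

Section Main.
Variables (R : realType) (M : manifold R 6).
Variables (omega : form_field M 2) (phi : form_field M 3).
Hypotheses (sw : symplectic omega) (sf : smooth_form phi)
  (cf_ : closed_form phi) (cF : F_integrable omega phi).
Local Notation D i := (@chart R 6 M i @` chart_dom i).

Let aw i x : D i x -> @alt_forms R 6 2 (omega i x).
Proof. by move=> [p ip <-]; have [[h _ _] _ _] := sw; exact: h. Qed.

Let af i x : D i x -> @alt_forms R 6 3 (phi i x).
Proof. by move=> [p ip <-]; have [h _ _] := sf; exact: h. Qed.

Let dw i x A : D i x -> differentiable (fun x => omega i x A) x.
Proof. by move=> Dx; have [[_ h _] _ _] := sw; have [h1 _] := h i A 1%N; exact: h1. Qed.

Let df i x A : D i x -> differentiable (fun x => phi i x A) x.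
Proof. by move=> Dx; have [_ h _] := sf; have [h1 _] := h i A 1%N; exact: h1. Qed.

Let nd i x : D i x -> forall u : 'rV[R]_6, (forall v, omega i x (col_mx u v) = 0) -> u = 0.
Proof. by move=> [p ip <-]; have [_ _ h] := sw; exact: h. Qed.

Let clf i x : D i x -> forall A, ext_derivative (phi i) x A = 0.
Proof. by move=> [p ip <-] A; exact: cf_. Qed.

Let clF i x : D i x -> forall A, ext_derivative (fun y => F_at (omega i y) (phi i y)) x A = 0.
Proof. by move=> [p ip <-] A; exact: (cF ip A). Qed.

Let oD i : open (D i). Proof. exact: chart_open. Qed.

Let r0 i x : D i x -> pfaffian (omega i x) != 0.
Proof. by move=> Dx; apply: pfaffian_neq0; [exact: aw|exact: nd]. Qed.

Lemma closed_K_integrable : K_integrable omega phi.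
Proof.
move=> U oU X Y [sX _] [sY _] i p ip Up.
have Dp : D i (chart i p) by exists p.
have Dp' : (@chart R 6 M i @` (chart_dom i `&` U)) (chart i p) by exists p.
have dX : differentiable (X i) (chart i p) by have [h _] := sX i 1%N; exact: h.
have dY : differentiable (Y i) (chart i p) by have [h _] := sY i 1%N; exact: h.
have h := (nijenhuis_K_at0 (@oD i) (@aw i) (@af i) (@dw i) (@df i) (@nd i) (@clf i) (@clF i) Dp dX
  dY).
exact: h.
Qed.

(** The quartic and the square of the Pfaffian are both multiplied by the squared Jacobian
    determinant. *)
Lemma Q_chart i j p : chart_dom i p -> chart_dom j p ->
  Q_field omega phi i (chart i p) = Q_field omega phi j (chart j p).
Proof.
move=> ip jp; have Di : D i (chart i p) by exists p.
have Dj : D j (chart j p) by exists p.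
pose g := jacobian (transition i j) (chart i p).
have ew : omega i (chart i p) = fun A => omega j (chart j p) (A *m g).
  by apply/funext => A; have [[_ _ h] _ _] := sw; exact: h.
have ef : phi i (chart i p) = fun A => phi j (chart j p) (A *m g).
  by apply/funext => A; have [_ _ h] := sf; exact: h.
have rE := pfaffian_pullback g (aw Dj); rewrite -ew in rE.
(* The Jacobian is invertible because it relates two nonzero Pfaffians. *)
have ug : g \in unitmx.
  by rewrite unitmxE unitfE; have := r0 Di; rewrite rE mulf_eq0 negb_or => /andP [].
rewrite /Q_field !Q_at_quartic; [|exact: aw|exact: af|exact: r0|exact: aw|exact: af|exact: r0].
rewrite rE {1}ef quartic_pullback //; last exact: af.
have d0 : \det g != 0 by rewrite -unitfE -unitmxE.
have rj := r0 Dj.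
by field; rewrite d0 rj.
Qed.

(** The level sets of Q are open and partition M, so each one is also closed and connectedness
    leaves a single level. *)
Lemma closed_Q_integrable : connected [set: M] -> Q_integrable omega phi.
Proof.
move=> cM.
(* [connected] admits an empty carrier, for which any constant serves. *)
have [[p0 _]|M0] := pselect (exists p : M, True); last first.
  by exists 0 => i p _; case: M0; exists p.
have cov (p : M) : exists i, chart_dom i p.
  have : (\bigcup_i @chart_dom R 6 M i) p by rewrite chart_cover.
  by case=> i _ ip; exists i.
have [i0 ip0] := cov p0.
pose c := Q_field omega phi i0 (chart i0 p0).
pose B (z : R) := [set p : M | exists2 i, chart_dom i p & Q_field omega phi i (chart i p) = z].
have loc (p : M) i : chart_dom i p -> \forall p' \near p, B (Q_field omega phi i (chart i p)) p'.
  move=> ip; have Dp : D i (chart i p) by exists p.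
  have : nbhs (chart i p) (D i) by apply: open_nbhs_nbhs; split => //; exact: chart_open.
  move=> /nbhs_ballP [e /= e0 he].
  have const y : ball (chart i p) e y -> Q_field omega phi i y = Q_field omega phi i (chart i p).
    apply: derive0_ball_const => z v /he Dz.
    exact: (Q_at_derive0 (@oD i) (@aw i) (@af i) (@dw i) (@df i) (@nd i) (@clf i) (@clF i) Dz).
  have od := @chart_dom_open R 6 M i.
  have cc : chart i @ p --> chart i p.
    have := @chart_continuous R 6 M i; rewrite continuous_open_subspace // => /(_ p).
    by apply; rewrite inE.
  have n1 : nbhs p (chart_dom i) by exact: open_nbhs_nbhs.
  have n2 : \forall p' \near p, ball (chart i p) e (chart i p').
    by apply: cc; exact: nbhsx_ballx.
  by apply: filterS2 n1 n2 => p' ip' bp'; exists i => //; exact: const.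
have oB z : open (B z).
  rewrite openE => p [i ip <-]; exact: loc.
have uB z z' p : B z p -> B z' p -> z = z'.
  by move=> [i ip <-] [j jp <-]; exact: Q_chart.
have Bc : B c = [set: M].
  apply: cM; first by exists p0; exists i0.
    by exists (B c) => //; rewrite setTI.
  exists (B c); last by rewrite setTI.
  rewrite -openC (_ : ~` B c = \bigcup_(z in [set z | z != c]) B z); first exact: bigcup_open.
  apply/seteqP; split=> p /=.
    move=> nBp; have [i ip] := cov p; exists (Q_field omega phi i (chart i p)); last by exists i.
    by apply/eqP => e; apply: nBp; exists i.
  by move=> [z /= zc Bz] Bcp; move/eqP: zc; apply; exact: uB Bz Bcp.
exists c => i p ip; have : B c p by rewrite Bc.
by apply: uB; exists i.
Qed.

Lemma stable_atP p i : chart_dom i p -> stable_at phi p <-> Q_field omega phi i (chart i p) != 0.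
Proof.
have QE j : chart_dom j p -> (Q_field omega phi j (chart j p) != 0) =
  (quartic (phi j (chart j p)) != 0).
  move=> jp; have Dj : D j (chart j p) by exists p.
  rewrite /Q_field Q_at_quartic; [|exact: aw|exact: af|exact: r0].
  by rewrite mulf_eq0 (mulf_eq0 4) invr_eq0 sqrf_eq0 (negbTE (r0 Dj)) orbF pnatr_eq0.
move=> ip; split=> [[j jp sj]|Qi].
  rewrite (Q_chart ip jp) QE //; apply: stable_quartic_neq0 => //; apply: af; by exists p.
by exists i => //; apply: quartic_neq0_stable; [apply: af; exists p|rewrite -QE].
Qed.

End Main.

Theorem theorem3p7 (R : realType) (M : manifold R 6)
    (M_connected : connected [set: M])
    (omega : form_field M 2) (omega_symplectic : symplectic omega)
    (phi : form_field M 3) (phi_smooth : smooth_form phi)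
    (phi_primitive : primitive omega phi)
    (phi_integrable : d_integrable phi)
    (phi_F_integrable : F_integrable omega phi) :
  K_integrable omega phi /\
  Q_integrable omega phi /\
  ((forall p : M, stable_at phi p) \/ (forall p : M, ~ stable_at phi p)).
Proof.
have hQ := closed_Q_integrable omega_symplectic phi_smooth phi_integrable phi_F_integrable
  M_connected.
split; first exact: closed_K_integrable.
split; first exact: hQ.
have [c hc] := hQ.
have cov (p : M) : exists i, chart_dom i p.
  have : (\bigcup_i @chart_dom R 6 M i) p by rewrite chart_cover.
  by case=> i _ ip; exists i.
have [c0|c0] := eqVneq c 0.
  right=> p; have [i ip] := cov p.
  by rewrite (stable_atP omega_symplectic phi_smooth ip) hc // c0 eqxx.
left=> p; have [i ip] := cov p.
by apply/(stable_atP omega_symplectic phi_smooth ip); rewrite hc.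
Qed.
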